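(* Let $u \geq 0$ be an integer. Let $(w_n)_n, (h_n)_n, (\varepsilon_n)_n$ be sequences of real numbers such that $w_n = O(n^{\alpha_1})$, $h_n = O(n^{\alpha_2})$ and $\varepsilon_n = \Omega(n^{-\beta})$ for some real numbers $0 \leq \alpha_1, \alpha_2, \beta < 1$ satisfying \[ 2\alpha_1 + \alpha_2 < 1 - 2\beta. \] For each integer $n \geq 1$, let $M_n$ be a $(w_n, h_n, \varepsilon_n)$-balanced $n \times (n + u)$ random matrix with entries in $\mathbb{Z}$, and let $\operatorname{coker}(M_n) = \mathbb{Z}^n/M_n(\mathbb{Z}^{n+u})$. Then the distribution of $\operatorname{coker}(M_n)$ converges weakly to $\lambda_u$ as $n \to \infty$. In other words, if $Y \sim \lambda_u$, then for every positive integer $a$ and every abelian group $H$ with exponent dividing $a$ we have \[ \lim_{n\to\infty} \mathbb{P}[\operatorname{coker}(M_n) \otimes \mathbb{Z}/a\mathbb{Z} \cong H] = \mathbb{P}[Y \otimes \mathbb{Z}/a\mathbb{Z} \cong H]. \]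
   Context: Asymptotics: $w_n = O(n^{\alpha})$ means there is a constant $A$ independent of $n$ with $w_n \le A n^{\alpha}$ for all $n$; $\varepsilon_n = \Omega(n^{-\beta})$ means there is a constant $B>0$ independent of $n$ with $\varepsilon_n\ge Bn^{-\beta}$ for all $n$. Balanced random variables: for a group $G$, a $G$-valued random variable $X$ is $\varepsilon$-balanced if for every proper subgroup $H<G$ and every $g\in G$, $\mathbb{P}[X\in gH]\le 1-\varepsilon$. Partitions: a partition of a finite set $S$ is a collection $\mathcal{P}=\{P_1,\dots,P_k\}$ of nonempty subsets with $S=P_1\sqcup\dots\sqcup P_k$; write $|\mathcal{P}|=\max_i \#P_i$. Write $[n]=\{1,\dots,n\}$. For an $n\times m$ matrix $M$, $P\subset[n]$ and $Q\subset[m]$, $M_{P,Q}$ is the submatrix with rows indexed by $P$ and columns indexed by $Q$. Balanced matrices: an $n\times m$ random matrix $M$ with entries in a ring $R$ is $(w,h,\varepsilon)$-balanced if there are a partition $\mathcal{Q}=\{Q_1,\dots,Q_r\}$ of $[m]$ and a partition $\mathcal{P}=\{P_1,\dots,P_\ell\}$ of $[n]$ with $|\mathcal{Q}|\le w$, $|\mathcal{P}|\le h$, such that each random matrix $M_{P_i,Q_j}$ is $\varepsilon$-balanced in the additive abelian group $(R^{\#P_i})^{\#Q_j}$ and the random matrices $M_{P_i,Q_j}$ (over all $i,j$) are independent. The measure $\lambda_u$: let $Y=\prod_p Y_p$ (product over all primes), where the $Y_p$ are independent random finite abelian $p$-groups with \[ \mathbb{P}[Y_p\cong B]=\frac{1}{|B|^u|\operatorname{Aut}(B)|}\prod_{k=u+1}^\infty(1-p^{-k})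 \] for each finite abelian $p$-group $B$; $\lambda_u$ is the distribution of (the isomorphism class of) $Y$. Weak convergence: call an abelian group $X$ well-behaved if $X\otimes\mathbb{Z}/a\mathbb{Z}$ is finite for every positive integer $a$. The set of isomorphism classes of well-behaved abelian groups is given the topology with basis of open sets $U_{a,H}=\{X \mid X\otimes\mathbb{Z}/a\mathbb{Z}\cong H\}$, for $a$ a positive integer and $H$ a finite abelian group of exponent dividing $a$, and its Borel $\sigma$-algebra; weak convergence of distributions is with respect to this topology. *)

(* Defs.v *)
From HB Require Import structures.
From mathcomp Require Import all_boot all_order all_algebra all_fingroup.
From mathcomp Require Import finmap.
From mathcomp Require Import all_classical all_reals all_analysis.

Set Implicit Arguments.
Unset Strict Implicit.
Unset Printing Implicit Defensive.

Import Order.TTheory GRing.Theory Num.Theory.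
Import numFieldNormedType.Exports.

Local Open Scope classical_set_scope.
Local Open Scope ring_scope.

Section Asymptotics.
Variable R : realType.

(* One-sided, as for the sequences of the theorem; n = 0 is excluded because
   0 `^ alpha does not have the intended meaning. *)
Definition bigO_pow (w : nat -> R) (alpha : R) : Prop :=
  exists A : R, forall n, (0 < n)%N -> w n <= A * n%:R `^ alpha.

Definition bigOmega_pow (e : nat -> R) (alpha : R) : Prop :=
  exists2 B : R, 0 < B & forall n, (0 < n)%N -> B * n%:R `^ alpha <= e n.

End Asymptotics.

Section AbelianGroups.

Definition zmod_isom (X Y : zmodType) : Prop :=
  exists f : {additive X -> Y}, bijective f.

Definition is_subgroup (X : zmodType) (H : set X) : Prop :=
  H 0 /\ forall x y, H x -> H y -> H (x - y).

Definition biadditive (X Y Z : zmodType) (b : X -> Y -> Z) : Prop :=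
  (forall y, zmod_morphism (b^~ y)) /\ (forall x, zmod_morphism (b x)).

(* T is isomorphic to the tensor product of X and Y over the integers, i.e. T
   carries a universal biadditive map. *)
Definition tensor_isom (X Y T : zmodType) : Prop :=
  exists b : X -> Y -> T, biadditive b /\
    forall (Z : zmodType) (c : X -> Y -> Z), biadditive c ->
      exists f : {additive T -> Z},
        (forall x y, f (b x y) = c x y) /\
        (forall g : {additive T -> Z},
           (forall x y, g (b x y) = c x y) -> g =1 f).

(* For a > 0, 'I_a.-1.+1 is the additive group of integers modulo a, including
   a = 1 (for which 'Z_a would have two elements). *)
Definition tensor_Zmod (X : zmodType) (a : nat) (H : zmodType) : Prop :=
  tensor_isom X 'I_a.-1.+1 H.

Definition exponent_dvd (H : zmodType) (a : nat) : Prop :=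
  forall x : H, x *+ a = 0.

Definition well_behaved (X : zmodType) : Prop :=
  forall a, (0 < a)%N -> exists H : finZmodType, tensor_Zmod X a H.

End AbelianGroups.

Section Cokernel.
Variables (n m : nat) (M : 'M[int]_(n, m)).

Definition mx_image : {pred 'cV[int]_n} :=
  fun x => `[< exists y : 'cV[int]_m, x = M *m y >].

Lemma mx_image_zmod_closed : zmod_closed mx_image.
Proof.
split; first by apply/asboolP; exists 0; rewrite mulmx0.
move=> x y /asboolP[x' ->] /asboolP[y' ->].
by apply/asboolP; exists (x' - y'); rewrite mulmxBr.
Qed.

HB.instance Definition _ :=
  GRing.isZmodClosed.Build 'cV[int]_n mx_image mx_image_zmod_closed.

Definition coker : zmodType := Quotient.quot mx_image.

End Cokernel.

Section Product.
Variables (I : Type) (V : I -> zmodType).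

Definition dprod : Type := forall i, V i.

HB.instance Definition _ := gen_eqMixin dprod.
HB.instance Definition _ := gen_choiceMixin dprod.

Definition dprod_zero : dprod := fun i => 0.
Definition dprod_opp (x : dprod) : dprod := fun i => - x i.
Definition dprod_add (x y : dprod) : dprod := fun i => x i + y i.

Lemma dprod_addA : associative dprod_add.
Proof. by move=> x y z; apply: functional_extensionality_dep => i; exact: addrA. Qed.

Lemma dprod_addC : commutative dprod_add.
Proof. by move=> x y; apply: functional_extensionality_dep => i; exact: addrC. Qed.

Lemma dprod_add0 : left_id dprod_zero dprod_add.
Proof. by move=> x; apply: functional_extensionality_dep => i; exact: add0r. Qed.

Lemma dprod_addN : left_inverse dprod_zero dprod_opp dprod_add.
Proof. by move=> x; apply: functional_extensionality_dep => i; exact: addNr. Qed.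

HB.instance Definition _ := GRing.isZmodule.Build dprod
  dprod_addA dprod_addC dprod_add0 dprod_addN.

Definition product_group : zmodType := dprod.

End Product.

Section Probability.
Context d (T : measurableType d) (R : realType) (P : probability T R).

(* sigma-algebra generated by X when E carries the discrete sigma-algebra; here
   E is a countable group of integer matrices. *)
Definition sigma_discrete (E : Type) (X : T -> E) : set (set T) :=
  [set X @^-1` S | S in [set: set E]].

Definition discrete_rv (E : Type) (X : T -> E) : Prop :=
  sigma_discrete X `<=` measurable.

Definition mutually_independent (I : choiceType) (D : set I)
    (F : I -> set (set T)) : Prop :=
  forall (J : {fset I}) (E : I -> set T),
    (forall i, i \in J -> D i /\ F i (E i)) ->
    P (\bigcap_(i in [set` J]) E i) = (\prod_(i <- J) P (E i))%E.

Definition balanced (E : zmodType) (eps : R) (X : T -> E) : Prop :=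
  discrete_rv X /\
  forall (H : set E) (g : E), is_subgroup H -> H <> setT ->
    (P (X @^-1` [set (g + x)%R | x in H]) <= (1 - eps)%:E)%E.

Definition block (K : Type) (n m : nat) (A : {set 'I_n}) (B : {set 'I_m})
    (M : 'M[K]_(n, m)) : 'M[K]_(#|A|, #|B|) :=
  mxsub (@enum_val _ (mem A)) (@enum_val _ (mem B)) M.

Definition balanced_mx (K : nzRingType) (n m : nat) (w h eps : R)
    (M : T -> 'M[K]_(n, m)) : Prop :=
  discrete_rv M /\
  exists (QQ : {set {set 'I_m}}) (PP : {set {set 'I_n}}),
    [/\ finset.partition QQ [set: 'I_m]%SET /\
        finset.partition PP [set: 'I_n]%SET,
        (\max_(B in QQ) #|B|)%:R <= w /\ (\max_(A in PP) #|A|)%:R <= h,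
        (forall A B, A \in PP -> B \in QQ ->
           balanced eps (fun t => block A B (M t))) &
        mutually_independent [set AB | AB.1 \in PP /\ AB.2 \in QQ]
          (fun AB => sigma_discrete (fun t => block AB.1 AB.2 (M t)))].

(* The space of isomorphism classes of finite abelian groups is discrete: its
   Borel sets correspond to the isomorphism-invariant classes of groups. *)
Definition sigma_isom (Y : T -> finZmodType) : set (set T) :=
  [set E | exists C : zmodType -> Prop,
    (forall A B, zmod_isom A B -> C A -> C B) /\ E = [set t | C (Y t)]].

Definition primes_type : choiceType := {p : nat | prime p}.

Definition prime_of (p : primes_type) : nat := sval p.

(* Y p is the random p-group Y_p; lambda_u is the distribution of product_Y Y. *)
Definition lambda_family (u : nat) (Y : primes_type -> T -> finZmodType)
    : Prop :=
  [/\ forall p t, (prime_of p).-nat #|Y p t|,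
      forall p, sigma_isom (Y p) `<=` measurable,
      mutually_independent setT (fun p => sigma_isom (Y p)) &
      forall p (B : finZmodType), (prime_of p).-nat #|B| ->
        P [set t | zmod_isom (Y p t) B] =
        ((#|B|%:R ^+ u * #|Aut [set: B]%SET|%:R)^-1 *
         limn (fun N => \prod_(u.+1 <= k < N) (1 - (prime_of p)%:R ^- k) : R))%:E].

Definition product_Y (Y : primes_type -> T -> finZmodType) (t : T) : zmodType :=
  product_group (fun p => Y p t : zmodType).

End Probability.

(* The topology on well-behaved groups is expressed with predicates on
   zmodType: the latter is too large a type to be the carrier of a
   topologicalType. Open classes are automatically isomorphism-invariant on
   well-behaved groups. *)
Section WeakConvergence.
Variable R : realType.

Definition basic_open (a : nat) (H X : zmodType) : Prop :=
  well_behaved X /\ tensor_Zmod X a H.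

Definition wb_open (O : zmodType -> Prop) : Prop :=
  forall X, well_behaved X -> O X ->
    exists (a : nat) (H : finZmodType),
      [/\ (0 < a)%N, exponent_dvd H a, basic_open a H X &
          forall X', basic_open a H X' -> O X'].

Definition wb_continuous (f : zmodType -> R) : Prop :=
  forall V : set R, open V -> wb_open (fun X => V (f X)).

Definition wb_bounded (f : zmodType -> R) : Prop :=
  exists C : R, forall X, well_behaved X -> `|f X| <= C.

(* Borel-measurable random well-behaved group. *)
Definition random_wb_group d (T : measurableType d) (X : T -> zmodType)
    : Prop :=
  (forall t, well_behaved (X t)) /\
  forall O, wb_open O -> measurable [set t | O (X t)].

(* The integral of f against the distribution of X is the expectation of
   f o X. *)
Definition weak_convergence (d : nat -> measure_display)
    (T : forall n, measurableType (d n)) (P : forall n, probability (T n) R)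
    (X : forall n, T n -> zmodType)
    (d' : measure_display) (S : measurableType d') (Q : probability S R)
    (Y : S -> zmodType) : Prop :=
  [/\ forall n, random_wb_group (X n), random_wb_group Y &
      forall f : zmodType -> R, wb_bounded f -> wb_continuous f ->
        ('E_(P n)[(fun t => f (X n t))] @[n --> \oo]
           --> 'E_Q[(fun s => f (Y s))])%E].

End WeakConvergence.

(* Main.v *)
Require Import Defs.
From HB Require Import structures.
From mathcomp Require Import all_boot all_order all_algebra all_fingroup all_solvable all_field all_character.
From mathcomp Require Import finmap ring lra.
From mathcomp Require Import complex.

Set Implicit Arguments.
Unset Strict Implicit.
Unset Printing Implicit Defensive.

Import Order.TTheory GRing.Theory Num.Theory FinRing.Theory.

Local Open Scope ring_scope.

(** The method of moments. The moment of a random abelian group [X] at a finite abelian group [G] is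
    the expected number of surjections [X -> G]. The moments of [coker(M_n)] tend to [|G|^-u], the
    groups [Y] have the same moments, and finitely many moments control the law of [X/aX], which is
    [X] tensored with [Z/a].

    Moments of the cokernel. A surjection from the cokernel to [G] is a vector [F] in [G^n] that
    generates [G] and satisfies [F M = 0] ([card_sur_cokmod]). Column blocks are independent, and on
    each of them [F M] is a sum of independent contributions of the row blocks ([product_formula]).
    Fourier analysis shows that this sum is nearly uniform on [H^B] when [F] is robustly spread over
    the subgroup [H] ([walk_bounds]). Every [F] is spread over its core, a minimiser of the number
    of blocks leaving [H] plus [D |H|] ([core_code]). If the core is [G], then [P(F M = 0)] is close
    to [|G|^-(n+u)] ([law_code]). Otherwise a generating [F] has a block leaving its core, which
    gains a factor [1 - eps] for every column block ([law_escape]), and few vectors have a given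
    proper core ([card_core]). With [D] of order [n^((1 - alpha2)/2)] all errors vanish under
    [2 alpha1 + alpha2 < 1 - 2 beta] ([exponent_bounds], [moment_near]).

    From moments to probabilities. The indicator of [X ~ H] is the sum over surjections
    [phi : X -> H] of the indicator that [ker phi] is trivial, divided by [|Aut H|]. A group killed
    by [a] is trivial when it has no nonzero map to [Z/p] for [p] dividing [a]. The number of such
    maps is a power of [p], so a polynomial vanishing at [p, ..., p^m] detects triviality, with an
    error bounded by a small multiple of the number of surjections onto [(Z/p)^m]. Hence
    ([certificate]) the indicator is a finite combination of surjection counts, up to an error that
    is bounded by such a combination with arbitrarily small coefficients. The limiting moments are
    at most [1], so the error has small mean on both sides ([cokmod_cvg]).

    Moments of [Y]. Modulo [a] only the primes dividing [a] matter, and the product of these [Y_p]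
    is [B] with probability [weight |B| / |Aut B|] ([Yl_event]). Counting subgroups of free modules
    [(Z/b)^N] twice, with [N] tending to infinity, shows that such weights have moments [|G|^-u]
    ([part_mean_sur], [partial_sur_cvg]); the normalisation enters only through the total mass [1].

    Weak convergence. A continuous function varies little on most basic open sets of level [N!], so
    a bounded one is approximated by a class function of [X/N!X] supported on finitely many classes
    ([truncation_bound], [exists_tame]), for which the convergence of probabilities suffices. *)

HB.saturate prod.
HB.saturate finfun_of.

(** * Additive maps between finite abelian groups and their counts *)

Section ZmodMorphism.
Variables (X Y : zmodType) (f : X -> Y).
Hypothesis fB : zmod_morphism f.

Lemma zmorph0 : f 0 = 0. Proof. by rewrite -[X in f X](subrr 0) fB subrr. Qed.
Lemma zmorphN x : f (- x) = - f x. Proof. by rewrite -sub0r fB zmorph0 sub0r. Qed.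
Lemma zmorphD x y : f (x + y) = f x + f y.
Proof. by rewrite -[y in LHS]opprK fB zmorphN opprK. Qed.
Lemma zmorphMn x n : f (x *+ n) = f x *+ n.
Proof. by elim: n => [|n IH]; rewrite ?mulr0n ?zmorph0// !mulrS zmorphD IH. Qed.
Lemma zmorphMz x (n : int) : f (x *~ n) = f x *~ n.
Proof.
case: n => n; first exact: zmorphMn.
by rewrite !NegzE !mulrNz zmorphN zmorphMn.
Qed.
Lemma zmorph_sum I (r : seq I) (P : pred I) F :
  f (\sum_(i <- r | P i) F i) = \sum_(i <- r | P i) f (F i).
Proof. exact: (big_morph f zmorphD zmorph0). Qed.
End ZmodMorphism.

Lemma zmorph_comp (X Y Z : zmodType) (g : Y -> Z) (f : X -> Y) :
  zmod_morphism g -> zmod_morphism f -> zmod_morphism (g \o f).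
Proof. by move=> gB fB x y /=; rewrite fB gB. Qed.

Lemma zmorph_inv (X Y : zmodType) (f : X -> Y) g :
  zmod_morphism f -> cancel f g -> cancel g f -> zmod_morphism g.
Proof. by move=> fB fK gK x y; apply: (can_inj fK); rewrite fB !gK. Qed.

Section Homs.
Variables X Y : finZmodType.

(** Finite sets of finite functions, so that the numbers of homomorphisms, surjections and
    isomorphisms are cardinals that can be partitioned and double counted. *)
Definition hom : {set {ffun X -> Y}} :=
  [set f : {ffun X -> Y} | [forall x : X, forall y : X, f (x - y) == f x - f y]]%SET.
Definition sur : {set {ffun X -> Y}} :=
  [set f in hom | [forall y : Y, exists x : X, f x == y]]%SET.
Definition iso : {set {ffun X -> Y}} :=
  [set f in sur | injectiveb f]%SET.

Lemma homP (f : {ffun X -> Y}) : reflect (zmod_morphism f) (f \in hom).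
Proof.
rewrite inE; apply: (iffP forallP) => [h x y|h x].
  by have /forallP/(_ y)/eqP := h x.
by apply/forallP => y; rewrite h.
Qed.

Lemma surP (f : {ffun X -> Y}) :
  reflect (zmod_morphism f /\ forall y, exists x, f x = y) (f \in sur).
Proof.
rewrite inE; apply: (iffP andP) => -[/homP h s]; split=> //.
- by move=> y; have /forallP/(_ y)/existsP[x /eqP] := s; exists x.
- by apply/forallP => y; have [x <-] := s y; apply/existsP; exists x.
Qed.

Lemma isoP (f : {ffun X -> Y}) :
  reflect (zmod_morphism f /\ bijective f) (f \in iso).
Proof.
rewrite inE; apply: (iffP andP) => [[/surP[h s] /injectiveP i]|[h b]]; split=> //.
- have s' y : exists x, f x == y by have [x <-] := s y; exists x.
  exists (fun y => xchoose (s' y)) => [x|y]; last exact/eqP/(xchooseP (s' y)).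
  by apply: i; apply/eqP/(xchooseP (s' (f x))).
- by case: b => g _ gK; apply/surP; split=> // y; exists (g y).
- exact/injectiveP/bij_inj.
Qed.

Lemma sur_hom f : f \in sur -> f \in hom. Proof. by rewrite inE => /andP[]. Qed.
Lemma iso_sur f : f \in iso -> f \in sur. Proof. by rewrite inE => /andP[]. Qed.

Lemma hom0 : [ffun=> 0] \in hom.
Proof. by apply/homP => x y; rewrite !ffunE subr0. Qed.

End Homs.
Arguments hom : clear implicits.
Arguments sur : clear implicits.
Arguments iso : clear implicits.

Definition zisog (X Y : finZmodType) : bool := (0 < #|iso X Y|)%N.

Lemma zisogP (X Y : finZmodType) :
  reflect (exists2 f : X -> Y, zmod_morphism f & bijective f) (zisog X Y).
Proof.
rewrite /zisog card_gt0; apply: (iffP (set0Pn _)) => [[f /isoP[]]|[f fB bf]].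
  by exists f.
exists [ffun x => f x]; apply/isoP; split.
  by move=> x y; rewrite !ffunE fB.
by apply: (eq_bij bf) => x; rewrite ffunE.
Qed.

Lemma zisog_refl X : zisog X X.
Proof. by apply/zisogP; exists id => //; exists id. Qed.

Lemma zisog_sym X Y : zisog X Y = zisog Y X.
Proof.
suff h U V : zisog U V -> zisog V U by apply/idP/idP; apply: h.
move=> /zisogP[f fB [g fK gK]]; apply/zisogP; exists g; last by exists f.
exact: zmorph_inv fB fK gK.
Qed.

Lemma zisog_trans X Y Z : zisog X Y -> zisog Y Z -> zisog X Z.
Proof.
move=> /zisogP[f fB bf] /zisogP[g gB bg]; apply/zisogP; exists (g \o f).
  exact: zmorph_comp.
exact: bij_comp.
Qed.

Lemma zisog_card X Y : zisog X Y -> #|X| = #|Y|.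
Proof. by case/zisogP => f _ /bij_eq_card. Qed.

Section Precomp.
Variables (X Y Z : finZmodType).

Definition fcomp (g : {ffun Y -> Z}) (f : {ffun X -> Y}) : {ffun X -> Z} :=
  [ffun x => g (f x)].

Lemma fcomp_hom g f : g \in hom Y Z -> f \in hom X Y -> fcomp g f \in hom X Z.
Proof. by move=> /homP gB /homP fB; apply/homP => x y; rewrite !ffunE fB gB. Qed.

Lemma fcomp_sur g f : g \in sur Y Z -> f \in sur X Y -> fcomp g f \in sur X Z.
Proof.
move=> gs fs; apply/surP; split.
  by apply/homP/fcomp_hom; apply: sur_hom.
move=> z; have /surP[_ /(_ z)[y <-]] := gs.
by have /surP[_ /(_ y)[x <-]] := fs; exists x; rewrite ffunE.
Qed.

Lemma fcomp_surl g f : g \in hom Y Z -> fcomp g f \in sur X Z -> g \in sur Y Z.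
Proof.
move=> /homP gB /surP[_ s]; apply/surP; split => // z.
by have [x <-] := s z; exists (f x); rewrite ffunE.
Qed.

Lemma fcomp_iso g f : g \in iso Y Z -> f \in iso X Y -> fcomp g f \in iso X Z.
Proof.
move=> /isoP[gB bg] /isoP[fB bf]; apply/isoP; split.
  by apply/homP/fcomp_hom; apply/homP.
by apply: (eq_bij (bij_comp bg bf)) => x; rewrite ffunE.
Qed.

Lemma fcomp_injl f : f \in sur X Y -> injective (fcomp^~ f).
Proof.
move=> /surP[_ s] g h /ffunP e; apply/ffunP => y; have [x <-] := s y.
by have := e x; rewrite !ffunE.
Qed.

Lemma fcomp_injr g : g \in iso Y Z -> injective (fcomp g).
Proof.
move=> /isoP[_ /bij_inj ig] f h /ffunP e; apply/ffunP => x.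
by have := e x; rewrite !ffunE => /ig.
Qed.

End Precomp.

Lemma card_fcompl (X Y Z : finZmodType) : zisog Y Z ->
  (#|hom X Y| <= #|hom X Z|)%N /\ (#|sur X Y| <= #|sur X Z|)%N
   /\ (#|iso X Y| <= #|iso X Z|)%N.
Proof.
rewrite /zisog card_gt0 => /set0Pn[g gi]; have ig := @fcomp_injr X _ _ _ gi.
split; [|split]; rewrite -(card_imset _ ig);
  apply/subset_leq_card/subsetP => _ /imsetP[f hf ->].
- exact: fcomp_hom (sur_hom (iso_sur gi)) _.
- exact: fcomp_sur (iso_sur gi) _.
- exact: fcomp_iso.
Qed.

Lemma card_fcompr (X Y Z : finZmodType) : zisog X Y ->
  (#|hom Y Z| <= #|hom X Z|)%N /\ (#|sur Y Z| <= #|sur X Z|)%N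
   /\ (#|iso Y Z| <= #|iso X Z|)%N.
Proof.
rewrite /zisog card_gt0 => /set0Pn[g gi]; have ig := @fcomp_injl _ _ Z _ (iso_sur gi).
split; [|split]; rewrite -(card_imset _ ig);
  apply/subset_leq_card/subsetP => _ /imsetP[f hf ->].
- exact: fcomp_hom _ (sur_hom (iso_sur gi)).
- exact: fcomp_sur _ (iso_sur gi).
- exact: fcomp_iso.
Qed.

Lemma eq_card_isogr (X Y Z : finZmodType) : zisog Y Z ->
  [/\ #|hom X Y| = #|hom X Z|, #|sur X Y| = #|sur X Z| & #|iso X Y| = #|iso X Z|].
Proof.
move=> i; have [h1 [h2 h3]] := card_fcompl X i; rewrite zisog_sym in i.
have [k1 [k2 k3]] := card_fcompl X i.
by split; apply/eqP; rewrite eqn_leq ?h1 ?h2 ?h3.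
Qed.

Lemma eq_card_isogl (X Y Z : finZmodType) : zisog X Y ->
  [/\ #|hom X Z| = #|hom Y Z|, #|sur X Z| = #|sur Y Z| & #|iso X Z| = #|iso Y Z|].
Proof.
move=> i; have [h1 [h2 h3]] := card_fcompr Z i; rewrite zisog_sym in i.
have [k1 [k2 k3]] := card_fcompr Z i.
by split; apply/eqP; rewrite eqn_leq ?h1 ?h2 ?h3 ?k1 ?k2 ?k3.
Qed.

(** * Subgroups and quotients *)

Section Subgroups.
Variable X : finZmodType.
Implicit Types K L : {group X}.

Lemma zgroup0 K : 0 \in K. Proof. exact: group1. Qed.
Lemma zgroupD K x y : x \in K -> y \in K -> x + y \in K.
Proof. exact: groupM. Qed.
Lemma zgroupN K x : x \in K -> - x \in K.
Proof. by move=> xK; rewrite -zmodVgE groupV. Qed.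
Lemma zgroupB K x y : x \in K -> y \in K -> x - y \in K.
Proof. by move=> xK /zgroupN; apply: zgroupD. Qed.
Lemma zgroupMn K x n : x \in K -> x *+ n \in K.
Proof. by move=> xK; rewrite -zmodXgE groupX. Qed.

(** Total in [A], so that kernels and images are groups for any function; [mem_grp] recovers the
    expected membership once [A] is closed under subtraction. The lock prevents unfolding to the
    generated group. *)
Definition grp (A : {set X}) : {group X} := locked <<A>>%G.

Lemma mem_grp (A : {set X}) : zmod_closed (mem A) -> grp A =i A.
Proof.
move=> [A0 AB] x; rewrite /grp -lock /= gen_set_id //.
have AN y : y \in A -> - y \in A by move=> yA; rewrite -sub0r; apply: AB.
by apply/group_setP; split => // y z yA zA; rewrite zmodMgE -[z]opprK AB ?AN.
Qed.

Definition sg_pred K : {pred X} := fun x => x \in K.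

Lemma sg_pred_closed K : zmod_closed (sg_pred K).
Proof. by split; [apply: zgroup0 | move=> x y; apply: zgroupB]. Qed.

HB.instance Definition _ K :=
  GRing.isZmodClosed.Build X (sg_pred K) (sg_pred_closed K).

Definition subz K : predArgType := {x : X | sg_pred K x}.

HB.instance Definition _ K := Finite.on (subz K).
HB.instance Definition _ K := [isSub of subz K for sval].
HB.instance Definition _ K := [SubChoice_isSubZmodule of subz K by <:].

Lemma card_subz K : #|subz K| = #|K|.
Proof. by rewrite card_sig; apply: eq_card. Qed.

Lemma sval_zmorph K : zmod_morphism (sval : subz K -> X).
Proof. by []. Qed.

Lemma subz_in K (x : subz K) : sval x \in K.
Proof. exact: (svalP x). Qed.

Lemma subz_inj K : injective (sval : subz K -> X).
Proof. exact: val_inj. Qed.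

Lemma subzE K x : x \in K -> exists y : subz K, sval y = x.
Proof. by move=> xK; exists (exist _ x xK). Qed.

Definition quo L : predArgType := coset_of L.

HB.instance Definition _ L := Finite.on (quo L).

Lemma quo_surj L (a : quo L) : exists x : X, coset L x = a.
Proof. by have [x _ ->] := cosetP a; exists x. Qed.

Lemma in_norm L (x : X) : x \in 'N(L)%g.
Proof.
have /subsetP : [set: X]%SET \subset 'N(L)%g.
  by apply: cents_norm; apply/centsP => a _ b _; rewrite /commute !zmodMgE addrC.
by apply; rewrite inE.
Qed.

Definition quo_add L (a b : quo L) : quo L := (a * b)%g.
Definition quo_opp L (a : quo L) : quo L := (a^-1)%g.
Definition quo_zero L : quo L := 1%g.

Lemma quo_addA L : associative (@quo_add L).
Proof. exact: mulgA. Qed.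
Lemma quo_addC L : commutative (@quo_add L).
Proof.
move=> a b; have [x <-] := quo_surj a; have [y <-] := quo_surj b.
by rewrite /quo_add -!morphM ?in_norm // !zmodMgE addrC.
Qed.
Lemma quo_add0 L : left_id (@quo_zero L) (@quo_add L).
Proof. exact: mul1g. Qed.
Lemma quo_addN L : left_inverse (@quo_zero L) (@quo_opp L) (@quo_add L).
Proof. exact: mulVg. Qed.

HB.instance Definition _ L := GRing.isZmodule.Build (quo L)
  (@quo_addA L) (@quo_addC L) (@quo_add0 L) (@quo_addN L).

Definition pi_quo L (x : X) : quo L := coset L x.

Lemma pi_quoB L : zmod_morphism (pi_quo L).
Proof.
move=> x y; rewrite /pi_quo -zmodVgE -zmodMgE morphM ?in_norm //.
by rewrite morphV ?in_norm.
Qed.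

Lemma pi_quo_surj L (a : quo L) : exists x, pi_quo L x = a.
Proof. exact: quo_surj. Qed.

Lemma pi_quo_eq0 L x : (pi_quo L x == 0) = (x \in L).
Proof.
apply/eqP/idP => [h|xL]; last exact: coset_id.
by apply: coset_idr => //; exact: in_norm.
Qed.

Lemma card_quo L : (#|quo L| * #|L| = #|X|)%N.
Proof.
have -> : #|quo L| = #|([set: X] / L)%g|.
  rewrite -cardsT; apply: eq_card => a; rewrite inE; apply/esym.
  by have [x <-] := quo_surj a; rewrite mem_quotient ?inE.
rewrite card_quotient; last by apply/subsetP => x _; apply: in_norm.
by rewrite mulnC Lagrange ?subsetT // cardsT.
Qed.

End Subgroups.
Arguments pi_quo {X} L x.

Section Kernel.
Variables X Y : finZmodType.
Implicit Types f : {ffun X -> Y}.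

Definition kerz f : {group X} := grp [set x | f x == 0]%SET.

Lemma mem_kerz f x : f \in hom X Y -> (x \in kerz f) = (f x == 0).
Proof.
move=> /homP fB; rewrite mem_grp ?inE //; split; first by rewrite !inE (zmorph0 fB).
by move=> a b; rewrite !inE fB => /eqP-> /eqP->; rewrite subr0.
Qed.

Definition imz f : {group Y} := grp [set f x | x in X]%SET.

Lemma mem_imz f y : f \in hom X Y -> reflect (exists x, f x = y) (y \in imz f).
Proof.
move=> /homP fB; rewrite mem_grp; last first.
  split; first by apply/imsetP; exists (0:X); rewrite ?inE ?(zmorph0 fB).
  by move=> _ _ /imsetP[x _ ->] /imsetP[z _ ->]; apply/imsetP; exists (x - z) => //; rewrite fB.
by apply: (iffP imsetP) => [[x _ ->]|[x <-]]; exists x.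
Qed.

Lemma card_fiber f y : f \in sur X Y -> #|[set x | f x == y]%SET| = #|kerz f|.
Proof.
move=> /[dup] /sur_hom fh /surP[fB s]; have [x0 <-] := s y.
rewrite -[RHS](card_imset _ (addrI x0)); apply: eq_card => x.
rewrite inE; apply/eqP/imsetP => [e|[z]].
  exists (x - x0); last by rewrite addrC subrK.
  by rewrite mem_kerz // fB e subrr.
by rewrite mem_kerz // => /eqP z0 ->; rewrite (zmorphD fB) z0 addr0.
Qed.

Lemma card_ker_sur f : f \in sur X Y -> (#|Y| * #|kerz f| = #|X|)%N.
Proof.
move=> fs; rewrite -[RHS]sum1_card (partition_big f predT) //=.
rewrite (eq_bigr (fun=> #|kerz f|)) ?sum_nat_const // => y _.
by rewrite sum1dep_card -(card_fiber y fs); apply: eq_card => x; rewrite !inE.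
Qed.

Lemma ker_trivial_iso f : f \in sur X Y ->
  (f \in iso X Y) = [forall x, (x \in kerz f) ==> (x == 0)].
Proof.
move=> fs; rewrite inE fs /=; have fh := sur_hom fs; have /homP fB := fh.
apply/injectiveP/forallP => [i x|h x y e].
  by apply/implyP; rewrite mem_kerz // => /eqP fx; apply/eqP/i; rewrite (zmorph0 fB).
apply/eqP; rewrite -subr_eq0; have /implyP := h (x - y); apply.
by rewrite mem_kerz // fB e subrr.
Qed.

End Kernel.

(** Given a surjection [q], the homomorphisms vanishing on its kernel are those
    that factor through it. *)
Section Descent.
Variables X B Z : finZmodType.
Variable q : {ffun X -> B}.
Hypothesis qs : q \in sur X B.

(** Evaluates [f] at some preimage under [q]. The default [0] is only reached when [q] is not
    onto. *)
Definition descend (f : {ffun X -> Z}) : {ffun B -> Z} :=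
  [ffun b => f (odflt 0 [pick x | q x == b])].

Lemma descendK g : descend (fcomp g q) = g.
Proof.
apply/ffunP => b; rewrite !ffunE; case: pickP => [x /eqP->//|h].
by have /surP[_ /(_ b)[x e]] := qs; have := h x; rewrite e eqxx.
Qed.

Lemma descend_comp f : f \in hom X Z -> kerz q \subset kerz f ->
  fcomp (descend f) q = f.
Proof.
move=> fh /subsetP s; have qh := sur_hom qs.
apply/ffunP => x; rewrite !ffunE; case: pickP => [y /eqP e|/(_ x)]; last by rewrite eqxx.
have /homP qB := qh; have /homP fB := fh.
have : y - x \in kerz q by rewrite mem_kerz // qB e subrr.
by move=> /s; rewrite mem_kerz // fB subr_eq0 => /eqP.
Qed.

Lemma descend_hom f : f \in hom X Z -> kerz q \subset kerz f ->
  descend f \in hom B Z.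
Proof.
move=> fh s; have e := descend_comp fh s; apply/homP => a b.
have /surP[qB sq] := qs; have [x <-] := sq a; have [y <-] := sq b.
rewrite -qB; have /homP fB := fh; have := fB x y.
by rewrite -[in LHS]e -{2 3}e !ffunE.
Qed.

Lemma ker_fcomp (g : {ffun B -> Z}) : g \in hom B Z -> kerz q \subset kerz (fcomp g q).
Proof.
move=> gh; have qh := sur_hom qs; apply/subsetP => x; rewrite !mem_kerz ?fcomp_hom //.
by rewrite ffunE => /eqP->; have /homP gB := gh; rewrite (zmorph0 gB).
Qed.

Lemma sur_descend f : f \in sur X Z -> kerz q \subset kerz f ->
  descend f \in sur B Z.
Proof.
move=> fs s; apply: (@fcomp_surl _ _ _ _ q); first exact: descend_hom (sur_hom fs) s.
by rewrite descend_comp // (sur_hom fs).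
Qed.

Lemma card_hom_quo :
  #|[set f in hom X Z | kerz q \subset kerz f]%SET| = #|hom B Z|.
Proof.
rewrite -(card_imset _ (@fcomp_injl _ _ Z _ qs)); apply: eq_card => f.
rewrite inE; apply/andP/imsetP => [[fh s]|[g gh ->]].
  by exists (descend f); [exact: descend_hom|rewrite descend_comp].
by rewrite fcomp_hom ?(sur_hom qs) // ker_fcomp.
Qed.

Lemma big_sur_quo (R : Type) (idx : R) (op : Monoid.com_law idx)
    (F : {ffun B -> Z} -> R) :
  \big[op/idx]_(g in sur B Z) F g =
  \big[op/idx]_(f in sur X Z | kerz q \subset kerz f) F (descend f).
Proof.
rewrite [RHS](reindex_onto (fun g => fcomp g q) descend) /=; last first.
  by move=> f /andP[/sur_hom fh s]; rewrite descend_comp.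
apply: eq_big => [g|g _]; last by rewrite descendK.
rewrite descendK eqxx andbT; apply/idP/andP => [gs|[gs s]].
  by rewrite fcomp_sur // ker_fcomp // sur_hom.
by rewrite -[g]descendK; apply: sur_descend.
Qed.

(** Composition with [q] is the bijection: [g] is injective exactly when [g] after [q] has no larger
    kernel than [q]. *)
Lemma card_iso_quo :
  #|[set f in sur X Z | kerz f == kerz q :> {set X}]%SET| = #|iso B Z|.
Proof.
rewrite -(card_imset _ (@fcomp_injl _ _ Z _ qs)); apply: eq_card => f.
have qh := sur_hom qs; rewrite inE; apply/andP/imsetP => [[fs /eqP e]|[g gi ->]].
  have s : kerz q \subset kerz f by rewrite e.
  exists (descend f); last by rewrite descend_comp // sur_hom.
  have ds := sur_descend fs s; rewrite ker_trivial_iso //.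
  apply/forallP => b; apply/implyP; rewrite mem_kerz ?(sur_hom ds) //.
  have /surP[qB /(_ b)[x <-]] := qs.
  have := descend_comp (sur_hom fs) s => /ffunP/(_ x); rewrite ffunE => ->.
  by rewrite -mem_kerz ?(sur_hom fs) // e mem_kerz.
have gs := iso_sur gi; split; first exact: fcomp_sur.
have gh := sur_hom gs; have /isoP[gB /bij_inj ig] := gi.
apply/eqP/setP => x; rewrite !mem_kerz ?fcomp_hom // ffunE.
by rewrite -(inj_eq ig) (zmorph0 gB).
Qed.

End Descent.

Definition piz (X : finZmodType) (L : {group X}) : {ffun X -> quo L} :=
  [ffun x => pi_quo L x].

Lemma piz_sur (X : finZmodType) (L : {group X}) : piz L \in sur X (quo L).
Proof.
apply/surP; split=> [x y|a]; first by rewrite !ffunE pi_quoB.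
by have [x <-] := pi_quo_surj a; exists x; rewrite ffunE.
Qed.

Lemma ker_piz (X : finZmodType) (L : {group X}) : kerz (piz L) = L.
Proof.
apply/val_inj/setP => x /=.
by rewrite mem_kerz ?(sur_hom (piz_sur L)) // ffunE pi_quo_eq0.
Qed.

(** Surjections are sorted by their kernel [L]; those with kernel [L] are the isomorphisms out of
    [X/L]. *)
Lemma card_sur_quo (X G : finZmodType) :
  #|sur X G| = (\sum_(L : {group X}) #|iso (quo L) G|)%N.
Proof.
rewrite -sum1_card (partition_big (@kerz X G) predT) //=.
apply: eq_bigr => L _; rewrite -(card_iso_quo G (piz_sur L)) -sum1_card.
by apply: eq_bigl => f; rewrite inE ker_piz -val_eqE.
Qed.

Lemma zisog_sur_ker (X B Z : finZmodType) f g :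
  f \in sur X B -> g \in sur X Z -> kerz f = kerz g -> zisog B Z.
Proof.
move=> fs gs e; rewrite /zisog -(card_iso_quo Z fs) card_gt0; apply/set0Pn; exists g.
by rewrite inE gs e eqxx.
Qed.

Section MoreHoms.

Lemma zmorphP (X Y : zmodType) (f : X -> Y) :
  {morph f : x y / x + y} -> zmod_morphism f.
Proof.
move=> fD x y; have f0 : f 0 = 0.
  by apply: (addrI (f 0)); rewrite -fD !addr0.
by rewrite fD; congr (_ + _); apply: (addrI (f y)); rewrite -fD !subrr.
Qed.

Lemma card_iso_sym (X Y : finZmodType) : #|iso X Y| = #|iso Y X|.
Proof.
have [i|] := boolP (zisog X Y).
  by have [_ _ ->] := eq_card_isogl Y i; have [_ _ <-] := eq_card_isogr Y i.
move=> n; have := n; rewrite zisog_sym in n.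
by move: n; rewrite /zisog -!leqNgt !leqn0 => /eqP-> /eqP->.
Qed.

(** Homomorphisms are sorted by their image. *)
Lemma card_hom_im (X G : finZmodType) :
  #|hom X G| = (\sum_(H : {group G}) #|sur X (subz H)|)%N.
Proof.
rewrite -sum1_card (partition_big (@imz X G) predT) //=.
apply: eq_bigr => H _; rewrite sum1dep_card.
pose inc := fun f : {ffun X -> subz H} => [ffun x => sval (f x)] : {ffun X -> G}.
have inc_inj : injective inc.
  move=> f g /ffunP e; apply/ffunP => x; apply: subz_inj.
  by have := e x; rewrite !ffunE.
rewrite -[RHS](card_imset _ inc_inj); apply: eq_card => f; rewrite inE.
apply/andP/imsetP => [[fh /eqP e]|[g /surP[gB gs] ->]].
  have fin x : sg_pred H (f x) by rewrite /sg_pred -e; apply/mem_imz => //; exists x.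
  exists [ffun x => exist _ (f x) (fin x) : subz H].
    apply/surP; split=> [x y|y].
      by apply: subz_inj; rewrite !ffunE /=; have /homP -> := fh.
    have : sval y \in imz f by rewrite e; exact: subz_in.
    move=> /(mem_imz _ fh)[x ex].
    by exists x; apply: subz_inj; rewrite ffunE.
  by apply/ffunP => x; rewrite !ffunE.
have ih : inc g \in hom X G.
  by apply/homP => x y; rewrite !ffunE gB.
split=> //; apply/eqP/val_inj/setP => y /=.
apply/(mem_imz _ ih)/idP => [[x <-]|yH]; first by rewrite ffunE; apply: subz_in.
have [z <-] := subzE yH; have [x <-] := gs z.
by exists x; rewrite ffunE.
Qed.

Lemma card_hom_prodl (A B G : finZmodType) :
  #|hom (A * B)%type G| = (#|hom A G| * #|hom B G|)%N.
Proof.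
pose h := fun p : {ffun A -> G} * {ffun B -> G} =>
  [ffun x : A * B => p.1 x.1 + p.2 x.2] : {ffun (A * B)%type -> G}.
rewrite -cardsX; have hi : {in setX (hom A G) (hom B G) &, injective h}.
  move=> [f g] [f' g']; rewrite !in_setX /= => /andP[/homP fB /homP gB] /andP[/homP f'B /homP g'B].
  move=> /ffunP e; congr (_, _); apply/ffunP => x.
    by have := e (x, 0); rewrite !ffunE /= (zmorph0 gB) (zmorph0 g'B) !addr0.
  by have := e (0, x); rewrite !ffunE /= (zmorph0 fB) (zmorph0 f'B) !add0r.
rewrite -(card_in_imset hi); apply: eq_card => f.
apply/idP/imsetP => [/homP fB|[[g k]]].
  exists ([ffun x => f (x, 0)], [ffun x => f (0, x)]).
    by rewrite in_setX; apply/andP; split; apply/homP => x y; rewrite !ffunE /= -fB;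
      congr (f (_, _)); rewrite /= ?subr0.
  by apply/ffunP => -[x y]; rewrite !ffunE /= -(zmorphD fB);
    congr (f (_, _)); rewrite /= ?addr0 ?add0r.
rewrite in_setX /= => /andP[/homP gB /homP kB] ->; apply/homP => -[x y] [x' y'].
by rewrite !ffunE /= gB kB opprD addrACA.
Qed.

Lemma card_hom_prodr (A B G : finZmodType) :
  #|hom G (A * B)%type| = (#|hom G A| * #|hom G B|)%N.
Proof.
pose h := fun p : {ffun G -> A} * {ffun G -> B} =>
  [ffun x : G => (p.1 x, p.2 x)] : {ffun G -> (A * B)%type}.
have hi : injective h.
  move=> [f g] [f' g'] /ffunP e; congr (_, _); apply/ffunP => x;
  by have := e x; rewrite !ffunE /= => -[].
rewrite -cardsX -(card_imset _ hi); apply: eq_card => f.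
apply/idP/imsetP => [/homP fB|[[g k]]].
  exists ([ffun x => (f x).1], [ffun x => (f x).2]).
    by rewrite in_setX; apply/andP; split; apply/homP => x y; rewrite !ffunE /= fB.
  by apply/ffunP => x; rewrite !ffunE /=; case: (f x).
by rewrite in_setX /= => /andP[/homP gB /homP kB] ->; apply/homP => x y; rewrite !ffunE /= gB kB.
Qed.

End MoreHoms.

(** * The free modules [(Z/b)^N] *)

Section FreeModules.
Variable b : nat.
Hypothesis b_gt0 : (0 < b)%N.

Definition cyc : finZmodType := 'I_b.-1.+1.

Lemma mulrn_mod (G : zmodType) (x : G) n : x *+ b = 0 -> x *+ (n %% b) = x *+ n.
Proof.
by move=> xb; rewrite [in RHS](divn_eq n b) mulrnDr mulnC mulrnA xb mul0rn add0r.
Qed.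

Lemma card_cyc : #|cyc| = b.
Proof. by rewrite card_ord prednK. Qed.

Definition cyc_hom (G : finZmodType) (x : G) : {ffun cyc -> G} :=
  [ffun c : 'I_b.-1.+1 => x *+ c].

Lemma cyc_homP (G : finZmodType) (x : G) : x *+ b = 0 -> cyc_hom x \in hom cyc G.
Proof.
move=> xb; apply/homP/zmorphP => c d; rewrite !ffunE /= -mulrnDr.
by rewrite [X in (_ %% X)%N](prednK b_gt0) mulrn_mod.
Qed.

Definition cyc1 : cyc := inZp 1.

Lemma val_cyc1Mn n : \val (cyc1 *+ n) = (n %% b)%N.
Proof.
rewrite -[X in (_ %% X)%N](prednK b_gt0).
by elim: n => [|n IH]; rewrite ?mulr0n ?mod0n // mulrS /= IH modnDm add1n.
Qed.

Lemma cyc_mul1 (c : 'I_b.-1.+1) : (c : cyc) = cyc1 *+ c.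
Proof.
apply/val_inj; rewrite val_cyc1Mn modn_small //.
by rewrite -[X in (_ < X)%N](prednK b_gt0).
Qed.

Lemma cyc_exp (x : cyc) : x *+ b = 0.
Proof.
rewrite [x]cyc_mul1 -mulrnA mulnC mulrnA.
suff -> : cyc1 *+ b = 0 by rewrite mul0rn.
by apply/val_inj; rewrite val_cyc1Mn modnn.
Qed.

Lemma cyc_hom1 (G : finZmodType) (x : G) : x *+ b = 0 -> cyc_hom x cyc1 = x.
Proof.
move=> xb; rewrite ffunE /= (prednK b_gt0).
by rewrite mulrn_mod // mulr1n.
Qed.

Lemma card_hom_cyc (G : finZmodType) : (forall x : G, x *+ b = 0) ->
  #|hom cyc G| = #|G|.
Proof.
move=> Gb; have hi : injective (@cyc_hom G).
  by move=> x y e; rewrite -(cyc_hom1 (Gb x)) e cyc_hom1.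
rewrite -[RHS]cardsT -(card_imset _ hi); apply: eq_card => f.
apply/idP/imsetP => [/homP fB|[x _ ->]]; last exact: cyc_homP.
exists (f cyc1) => //; apply/ffunP => c; rewrite ffunE -(zmorphMn fB).
by rewrite -cyc_mul1.
Qed.

Fixpoint Xp (N : nat) : finZmodType :=
  if N is N'.+1 then (cyc * Xp N')%type else 'I_1.

Lemma card_Xp N : #|Xp N| = (b ^ N)%N.
Proof.
elim: N => [|N IH]; first by rewrite card_ord.
by rewrite card_prod IH card_ord (prednK b_gt0) expnS.
Qed.

Lemma Xp_exp N (x : Xp N) : x *+ b = 0.
Proof.
elim: N x => [|N IH] x; first by apply/val_inj; case: (_ *+ _) => -[].
case: x => x y; have -> : ((x, y) : Xp N.+1) *+ b = (x *+ b, y *+ b).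
  elim: (b) => // n IHn; rewrite !mulrS IHn //.
by rewrite cyc_exp IH.
Qed.

Lemma card_hom_Xp N (G : finZmodType) : (forall x : G, x *+ b = 0) ->
  #|hom (Xp N) G| = (#|G| ^ N)%N.
Proof.
move=> Gb; elim: N => [|N IH].
  rewrite expn0 -(cards1 ([ffun=> 0] : {ffun Xp 0 -> G})); apply: eq_card => f.
  rewrite in_set1; apply/homP/eqP => [fB|->]; last by move=> x y; rewrite !ffunE subr0.
  apply/ffunP => x; rewrite ffunE -(zmorph0 fB); congr (f _); apply/val_inj.
  by case: x => -[].
by rewrite /= card_hom_prodl IH card_hom_cyc // expnS.
Qed.

Lemma card_hom_to_Xp N (G : finZmodType) : #|hom G (Xp N)| = (#|hom G cyc| ^ N)%N.
Proof.
elim: N => [|N IH]; last by rewrite /= card_hom_prodr IH expnS.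
rewrite expn0 -(cards1 ([ffun=> 0] : {ffun G -> Xp 0})); apply: eq_card => f.
rewrite in_set1; apply/homP/eqP => [fB|->]; last by move=> x y; rewrite !ffunE subr0.
by apply/ffunP => x; apply/val_inj; rewrite ffunE; case: (f x) => -[].
Qed.

Lemma Xp_fstD N (x y : Xp N.+1) : (x + y).1 = x.1 + y.1. Proof. by []. Qed.
Lemma Xp_fstB N (x y : Xp N.+1) : (x - y).1 = x.1 - y.1. Proof. by []. Qed.
Lemma Xp_fstMn N (x : Xp N.+1) n : (x *+ n).1 = x.1 *+ n.
Proof. by elim: n => // n IH; rewrite !mulrS Xp_fstD IH. Qed.

(** The first coordinates of [K] form a subgroup of [Z/b], hence a cyclic one: an element of least
    nonzero first coordinate generates it, by division with remainder. *)
Lemma Xp_fst_gen N (K : {group Xp N.+1}) :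
  exists2 k0, k0 \in K & forall k, k \in K -> exists c : nat, k.1 = k0.1 *+ c.
Proof.
pose P := [pred k : Xp N.+1 | (k \in K) && (k.1 != 0)].
have [k1 Pk1|nP] := pickP P; last first.
  exists 0; first exact: zgroup0.
  move=> k kK; exists 0%N; rewrite mulr0n; apply/eqP.
  by have := nP k; rewrite /= kK /= => /negbFE.
pose v (k : Xp N.+1) := \val k.1.
case: (@arg_minnP _ k1 P v Pk1) => k0 /andP[k0K k0n] k0min.
exists k0 => // k kK; exists (v k %/ v k0)%N; apply/eqP; rewrite -subr_eq0.
have v0 : (0 < v k0)%N.
  by rewrite lt0n; apply: contraNneq k0n => e; apply/eqP/val_inj.
have e : k.1 - k0.1 *+ (v k %/ v k0) = cyc1 *+ (v k %% v k0).
  rewrite [k.1]cyc_mul1 [k0.1]cyc_mul1 -mulrnA.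
  rewrite [X in cyc1 *+ X](divn_eq (v k) (v k0)) mulnC mulrnDr.
  by rewrite addrAC subrr add0r.
apply/negPn/negP => n0.
have k'K : k - k0 *+ (v k %/ v k0) \in K by apply: zgroupB => //; apply: zgroupMn.
have := k0min (k - k0 *+ (v k %/ v k0)).
rewrite /= k'K -Xp_fstMn -Xp_fstB in n0 *.
rewrite n0 => /(_ isT); rewrite /v Xp_fstB Xp_fstMn e val_cyc1Mn.
rewrite leqNgt (leq_ltn_trans (leq_mod _ _)) // ltn_mod //.
Qed.

(** Subgroups of [(Z/b)^N] are generated by [N] elements. *)
Lemma sub_Xp_gen N (K : {group Xp N}) : exists T, T \in sur (Xp N) (subz K).
Proof.
elim: N K => [|N IH] K.
  exists [ffun=> 0]; apply/surP; split=> [x y|y]; first by rewrite !ffunE subr0.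
  exists 0; rewrite ffunE; apply/subz_inj/val_inj; case: (sval y) => -[] //=.
(* The elements of [K] with first coordinate [0] are left to the induction; one further generator
   [k0] takes care of the first coordinate. *)
pose K' : {group Xp N} := grp [set x | ((0, x) : Xp N.+1) \in K]%SET.
have mK' x : (x \in K') = (((0, x) : Xp N.+1) \in K).
  rewrite mem_grp ?inE //; split; first by rewrite !inE; apply: zgroup0.
  move=> y z; rewrite !inE => yK zK; have := zgroupB yK zK.
  by congr (_ \in K); congr (_, _); rewrite /= subrr.
have [T' /surP[T'B T's]] := IH K'.
have [k0 k0K k0g] := Xp_fst_gen K.
pose t (x : Xp N.+1) : Xp N.+1 := k0 *+ \val x.1 + (0, sval (T' x.2)).
have tK x : sg_pred K (t x).
  apply: zgroupD; first exact: zgroupMn.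
  by rewrite -mK'; apply: subz_in.
have hB := cyc_homP (Xp_exp k0).
exists [ffun x => exist _ (t x) (tK x) : subz K]; apply/surP; split.
  move=> x y; apply: subz_inj; rewrite !ffunE /= /t.
  have /homP/(_ x.1 y.1) := hB; rewrite !ffunE /= => ->.
  rewrite T'B opprD addrACA; congr (_ + _).
  by congr (_, _); rewrite /= ?subr0.
move=> y; have yK := subz_in y; have [c e] := k0g _ yK.
have y'K : sval y - k0 *+ c \in K by apply: zgroupB => //; apply: zgroupMn.
have e1 : (sval y - k0 *+ c).1 = 0 by rewrite Xp_fstB Xp_fstMn e subrr.
have ew : ((0, (sval y - k0 *+ c).2) : Xp N.+1) = sval y - k0 *+ c.
  by rewrite -e1; case: (_ - _).
have : (sval y - k0 *+ c).2 \in K' by rewrite mK' ew.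
move=> /subzE[z ez]; have [x ex] := T's z.
exists ((cyc1 *+ c : cyc), x); apply/subz_inj; rewrite ffunE.
transitivity (t (cyc1 *+ c, x)) => //.
by rewrite /t ex ez ew val_cyc1Mn mulrn_mod ?Xp_exp // addrC subrK.
Qed.

End FreeModules.

Lemma mulrn_card (G : finZmodType) (x : G) : x *+ #|G| = 0.
Proof.
rewrite -zmodXgE -cardsT; apply: expg_cardG; exact: in_setT.
Qed.

Lemma sur_exp (X Y : finZmodType) (f : {ffun X -> Y}) b : f \in sur X Y ->
  (forall x : X, x *+ b = 0) -> forall y : Y, y *+ b = 0.
Proof.
by move=> /surP[fB s] Xb y; have [x <-] := s y; rewrite -(zmorphMn fB) Xb (zmorph0 fB).
Qed.

Lemma subz_exp (X : finZmodType) (K : {group X}) b :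
  (forall x : X, x *+ b = 0) -> forall x : subz K, x *+ b = 0.
Proof. by move=> Xb x; apply: subz_inj; rewrite (zmorphMn (@sval_zmorph _ K)) Xb. Qed.

Lemma zisog_subzT (G : finZmodType) (H : {group G}) : H = [set: G]%SET :> {set G} ->
  zisog (subz H) G.
Proof.
move=> HT; apply/zisogP; exists sval; first exact: sval_zmorph.
have gP x : sg_pred H x by rewrite /sg_pred HT inE.
by exists (fun x => exist _ x (gP x)) => [x|x] //; apply: subz_inj.
Qed.

Lemma card_proper_sub (G : finZmodType) (H : {group G}) :
  H != [set: G]%SET :> {set G} -> (#|H| <= #|G|./2)%N.
Proof.
move=> nT; have := card_quo H; case e: #|quo H| => [|[|k]].
- by have : (0 < #|quo H|)%N by [apply/card_gt0P; exists 0]; rewrite e.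
- rewrite mul1n => eG; case/negP: nT; rewrite eqEcard subsetT cardsT eG leqnn //.
- by move=> <-; rewrite -[#|H| in X in (X <= _)%N]doubleK half_leq // -mul2n leq_mul2r !ltnS orbT.
Qed.

(** * Extensions, and transfer of sums between quotients of two groups *)

Section ImageOfSubgroup.
Variables (X : finZmodType) (K : {group X}) (L : {group (subz K : finZmodType)}).

Definition imsub : {group X} := grp [set sval x | x : subz K in L]%SET.

Let imsub_closed : zmod_closed (mem [set sval x | x : subz K in L]%SET).
Proof.
split; first by apply/imsetP; exists (0 : subz K) => //; apply: zgroup0.
move=> _ _ /imsetP[y yL ->] /imsetP[z zL ->].
by apply/imsetP; exists (y - z) => //; apply: zgroupB.
Qed.

Lemma mem_imsub (x : subz K) : (sval x \in imsub) = (x \in L).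
Proof.
rewrite mem_grp //; apply/imsetP/idP => [[y yL /subz_inj->//]|xL].
by exists x.
Qed.

Lemma imsub_sub : imsub \subset K.
Proof.
apply/subsetP => x; rewrite mem_grp // => /imsetP[y _ ->]; exact: subz_in.
Qed.

End ImageOfSubgroup.

Section Kappa.

(** [kappa H V B] counts the short exact sequences [0 -> V -> B -> H -> 0]. *)
Definition kappa (H V B : finZmodType) : nat :=
  (\sum_(psi in sur B H) #|iso (subz (kerz psi)) V|)%N.

Variables H V : finZmodType.

Section Q2.
Variable X : finZmodType.
Variable phi : {ffun X -> H}.
Hypothesis phis : phi \in sur X H.
Variable L : {group X}.
Hypothesis LK : L \subset kerz phi.

Let psi := descend (piz L) phi.
Let psis : psi \in sur (quo L) H.
Proof. by apply: sur_descend; rewrite ?piz_sur ?ker_piz. Qed.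
Let psiE x : psi (piz L x) = phi x.
Proof.
have /ffunP/(_ x) : fcomp psi (piz L) = phi.
  by apply: descend_comp; rewrite ?piz_sur ?ker_piz ?sur_hom.
by rewrite ffunE.
Qed.

Let qP (x : subz (kerz phi)) : sg_pred (kerz psi) (piz L (sval x)).
Proof.
rewrite /sg_pred mem_kerz ?(sur_hom psis) // psiE -mem_kerz ?(sur_hom phis) //.
exact: subz_in.
Qed.
Let q : {ffun subz (kerz phi) -> subz (kerz psi)} :=
  [ffun x => exist _ (piz L (sval x)) (qP x)].

Let qs : q \in sur (subz (kerz phi)) (subz (kerz psi)).
Proof.
have /surP[pB ps] := piz_sur L; apply/surP; split=> [x y|y].
  by apply: subz_inj; rewrite ![q _]ffunE; exact: (pB (sval x) (sval y)).
have := subz_in y; have [x ex] := ps (sval y).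
rewrite -ex mem_kerz ?(sur_hom psis) // psiE -mem_kerz ?(sur_hom phis) //.
by move=> /subzE[z ez]; exists z; apply: subz_inj; rewrite [q _]ffunE /= ez ex.
Qed.

Definition ker_in (chi : {ffun subz (kerz phi) -> V}) : {group X} :=
  imsub (kerz chi).

(** The kernel of the map [X/L -> H] induced by [phi] is [ker phi / L], so a surjection
    [ker phi -> V] with kernel [L] is the same as an isomorphism from that kernel to [V]. *)
Lemma card_sur_ker_in :
  #|[set chi in sur (subz (kerz phi)) V | ker_in chi == L]%SET| =
  #|iso (subz (kerz psi)) V|.
Proof.
rewrite -(card_iso_quo V qs); apply: eq_card => chi; rewrite [LHS]in_set [RHS]in_set.
case cs : (chi \in sur _ V) => //=; have ch := sur_hom cs.
have kq x : (x \in kerz q) = (sval x \in L).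
  rewrite mem_kerz ?(sur_hom qs) // ffunE -(inj_eq (@subz_inj _ _)) /=.
  by rewrite -mem_kerz ?ker_piz ?sur_hom ?piz_sur.
apply/eqP/eqP => [e|/setP e].
  by apply/setP => x; rewrite -mem_imsub -/(ker_in chi) e kq.
apply/val_inj/setP => x /=; have [xK|xK] := boolP (x \in kerz phi).
  by have [y <-] := subzE xK; rewrite mem_imsub e kq.
rewrite [RHS](contraNF _ xK); last by move=> xL; move/subsetP: LK; apply.
by apply: contraNF xK; apply/subsetP/imsub_sub.
Qed.

End Q2.

(** A pair [(phi, chi)] is sorted by the kernel [L] of [chi], a subgroup of [X]: it is then a way of
    writing [X/L] as an extension of [H] by [V]. *)
Lemma kappa_sum (X : finZmodType) :
  (\sum_(phi in sur X H) #|sur (subz (kerz phi)) V| =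
   \sum_(L : {group X}) kappa H V (quo L))%N.
Proof.
under [RHS]eq_bigr => L _ do rewrite /kappa (big_sur_quo (piz_sur L)).
rewrite (exchange_big_dep (fun phi => phi \in sur X H)) /=; last by move=> L phi _ /andP[].
apply: eq_bigr => phi phis; rewrite -sum1_card.
rewrite (partition_big (@ker_in X phi) (fun L : {group X} => L \subset kerz phi)) /=.
  apply: eq_big => [L|L LK]; first by rewrite phis ker_piz.
  by rewrite -(card_sur_ker_in phis LK) -sum1_card; apply: eq_bigl => chi; rewrite !inE.
by move=> chi _; apply: imsub_sub.
Qed.

Lemma kappa_card B : (kappa H V B != 0)%N -> #|B| = (#|H| * #|V|)%N.
Proof.
move=> n0; have [psi /andP[ps]|h] := pickP [pred psi | (psi \in sur B H) && (#|iso (subz (kerz psi)) V| != 0)%N].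
  rewrite -lt0n => i; rewrite -(card_ker_sur ps) -(card_subz (kerz psi)).
  by rewrite (zisog_card i).
case/negP: n0; rewrite /kappa big1 // => psi ps.
by have := h psi; rewrite /= ps /= => /negbFE/eqP.
Qed.

End Kappa.

Lemma zisog_subz (X Y : finZmodType) (f : X -> Y) (K : {group X}) (K' : {group Y}) :
  zmod_morphism f -> bijective f -> (forall x, (f x \in K') = (x \in K)) ->
  zisog (subz K) (subz K').
Proof.
move=> fB [g fK gK] h.
have h1 (x : subz K) : sg_pred K' (f (sval x)) by rewrite /sg_pred h; apply: subz_in.
have h2 (x : subz K') : sg_pred K (g (sval x)).
  by rewrite /sg_pred -h gK; apply: subz_in.
apply/zisogP; exists (fun x => exist _ (f (sval x)) (h1 x)).
  by move=> x y; apply: subz_inj => /=; apply: fB.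
by exists (fun x => exist _ (g (sval x)) (h2 x)) => x; apply: subz_inj => /=.
Qed.

Lemma kappa_iso H V B C : zisog B C -> kappa H V B = kappa H V C.
Proof.
move=> /[dup]; rewrite {1}/zisog card_gt0 => /set0Pn[g gi] iBC; have gs := iso_sur gi.
have /isoP[gB gb] := gi; have gh := sur_hom gs.
rewrite /kappa [RHS](big_sur_quo gs); apply: eq_big => [f|f fs].
  rewrite andb_idr // => fs; apply/subsetP => x; rewrite mem_kerz // -(zmorph0 gB).
  by rewrite (inj_eq (bij_inj gb)) => /eqP->; apply: zgroup0.
have kk : kerz g \subset kerz f.
  apply/subsetP => x; rewrite mem_kerz // -(zmorph0 gB).
  by rewrite (inj_eq (bij_inj gb)) => /eqP->; apply: zgroup0.
suff i : zisog (subz (kerz f)) (subz (kerz (descend g f))) by have [_ _ ->] := eq_card_isogl V i.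
apply: (zisog_subz gB gb) => x.
have fh := sur_hom fs.
rewrite !mem_kerz ?(sur_hom (sur_descend gs fs kk)) //.
by have := descend_comp gs fh kk => /ffunP/(_ x); rewrite [LHS]ffunE => ->.
Qed.

Section Transfer.
Variable R : numFieldType.
Implicit Types F : finZmodType -> R.

(** Quotients of [X0] are a (redundant) system of representatives for the groups
    of order [n] that are quotients of [X]. *)
Lemma sum_quo_transfer F (X X0 : finZmodType) n :
  (forall B C, zisog B C -> F B = F C) ->
  (forall L : {group X}, #|quo L| = n -> (0 < #|sur X0 (quo L)|)%N) ->
  \sum_(L : {group X} | #|quo L| == n) F (quo L) =
  \sum_(L0 : {group X0} | #|quo L0| == n)
     F (quo L0) / #|sur X0 (quo L0)|%:R * #|sur X (quo L0)|%:R.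
Proof.
move=> Fi hs.
(* [F (X/L)] is distributed over the [L0] whose quotient is isomorphic to [X/L]: the isomorphisms
   from these quotients to [X/L] add up to all surjections [X0 -> X/L]. *)
have step (L : {group X}) : #|quo L| == n -> F (quo L) =
    \sum_(L0 : {group X0} | #|quo L0| == n)
      F (quo L0) / #|sur X0 (quo L0)|%:R * #|iso (quo L) (quo L0)|%:R.
  move=> /eqP Ln; have s0 := hs L Ln.
  have e (L0 : {group X0}) : #|quo L0| == n ->
      F (quo L0) / #|sur X0 (quo L0)|%:R * #|iso (quo L) (quo L0)|%:R =
      F (quo L) / #|sur X0 (quo L)|%:R * #|iso (quo L0) (quo L)|%:R.
    move=> _; rewrite card_iso_sym; have [i|] := boolP (zisog (quo L0) (quo L)).
      by rewrite (Fi _ _ i); have [_ -> _] := eq_card_isogr X0 i.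
    by rewrite /zisog -leqNgt leqn0 => /eqP->; rewrite !mulr0.
  rewrite (eq_bigr _ e) -mulr_sumr -natr_sum.
  suff -> : (\sum_(L0 : {group X0} | #|quo L0| == n) #|iso (quo L0) (quo L)| =
            #|sur X0 (quo L)|)%N.
    by rewrite mulfVK // pnatr_eq0 -lt0n.
  rewrite card_sur_quo [RHS](bigID (fun L0 : {group X0} => #|quo L0| == n)) /=.
  rewrite [X in (_ + X)%N]big1 ?addn0 // => L0 nL0; apply/eqP; rewrite -leqn0 leqNgt.
  by apply: contra nL0 => /zisog_card ->; rewrite Ln.
rewrite (eq_bigr _ step) exchange_big /=; apply: eq_bigr => L0 /eqP e0.
rewrite -mulr_sumr; congr (_ * _); rewrite -natr_sum; congr (_%:R).
rewrite card_sur_quo [RHS](bigID (fun L : {group X} => #|quo L| == n)) /=.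
rewrite [X in (_ + X)%N]big1 ?addn0 // => L nL; apply/eqP; rewrite -leqn0 leqNgt.
by apply: contra nL => /zisog_card ->; rewrite e0.
Qed.

End Transfer.

(** * Surjections from free modules and from their subgroups *)

Section SurXp.
Variable b : nat.
Hypothesis b_gt0 : (0 < b)%N.

(** [K] is a quotient of the free module, so its surjections inject into the [#|V| ^ N]
    homomorphisms from the latter. *)
Lemma card_sur_sub_Xp N (K : {group Xp b N}) (V : finZmodType) :
  (forall x : V, x *+ b = 0) -> (#|sur (subz K) V| <= #|V| ^ N)%N.
Proof.
move=> Vb; have [T Ts] := sub_Xp_gen b_gt0 K.
rewrite -(card_hom_Xp b_gt0 N Vb) -(card_imset _ (@fcomp_injl _ _ V _ Ts)).
apply/subset_leq_card/subsetP => _ /imsetP[f fs ->].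
by apply: sur_hom; apply: fcomp_sur.
Qed.

Lemma card_sur_Xp_le N (G : finZmodType) : (forall x : G, x *+ b = 0) ->
  (#|sur (Xp b N) G| <= #|G| ^ N)%N.
Proof.
move=> Gb; rewrite -(card_hom_Xp b_gt0 N Gb).
by apply/subset_leq_card/subsetP => f; apply: sur_hom.
Qed.

(** A homomorphism that is not onto lands in one of at most [2 ^ #|G|] proper subgroups, each of
    order at most [#|G| / 2]. Everything is multiplied by [2 ^ N] to stay within the naturals. *)
Lemma card_sur_Xp_ge N (G : finZmodType) : (forall x : G, x *+ b = 0) ->
  (#|G| ^ N * 2 ^ N <= #|sur (Xp b N) G| * 2 ^ N + 2 ^ #|G| * #|G| ^ N)%N.
Proof.
move=> Gb; case: N => [|N].
  by rewrite !expn0 !muln1 (leq_trans _ (leq_addl _ _)) ?expn_gt0.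
have H1 : (#|G| ^ N.+1 <= #|sur (Xp b N.+1) G| + 2 ^ #|G| * (#|G|./2) ^ N.+1)%N.
  rewrite -[leqLHS](card_hom_Xp b_gt0 N.+1 Gb) card_hom_im.
  rewrite (bigID (fun H : {group G} => H == [set: G]%SET :> {set G})) /= leq_add //.
    have -> : (\sum_(H : {group G} | (H == [set: G]%SET :> {set G})) #|sur (Xp b N.+1) (subz H)| =
      \sum_(H : {group G} | H == [set: G]%G) #|sur (Xp b N.+1) G|)%N.
      apply: eq_big => // H /eqP HT.
      by have [_ -> _] := eq_card_isogr (Xp b N.+1) (zisog_subzT HT).
    by rewrite big_pred1_eq.
  apply: (@leq_trans (\sum_(H : {group G}) #|G|./2 ^ N.+1)%N).
    rewrite [leqLHS]big_mkcond; apply: leq_sum => H _; case: ifP => // nT.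
    apply: leq_trans (card_sur_Xp_le N.+1 (@subz_exp _ H _ Gb)) _.
    by rewrite leq_exp2r // card_subz card_proper_sub.
  rewrite sum_nat_const leq_mul2r; apply/orP; right.
  rewrite -cardsT -(card_imset _ val_inj) /=.
  apply: leq_trans (subset_leq_card (subsetT _)) _.
  by rewrite -powersetT card_powerset cardsT.
apply: (@leq_trans ((#|sur (Xp b N.+1) G| + 2 ^ #|G| * #|G|./2 ^ N.+1) * 2 ^ N.+1)%N).
  by rewrite leq_mul2r H1 orbT.
rewrite mulnDl leq_add2l -mulnA leq_mul2l -expnMn; apply/orP; right.
rewrite leq_exp2r // muln2 -[leqRHS]odd_double_half; exact: leq_addl.
Qed.

End SurXp.

Lemma corestr (X Y : finZmodType) (f : {ffun X -> Y}) : f \in hom X Y ->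
  exists2 g : {ffun X -> subz (imz f)}, g \in sur X (subz (imz f)) &
    forall x, sval (g x) = f x.
Proof.
move=> fh; have /homP fB := fh.
have fP x : sg_pred (imz f) (f x) by apply/(mem_imz _ fh); exists x.
exists [ffun x => exist _ (f x) (fP x)]; last by move=> x; rewrite ffunE.
apply/surP; split=> [x y|y]; first by apply: subz_inj; rewrite !ffunE /= fB.
have := subz_in y => /(mem_imz _ fh)[x ex].
by exists x; apply: subz_inj; rewrite ffunE.
Qed.

Lemma card_im_ker (X Y : finZmodType) (f : {ffun X -> Y}) : f \in hom X Y ->
  (#|imz f| * #|kerz f| = #|X|)%N.
Proof.
move=> fh; have [g gs ge] := corestr fh.
rewrite -(card_ker_sur gs) card_subz; congr (_ * _)%N; apply: eq_card => x.
by rewrite !mem_kerz ?(sur_hom gs) // -(inj_eq (@subz_inj _ _)) ge.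
Qed.

Definition mulz (X : finZmodType) (v : nat) : {ffun X -> X} := [ffun x => x *+ v].

Lemma mulz_hom X v : mulz X v \in hom X X.
Proof. by apply/homP => x y; rewrite !ffunE mulrnBl. Qed.

Lemma mem_im_mulz (X : finZmodType) v (y : X) :
  reflect (exists x, x *+ v = y) (y \in imz (mulz X v)).
Proof.
by apply: (iffP (mem_imz y (mulz_hom X v))) => -[x e]; exists x; rewrite -e ffunE.
Qed.

Lemma mem_ker_mulz (X : finZmodType) v (y : X) :
  (y \in kerz (mulz X v)) = (y *+ v == 0).
Proof. by rewrite mem_kerz ?mulz_hom // ffunE. Qed.

Section KernelOfFree.
Variable b : nat.
Hypothesis b_gt0 : (0 < b)%N.

Lemma Xp_divisible N v c (x : Xp b N) : (v * c)%N = b -> x *+ v = 0 ->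
  exists y, x = y *+ c.
Proof.
move=> vc; have v0 : (0 < v)%N by move: b_gt0; rewrite -vc muln_gt0 => /andP[].
elim: N x => [|N IH] x xv; first by exists 0; apply/val_inj; case: x {xv} => -[] //= _; rewrite mul0rn.
have x2v : x.2 *+ v = 0.
  have <- : (x *+ v).2 = x.2 *+ v by elim: (v) => // k IHk; rewrite !mulrS -IHk.
  by rewrite xv.
have [y2 e2] := IH _ x2v.
have x1v : x.1 *+ v = 0 by rewrite -Xp_fstMn xv.
have [y1 e1] : exists y, x.1 = y *+ c.
  have d : (c %| \val x.1)%N.
    have : (b %| \val x.1 * v)%N.
      rewrite /dvdn -(val_cyc1Mn b_gt0) mulrnA -(cyc_mul1 b_gt0).
      by rewrite x1v.
    by rewrite -{1}vc mulnC dvdn_pmul2r.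
  exists (cyc1 b *+ (\val x.1 %/ c)).
  by rewrite -mulrnA divnK // -(cyc_mul1 b_gt0).
exists ((y1, y2) : Xp b N.+1).
have -> : ((y1, y2) : Xp b N.+1) *+ c = (y1 *+ c, y2 *+ c).
  by elim: (c) => // k IHk; rewrite !mulrS IHk.
by rewrite -e1 -e2; case: (x).
Qed.

(** The kernel of a surjection from [(Z/b)^N] behaves like a free module of rank
    [N] with respect to groups of small order, as a sublattice of finite index in
    [Z^N] would. *)
Lemma card_hom_ker_Xp N (H V : finZmodType) (phi : {ffun Xp b N -> H}) :
  phi \in sur (Xp b N) H -> (#|H| * #|V| %| b)%N ->
  #|hom (subz (kerz phi)) V| = (#|V| ^ N)%N.
Proof.
move=> ps; have ph := sur_hom ps; set X := Xp b N; set K := kerz phi.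
set v := #|V|; case/dvdnP => c' eb; have vc : (v * (c' * #|H|))%N = b.
  by rewrite eb mulnCA [in RHS]mulnA [(v * _)%N]mulnC mulnA.
have Vb (x : V) : x *+ b = 0 by rewrite -vc mulrnA mulrn_card mul0rn.
have [T Ts] := sub_Xp_gen b_gt0 K; have Th := sur_hom Ts; have /homP TB := Th.
(* The [v]-torsion of [X] consists of multiples of [c' * #|H|], which [phi] kills; so [K] and [X]
   have the same [v]-torsion. *)
have vK (x : X) : x *+ v = 0 -> x \in K.
  move=> /(Xp_divisible vc)[y ->]; rewrite mem_kerz //; have /homP pB := ph.
  by rewrite (zmorphMn pB) mulnC mulrnA mulrn_card mul0rn.
set vKK := imz (mulz (subz K) v).
have Kv : #|kerz (mulz (subz K) v)| = #|kerz (mulz X v)|.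
  rewrite -(card_imset _ (@subz_inj _ K)); apply: eq_card => x.
  apply/imsetP/idP => [[y]|]; rewrite mem_ker_mulz.
    by move=> /eqP e ->; rewrite mem_ker_mulz -(zmorphMn (@sval_zmorph _ K)) e.
  move=> /eqP xv; have [y ey] := subzE (vK _ xv); exists y => //.
  by rewrite mem_ker_mulz -(inj_eq (@subz_inj _ K)) (zmorphMn (@sval_zmorph _ K)) ey xv.
pose g := fcomp (piz vKK) T.
have gs : g \in sur X (quo vKK) by apply: fcomp_sur; rewrite ?piz_sur.
have gk x : (x \in kerz g) = (T x \in vKK).
  by rewrite mem_kerz ?(sur_hom gs) // ffunE ffunE pi_quo_eq0.
have vXg : imz (mulz X v) \subset kerz g.
  apply/subsetP => x /mem_im_mulz[y <-]; rewrite gk (zmorphMn TB).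
  by apply/mem_im_mulz; exists (T y).
have t0 : (0 < #|kerz (mulz X v)|)%N by apply/card_gt0P; exists 0; apply: zgroup0.
have q0 : (0 < #|vKK|)%N by apply/card_gt0P; exists 0; apply: zgroup0.
have cX := card_im_ker (mulz_hom X v); have cK := card_im_ker (mulz_hom (subz K) v).
have cg := card_ker_sur gs; have cq := card_quo vKK.
(* [v X] lies in the kernel of [g] and has the same index, since [[X : vX]] and [[K : vK]] are both
   the order of the common [v]-torsion. As a map [X -> V] kills [v X], it then kills the kernel of
   [T] and factors through [T]. *)
have eg : imz (mulz X v) =i kerz g.
  apply/subset_cardP => //; apply/eqP; rewrite -(eqn_pmul2r t0) cX -cg.
  rewrite -(eqn_pmul2l q0) mulnA [(#|vKK| * _)%N]mulnC cq -cK Kv -/vKK.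
  by rewrite -mulnA [(_ * #|kerz g|)%N]mulnC.
rewrite -(card_hom_quo V Ts) -(card_hom_Xp b_gt0 N Vb); apply: eq_card => f.
rewrite [LHS]in_set andb_idr // => fh; apply/subsetP => x xT.
have : x \in kerz g.
  by rewrite gk; move: xT; rewrite mem_kerz // => /eqP->; apply: zgroup0.
rewrite -eg => /mem_im_mulz[y <-]; rewrite mem_kerz //; have /homP fB := fh.
by rewrite (zmorphMn fB) mulrn_card.
Qed.

(** Induction on the order of [V]: the counts of all homomorphisms agree by [card_hom_ker_Xp], and
    those of surjections onto proper subgroups agree by induction. *)
Lemma card_sur_ker_Xp N (H V : finZmodType) (phi : {ffun Xp b N -> H}) :
  phi \in sur (Xp b N) H -> (#|H| * #|V| %| b)%N ->
  #|sur (subz (kerz phi)) V| = #|sur (Xp b N) V|.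
Proof.
move=> ps; have [k] := ubnP #|V|; elim: k V => // k IH V lt dv.
have Vb (x : V) : x *+ b = 0.
  by case/dvdnP: dv => c ->; rewrite mulnA mulnC mulrnA mulrn_card mul0rn.
have := card_hom_ker_Xp ps dv; rewrite -(card_hom_Xp b_gt0 N Vb) !card_hom_im.
rewrite !(bigD1 (P := xpredT) [set: V]%G) //=.
have -> : (\sum_(H0 : {group V} | H0 != [set: V]%G) #|sur (subz (kerz phi)) (subz H0)| =
   \sum_(H0 : {group V} | H0 != [set: V]%G) #|sur (Xp b N) (subz H0)|)%N.
  apply: eq_bigr => L LT; apply: IH.
    rewrite card_subz; apply: leq_trans (_ : #|V| <= k)%N; last by rewrite -ltnS.
    rewrite -cardsT; apply: proper_card; rewrite properT.
    by apply: contra LT => /eqP e; apply/eqP/val_inj.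
  apply: dvdn_trans dv; rewrite dvdn_mul // card_subz -(card_quo L) dvdn_mull //.
move/addIn; have iT := @zisog_subzT V [set: V]%G erefl.
by have [_ -> _] := eq_card_isogr (subz (kerz phi)) iT; have [_ -> _] := eq_card_isogr (Xp b N) iT.
Qed.

End KernelOfFree.

Lemma cycB_val b (b_gt0 : (0 < b)%N) (G : finZmodType) (h : G -> nat) :
  (forall x y : G, h (x + y)%R = h x + h y %[mod b])%N ->
  [ffun x => cyc1 b *+ h x] \in hom G (cyc b).
Proof.
move=> hD; apply/homP/zmorphP => x y; rewrite !ffunE -mulrnDr.
by apply/val_inj; rewrite !(val_cyc1Mn b_gt0).
Qed.

(** The irreducible characters of an abelian group are linear and have trivial common kernel. Their
    values are [N]-th roots of unity, and the exponents of these give the map to [Z/N]. *)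
Lemma exists_char (G : finZmodType) (N : nat) (x : G) : (0 < N)%N ->
  (forall y : G, y *+ N = 0) -> x != 0 ->
  exists2 f, f \in hom G (cyc N) & f x != 0.
Proof.
move=> N0 GN x0; pose GG : {group G} := [set: G]%G.
have abG : abelian GG by apply/centsP => a _ b _; rewrite /commute !zmodMgE addrC.
have : x \notin (\bigcap_i cfker 'chi[GG]_i)%g by rewrite TI_cfker_irr in_set1.
have -> : (x \notin (\bigcap_i cfker 'chi[GG]_i)%g) = ~~ [forall i, x \in cfker 'chi[GG]_i].
  by congr (~~ _); apply/bigcapP/forallP => // h i; apply: h.
rewrite negb_forall => /existsP[i nk]; have lin : 'chi_i \is a linear_char.
  exact/char_abelianP.
have [z zp] := C_prim_root_exists N0.
have e1 y : 'chi_i y ^+ N = 1.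
  by rewrite -lin_charX ?inE // zmodXgE GN -zmod1gE lin_char1.
pose h y := val (sval (prim_rootP zp (e1 y))).
have hE y : 'chi_i y = z ^+ h y by rewrite /h; case: (prim_rootP _ _).
exists [ffun y => cyc1 N *+ h y].
  apply: cycB_val => // a b; apply/eqP.
  by rewrite -(eq_prim_root_expr zp) exprD -!hE -zmodMgE lin_charM ?inE.
rewrite ffunE; apply: contra nk => /eqP/(congr1 val).
rewrite (val_cyc1Mn N0) => hx; rewrite cfkerEchar ?irr_char // !inE /=.
rewrite hE lin_char1 // -(expr0 z) (eq_prim_root_expr zp).
by rewrite mod0n hx.
Qed.

(** * Maps to [Z/p] as detectors of the prime [p] *)

Section PrimeDetection.
Variable p : nat.
Hypothesis p_pr : prime p.
Let p_gt0 := prime_gt0 p_pr.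

Definition nchar (K : finZmodType) : nat := #|hom K (cyc p)|.

Lemma nchar_gt0 K : (0 < nchar K)%N.
Proof. by apply/card_gt0P; exists [ffun=> 0]; apply: hom0. Qed.

Lemma nchar_pow K : exists r, nchar K = (p ^ r)%N.
Proof.
pose F : finZmodType := {ffun K -> cyc p}.
have e : nchar K = #|grp (hom K (cyc p) : {set F})|.
  apply: eq_card => f; rewrite mem_grp //; split; first exact: hom0.
  move=> g h /homP gB /homP hB; apply/homP => x y; rewrite !ffunE gB hB.
  by rewrite !opprD addrACA.
have : (nchar K %| p ^ #|K|)%N.
  have <- : #|F| = (p ^ #|K|)%N by rewrite card_ffun card_ord (prednK p_gt0).
  by rewrite e -cardsT cardSg ?subsetT.
by move/(dvdn_pfactor _ _ p_pr) => [m _ ->]; exists m.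
Qed.

Lemma exists_proper_char (K : finZmodType) (L : {group K}) :
  (forall x : K, x *+ p \in L) -> L != [set: K]%SET :> {set K} ->
  exists2 f, f \in sur K (cyc p) & L \subset kerz f.
Proof.
move=> pL LT; have [x xL] : exists x, x \notin L.
  move: LT; rewrite -properT properE subsetT /= => /subsetPn[x _ xL].
  by exists x.
have qp (a : quo L) : a *+ p = 0.
  have [y <-] := pi_quo_surj a; rewrite -(zmorphMn (@pi_quoB _ L)).
  by apply/eqP; rewrite pi_quo_eq0.
have q0 : pi_quo L x != 0 by rewrite pi_quo_eq0.
have [f fh fx] := exists_char p_gt0 qp q0.
have fph : fcomp f (piz L) \in hom K (cyc p) by rewrite fcomp_hom ?(sur_hom (piz_sur L)).
exists (fcomp f (piz L)); last first.
  apply/subsetP => y yL; rewrite mem_kerz // !ffunE; have /homP fB := fh.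
  by move: yL; rewrite -pi_quo_eq0 => /eqP->; rewrite (zmorph0 fB).
set g := fcomp f (piz L) in fph *; have /homP gB := fph.
apply/surP; split=> // y; apply/(mem_imz _ fph).
suff -> : imz g = [set: cyc p]%G by rewrite inE.
apply/val_inj/eqP; rewrite eqEcard subsetT /= cardsT (card_cyc p_gt0).
have := cardSg (subsetT (imz g)); rewrite cardsT (card_cyc p_gt0).
move/(primeP p_pr).2/orP => [|/eqP-> //]; rewrite -trivg_card1 => /eqP t.
have : g x \in imz g by apply/(mem_imz _ fph); exists x.
rewrite t => /set1P; rewrite !ffunE => g0; case/negP: fx; exact/eqP.
Qed.

(** By Cauchy's theorem multiplication by [p] is not injective, so [p K] is a proper subgroup and a
    nonzero character kills it. *)
Lemma nchar_gt1 (K : finZmodType) : (p %| #|K|)%N -> (1 < nchar K)%N.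
Proof.
move=> d; have KT : (p %| #|[set: K]%G|)%N by rewrite cardsT.
have [x _ ox] := Cauchy p_pr KT.
have [|//|f fs _] := @exists_proper_char K (imz (mulz K p)).
- by move=> y; apply/mem_im_mulz; exists y.
- apply/eqP => e; have := card_im_ker (mulz_hom K p); rewrite e cardsT.
  rewrite -[in X in _ = X](muln1 #|K|) => /eqP.
  rewrite eqn_pmul2l; last by apply/card_gt0P; exists 0.
  rewrite -trivg_card1 => /eqP t.
  have : x \in kerz (mulz K p) by rewrite mem_ker_mulz -zmodXgE -ox expg_order.
  rewrite t => /set1P x1; move: ox p_pr; rewrite x1 order1 => <-.
  by [].
- rewrite /nchar (cardD1 [ffun=> 0]) hom0 add1n ltnS; apply/card_gt0P; exists f.
  apply/andP; split; last exact: sur_hom.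
  have /surP[_ /(_ (cyc1 p))[y fy]] := fs.
  apply/eqP => /ffunP/(_ y); rewrite fy ffunE => /(congr1 val) /=.
  by rewrite /= (prednK p_gt0) modn_small ?prime_gt1.
Qed.

(** At least half of the homomorphisms [K -> (Z/p)^m] are onto once
    [#|Hom(K, Z/p)| >= p^(m+1)]: the others are killed by one of the [p^m - 1]
    nonzero functionals on [(Z/p)^m]. *)
Lemma card_sur_elem (K : finZmodType) m : (p ^ m.+1 <= nchar K)%N ->
  (nchar K ^ m <= 2 * #|sur K (Xp p m)|)%N.
Proof.
move=> le; set V := Xp p m; set x := nchar K.
have Vp (v : V) : v *+ p = 0 by apply: Xp_exp.
have hV : #|hom K V| = (x ^ m)%N by rewrite card_hom_to_Xp.
pose B (l : {ffun V -> cyc p}) := [set f in hom K V | [forall y, l (f y) == 0]]%SET.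
(* [(f, g) |-> f + v g] embeds [B l] times [Hom(K, Z/p)] into [Hom(K, V)]: applying [l] recovers
   [g]. *)
have Bx l : l \in sur V (cyc p) -> (#|B l| * x <= x ^ m)%N.
  move=> /surP[lB ls]; have [v lv] := ls (cyc1 p); rewrite -hV /x /nchar -cardsX.
  pose j (fg : {ffun K -> V} * {ffun K -> cyc p}) : {ffun K -> V} :=
    [ffun y => fg.1 y + v *+ \val (fg.2 y)].
  have lj fg : fg \in setX (B l) (hom K (cyc p)) -> forall y, l (j fg y) = fg.2 y.
    case: fg => f g; rewrite in_setX /= [_ \in B l]in_set -andbA => /and3P[fh /forallP f0 _] y.
    by rewrite ffunE (zmorphD lB) (eqP (f0 y)) add0r (zmorphMn lB) lv -(cyc_mul1 p_gt0).
  have ji : {in setX (B l) (hom K (cyc p)) &, injective j}.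
    move=> fg fg' h h' e; have e2 : fg.2 = fg'.2.
      by apply/ffunP => y; rewrite -(lj _ h) -(lj _ h') e.
    rewrite (surjective_pairing fg) (surjective_pairing fg') e2; congr (_, _).
    apply/ffunP => y; move/ffunP/(_ y): e; rewrite !ffunE e2.
    by move/addIr.
  rewrite -(card_in_imset ji); apply/subset_leq_card/subsetP => _ /imsetP[[f g] h ->].
  move: h; rewrite in_setX /= [_ \in B l]in_set -andbA => /and3P[/homP fB _ gh].
  have /homP vB := cyc_homP p_gt0 (Vp v); have /homP gB := gh.
  apply/homP => y z; rewrite !ffunE fB gB.
  have := vB (g y) (g z); rewrite !ffunE => ->.
  by rewrite opprD addrACA.
have cov : (x ^ m <= #|sur K V| + \sum_(l in sur V (cyc p)) #|B l|)%N.
  rewrite -hV -!sum1_card (eq_bigr (fun l => \sum_f (f \in B l : nat))%N); last first.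
    by move=> l _; rewrite -sum1_card big_mkcond.
  rewrite exchange_big [leqLHS]big_mkcond [X in (_ <= X + _)%N]big_mkcond.
  rewrite -big_split /=; apply: leq_sum => f _.
  case: ifP => // fh; have [//|fs] := ifP.
  have nT : imz f != [set: V]%SET :> {set V}.
    apply/negP => /eqP e; case/negP: fs; apply/surP; split; first exact/homP.
    by move=> y; apply/(mem_imz _ fh); rewrite e inE.
  have [y|l ls lk] := exists_proper_char _ nT; first by rewrite Vp; apply: zgroup0.
  rewrite (bigD1 l) //= add0n [_ \in B l]in_set fh /= (_ : [forall y, _] = true) //.
  apply/forallP => y; rewrite -mem_kerz ?(sur_hom ls) //; apply: (subsetP lk).
  by apply/(mem_imz _ fh); exists y.
have lc : (#|sur V (cyc p)| <= (p ^ m).-1)%N.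
  have <- : #|hom V (cyc p)| = (p ^ m)%N.
    by rewrite (card_hom_Xp p_gt0) ?(card_cyc p_gt0) // => y; apply: cyc_exp.
  rewrite (cardsD1 [ffun=> 0] (hom _ _)) hom0 /=; apply/subset_leq_card/subsetP => l ls.
  rewrite in_setD1 (sur_hom ls) andbT; have /surP[_ /(_ (cyc1 p))[y ly]] := ls.
  apply/eqP => /ffunP/(_ y); rewrite ly ffunE => /(congr1 val) /=.
  by rewrite /= (prednK p_gt0) modn_small ?prime_gt1.
have x0 : (0 < x)%N := nchar_gt0 K.
have S : ((\sum_(l in sur V (cyc p)) #|B l|) * x <= (p ^ m).-1 * x ^ m)%N.
  rewrite big_distrl /=; apply: leq_trans (_ : \sum_(l in sur V (cyc p)) x ^ m <= _)%N.
    exact: leq_sum.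
  by rewrite sum_nat_const leq_mul2r lc orbT.
set Sg := (\sum_(l in _) _)%N in cov S.
(* The hypothesis [p ^ m.+1 <= x] enters here: at most half of the homomorphisms are lost. *)
have S2 : (2 * Sg <= x ^ m)%N.
  rewrite -(leq_pmul2r x0) -mulnA; apply: leq_trans (_ : 2 * ((p ^ m).-1 * x ^ m) <= _)%N.
    by rewrite leq_mul2l S orbT.
  rewrite mulnA mulnC leq_mul2l; apply/orP; right; apply: leq_trans le.
  rewrite expnS; apply: leq_mul; first exact: prime_gt1.
  exact: leq_pred.
rewrite -(leq_add2r (2 * Sg)) -mulnDr; apply: leq_trans (_ : 2 * x ^ m <= _)%N.
  by rewrite [leqRHS]mul2n -addnn leq_add2l.
by rewrite leq_mul2l cov.
Qed.

End PrimeDetection.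

Lemma card_sur_triv K : #|sur K 'I_1| = 1%N.
Proof.
rewrite -(cards1 ([ffun=> 0] : {ffun K -> 'I_1})); apply: eq_card => f.
rewrite in_set1; apply/surP/eqP => [_|->].
  by apply/ffunP => x; apply/val_inj; rewrite ffunE; case: (f x) => -[].
split=> [x y|y]; first by rewrite !ffunE subr0.
by exists 0; apply/val_inj; rewrite ffunE; case: y => -[].
Qed.

(** The image of a pair of surjections has order divisible by [#|V|] and by [#|W|], hence by their
    product. *)
Lemma card_sur_prod (K V W : finZmodType) : coprime #|V| #|W| ->
  #|sur K (V * W)%type| = (#|sur K V| * #|sur K W|)%N.
Proof.
move=> co; pose h := fun p : {ffun K -> V} * {ffun K -> W} =>
  [ffun x : K => (p.1 x, p.2 x)] : {ffun K -> (V * W)%type}.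
have hi : injective h.
  move=> [f g] [f' g'] /ffunP e; congr (_, _); apply/ffunP => x;
  by have := e x; rewrite !ffunE /= => -[].
rewrite -cardsX -(card_imset _ hi); apply: eq_card => f.
apply/idP/imsetP => [/surP[fB fs]|[[g k]]].
  exists ([ffun x => (f x).1], [ffun x => (f x).2]).
    rewrite in_setX; apply/andP; split; apply/surP; split.
    - by move=> x y; rewrite !ffunE /= fB.
    - by move=> y; have [x e] := fs (y, 0); exists x; rewrite ffunE e.
    - by move=> x y; rewrite !ffunE /= fB.
    - by move=> y; have [x e] := fs (0, y); exists x; rewrite ffunE e.
  by apply/ffunP => x; rewrite !ffunE /=; case: (f x).
rewrite in_setX /= => /andP[gs ks] ->; have /surP[gB gS] := gs; have /surP[kB kS] := ks.
have hh : h (g, k) \in hom K (V * W)%type.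
  by apply/homP => x y; rewrite !ffunE gB kB.
apply/surP; split; first exact/homP.
move=> y; apply/(mem_imz _ hh).
pose VW : finZmodType := (V * W)%type.
suff -> : imz (h (g, k)) = [set: VW]%G :> {group VW} by rewrite inE.
have [T Ts Te] := corestr hh.
have fst_s : [ffun x : subz (imz (h (g, k))) => (sval x).1] \in sur _ V.
  apply/surP; split=> [a b|a]; first by rewrite !ffunE.
  have [x ex] := gS a; exists (T x).
  by rewrite ffunE Te ffunE.
have snd_s : [ffun x : subz (imz (h (g, k))) => (sval x).2] \in sur _ W.
  apply/surP; split=> [a b|a]; first by rewrite !ffunE.
  have [x ex] := kS a; exists (T x).
  by rewrite ffunE Te ffunE.
apply/val_inj/eqP; rewrite eqEcard subsetT /= cardsT card_prod.
apply: dvdn_leq; first by apply/card_gt0P; exists 0; apply: zgroup0.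
rewrite Gauss_dvd // -(card_subz (imz _)).
by rewrite -{1}(card_ker_sur fst_s) -(card_ker_sur snd_s) !dvdn_mulr.
Qed.

(** * Combinations of surjection counts that detect the trivial group *)

Section Combinations.
Variable R : archiRealFieldType.
Implicit Types (f g : finZmodType -> R) (good : finZmodType -> Prop).

(** Finite linear combinations of the functions [K |-> #|Sur(K, V)|]. *)
Definition comb good f (beta : R) : Prop :=
  exists (I : finType) (V : I -> finZmodType) (c : I -> R),
    [/\ forall i, good (V i), forall K, f K = \sum_i c i * #|sur K (V i)|%:R
      & \sum_i `|c i| <= beta].

Lemma comb_ext good f g beta : f =1 g -> comb good f beta -> comb good g beta.
Proof. by move=> e [I [V [c [gV fE cb]]]]; exists I, V, c; split=> // K; rewrite -e. Qed.

Lemma comb_weak good good' f beta beta' : (forall V, good V -> good' V) ->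
  beta <= beta' -> comb good f beta -> comb good' f beta'.
Proof.
move=> gg bb [I [V [c [gV fE cb]]]]; exists I, V, c; split=> //; last exact: le_trans bb.
by move=> i; apply: gg.
Qed.

Lemma comb_sur good V : good V -> comb good (fun K => #|sur K V|%:R) 1.
Proof.
move=> gV; exists unit, (fun=> V), (fun=> 1); split=> // [K|].
  by rewrite big_const card_unit /= addr0 mul1r.
by rewrite big_const card_unit /= addr0 normr1.
Qed.

Lemma comb0 good : comb good (fun=> 0) 0.
Proof.
exists void, (of_void _), (fun=> 0).
split=> [i|K|]; first by case: i.
  by rewrite big1 //; case.
by apply: sumr_le0; case.
Qed.

Lemma combD good f g beta gamma : comb good f beta -> comb good g gamma ->
  comb good (fun K => f K + g K) (beta + gamma).
Proof.
move=> [I [V [c [gV fE cb]]]] [J [W [d [gW gE db]]]].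
exists (I + J)%type, (fun ij => match ij with inl i => V i | inr j => W j end),
  (fun ij => match ij with inl i => c i | inr j => d j end).
split=> [[i|j]//|K|]; last by rewrite big_sumType /= lerD.
by rewrite fE gE big_sumType.
Qed.

Lemma combZ good f a beta : comb good f beta ->
  comb good (fun K => a * f K) (`|a| * beta).
Proof.
move=> [I [V [c [gV fE cb]]]]; exists I, V, (fun i => a * c i); split=> // [K|].
  by rewrite fE mulr_sumr; apply: eq_bigr => i _; rewrite mulrA.
under eq_bigr do rewrite normrM.
by rewrite -mulr_sumr ler_wpM2l.
Qed.

Lemma comb_sum good (I : Type) (r : seq I) (P : pred I) (F : I -> finZmodType -> R)
    (beta : I -> R) : (forall i, P i -> comb good (F i) (beta i)) ->
  comb good (fun K => \sum_(i <- r | P i) F i K) (\sum_(i <- r | P i) beta i).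
Proof.
move=> h; elim: r => [|i r IH].
  by rewrite big_nil; apply: comb_ext (comb0 _) => K; rewrite big_nil.
rewrite big_cons; have [Pi|nP] := boolP (P i).
  apply: comb_ext (combD (h i Pi) IH) => K; by rewrite big_cons Pi.
by apply: comb_ext IH => K; rewrite big_cons (negbTE nP).
Qed.

Lemma combM good good' good'' f g beta gamma :
  (forall V W, good V -> good' W -> coprime #|V| #|W| /\ good'' (V * W)%type) ->
  comb good f beta -> comb good' g gamma ->
  comb good'' (fun K => f K * g K) (beta * gamma).
Proof.
move=> h [I [V [c [gV fE cb]]]] [J [W [d [gW gE db]]]].
exists (I * J)%type, (fun ij => V ij.1 * W ij.2)%type, (fun ij => c ij.1 * d ij.2).
split=> [[i j]/=|K|].
- by have [] := h _ _ (gV i) (gW j).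
- rewrite fE gE big_distrlr /= pair_bigA /=; apply: eq_bigr => -[i j] _ /=.
  have [co _] := h _ _ (gV i) (gW j); rewrite card_sur_prod // natrM.
  by rewrite mulrACA.
- rewrite -(pair_bigA _ (fun i j => `|c i * d j|)) /=.
  under eq_bigr do (under eq_bigr do rewrite normrM).
  rewrite -big_distrlr /=; apply: ler_pM => //; exact: sumr_ge0.
Qed.

(** [A] is approximated by combinations, with an error term that is itself a
    combination of arbitrarily small weight. *)
Definition detects good (A : finZmodType -> R) : Prop :=
  forall delta, 0 < delta -> exists L E,
    [/\ exists beta, comb good L beta, comb good E delta &
        forall K, `|A K - L K| <= E K].

(** [nchar p K ^ i] counts the maps [K -> (Z/p)^i], that is, the surjections onto the subgroups of
    [(Z/p)^i]. *)
Lemma comb_poly p (p_pr : prime p) (q : {poly R}) :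
  exists beta, comb (fun V => p.-nat #|V|) (fun K => q.[(nchar p K)%:R]) beta.
Proof.
have pw i : exists beta, comb (fun V => p.-nat #|V|) (fun K => (nchar p K)%:R ^+ i) beta.
  eexists; apply: (comb_ext (f := fun K => \sum_(W : {group Xp p i}) #|sur K (subz W)|%:R)).
    by move=> K; rewrite -natr_sum -card_hom_im card_hom_to_Xp natrX.
  apply: comb_sum => W _; apply: comb_sur; rewrite card_subz.
  apply: (@pnat_dvd _ #|Xp p i|); first by rewrite -cardsT cardSg ?subsetT.
  by rewrite (card_Xp (prime_gt0 p_pr)) pnatX pnat_id.
have {}pw i : exists beta, comb (fun V => p.-nat #|V|) (fun K => q`_i * (nchar p K)%:R ^+ i) beta.
  by have [beta cb] := pw i; exists (`|q`_i| * beta); apply: combZ.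
suff h n : exists beta, comb (fun V => p.-nat #|V|)
    (fun K => \sum_(i < n) q`_i * (nchar p K)%:R ^+ i) beta.
  by have [beta cb] := h (size q); exists beta; apply: comb_ext cb => K; rewrite horner_coef.
elim: n => [|n [beta IH]].
  by exists 0; apply: comb_ext (comb0 _) => K; rewrite big_ord0.
have [gamma cb] := pw n; exists (beta + gamma); apply: comb_ext (combD IH cb) => K.
by rewrite big_ord_recr.
Qed.

(** [nchar p K] is some [x = p ^ r], and the polynomial [L] is [1] at [r = 0] and vanishes for
    [1 <= r <= m]. For [r > m] its size is at most [x ^ m / D], which [card_sur_elem] bounds by
    [2 / D] times the number of surjections onto [(Z/p)^m]. *)
Lemma detect_prime p : prime p ->
  detects (fun V => p.-nat #|V|) (fun K => (nchar p K == 1%N)%:R).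
Proof.
move=> p_pr delta d0; have p1 := prime_gt1 p_pr; have p0 := prime_gt0 p_pr.
(* Since [m <= D], this choice makes the weight [2 / D] of the error at most [delta]. *)
have [m m_gt] : exists m, 2 / delta < m%:R.
  by exists (Num.bound (2 / delta)); rewrite archi_boundP // divr_ge0 // ltW.
have pn i : (0 < i)%N -> (0 : R) < p%:R ^+ i - 1.
  by move=> i0; rewrite subr_gt0 exprn_egt1 ?ltr1n // -lt0n.
pose D : R := \prod_(1 <= i < m.+1) (p%:R ^+ i - 1).
have D0 : 0 < D by rewrite /D big_nat prodr_gt0 // => i /andP[i0 _]; apply: pn.
pose L (x : R) : R := \prod_(1 <= i < m.+1) ((p%:R ^+ i - x) / (p%:R ^+ i - 1)).
exists (fun K => L (nchar p K)%:R), (fun K => 2 / D * #|sur K (Xp p m)|%:R); split.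
- pose q := \prod_(1 <= i < m.+1) ((p%:R ^+ i - 1)^-1 *: ((p%:R ^+ i)%:P - 'X) : {poly R}).
  have [beta cb] := comb_poly p_pr q; exists beta; apply: comb_ext cb => K.
  rewrite /q horner_prod; apply: eq_bigr => i _.
  by rewrite hornerZ hornerD hornerN hornerC hornerX mulrC.
- apply: (comb_weak (good := fun V => p.-nat #|V|) (beta := `|2 / D| * 1)) => //; last first.
    by apply: combZ; apply: comb_sur; rewrite card_Xp // pnatX pnat_id.
  have D0' := ltW D0; rewrite mulr1 ger0_norm ?divr_ge0 // ler_pdivrMr //.
  have : m%:R <= D.
    rewrite /D; case: (m) => [|k]; first by rewrite big_geq.
    rewrite big_nat_recr //=; apply: (@le_trans _ _ (p%:R ^+ k.+1 - 1)).
      rewrite lerBrDr natr1 -natrX ler_nat; exact: ltn_expl.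
    apply: ler_peMl; first exact/ltW/pn.
    rewrite big_nat; elim/big_rec : _ => // i y /andP[i0 _] y1.
    apply: (le_trans y1); apply: ler_peMl; first exact: le_trans y1.
    rewrite lerBrDr; apply: (@le_trans _ _ (p%:R ^+ 1)).
      by rewrite expr1 -[1 + 1]/(2%:R) ler_nat.
    by rewrite ler_eXn2l ?ltr1n.
  move=> mD; apply: (@le_trans _ _ (delta * m%:R)); last by rewrite ler_pM2l.
  by move: m_gt; rewrite ltr_pdivrMr // => /ltW; rewrite mulrC.
- move=> K; have [r er] := nchar_pow p_pr K; rewrite er.
  have Er0 : 0 <= 2 / D * #|sur K (Xp p m)|%:R.
    by rewrite mulr_ge0 // divr_ge0 // ltW.
  case: r er => [|r] er.
    rewrite expn0 eqxx /L big1_seq ?subrr ?normr0 // => i /andP[_].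
    rewrite mem_index_iota => /andP[i0 _].
    by rewrite divff // gt_eqF // pn.
  rewrite gtn_eqF; last by rewrite -{1}(expn0 p) ltn_exp2l.
  have [rm|rm] := leqP r.+1 m.
    rewrite /L (bigD1_seq r.+1) ?iota_uniq ?mem_index_iota //=.
    by rewrite natrX subrr !mul0r subr0 normr0.
  rewrite sub0r normrN /L normr_prod; set x : R := (p ^ r.+1)%:R.
  have x0 : 0 <= x by [].
  apply: (@le_trans _ _ (\prod_(1 <= i < m.+1) (x / (p%:R ^+ i - 1)))).
    rewrite [leLHS]big_nat [leRHS]big_nat; apply: ler_prod => i /andP[i0 im].
    rewrite normr_ge0 /= normrM normfV (gtr0_norm (pn _ i0)) ler_pM2r ?invr_gt0 ?pn //.
    rewrite ler_norml; apply/andP; split.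
      by rewrite lerBrDr addrC subrr exprn_ge0.
    rewrite lerBlDr (le_trans (y := x)) ?lerDl // /x -natrX ler_nat leq_exp2l //.
    by apply: leq_trans (ltnW rm); rewrite -ltnS.
  rewrite big_split /= prodfV -/D big_const_nat iter_mulr_1 subSS subn0.
  rewrite mulrAC ler_pM2r ?invr_gt0 // -natrX -natrM ler_nat.
  have := card_sur_elem p_pr (K := K) (m := m); rewrite er; apply.
  by rewrite leq_exp2l.
Qed.

(** The indicator is a product over the primes. Products of combinations over coprime orders are
    combinations by [card_sur_prod], and weights multiply. *)
Lemma detect_primes (l : seq nat) : all prime l -> uniq l ->
  detects (fun V => [pred q | q \in l].-nat #|V|)
    (fun K => (all (fun p => nchar p K == 1%N) l)%:R).
Proof.
elim: l => [_ _ d d0|p l IH /= /andP[p_pr al] /andP[pl ul] d d0].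
  exists (fun=> 1), (fun=> 0); split=> [||K]; last by rewrite subrr normr0.
  - exists 1; apply: (comb_ext (f := fun K => #|sur K 'I_1|%:R)).
      by move=> K; rewrite card_sur_triv.
    by apply: comb_sur; rewrite card_ord.
  - exact: (comb_weak (fun V h => h) (ltW d0) (comb0 _)).
(* The error of the product has weight [d' + d' + d' ^ 2], at most [3 d'] because [d' <= 1]. *)
pose d' := Num.min 1 (d / 3); have d'0 : 0 < d' by rewrite lt_min ltr01 divr_gt0.
have [L [E [[beta cL] cE LE]]] := IH al ul d' d'0.
have [L' [E' [[beta' cL'] cE' LE']]] := detect_prime p_pr d'0.
set good := (X in detects X _) in IH; pose good1 (V : finZmodType) : Prop := [pred q | q \in p :: l].-nat #|V|.
have w1 (V : finZmodType) : p.-nat #|V| -> good1 V.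
  by apply: sub_in_pnat => q _; rewrite !inE => ->.
have w2 (V : finZmodType) : good V -> good1 V.
  by apply: sub_in_pnat => q _; rewrite !inE => ->; rewrite orbT.
have co (V W : finZmodType) : p.-nat #|V| -> good W -> coprime #|V| #|W| /\ good1 (V * W)%type.
  move=> Vp Wl; split; last by rewrite /good1 card_prod pnatM; apply/andP; split; [exact: w1|exact: w2].
  apply: (@pnat_coprime p) => //; apply: sub_in_pnat Wl => q _; rewrite !inE => ql.
  by apply: contraNneq pl => <-.
exists (fun K => L' K * L K), (fun K => E' K + E K + E' K * E K); split.
- by exists (beta' * beta); apply: combM cL' cL.
- apply: (comb_weak (good := good1) (beta := d' + d' + d' * d')) => //; last first.
    apply: combD; last by apply: combM cE' cE.
    apply: combD; first by apply: comb_weak cE'.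
    by apply: comb_weak cE.
  have : d' <= 1 by rewrite /d' ge_min lexx.
  have : d' <= d / 3 by rewrite /d' ge_min lexx orbT.
  nra.
- move=> K; have := LE K; have := LE' K; set x := (nchar p K == 1%N); set y := all _ _.
  rewrite -mulnb natrM; move: (L K) (L' K) (E K) (E' K) => l1 l2 e1 e2 h2 h1.
  have e10 := le_trans (normr_ge0 _) h1; have e20 := le_trans (normr_ge0 _) h2.
  have -> : x%:R * y%:R - l2 * l1 = x%:R * (y%:R - l1) + (x%:R - l2) * l1 by ring.
  apply: (le_trans (ler_normD _ _)); rewrite !normrM.
  have l11 : `|l1| <= 1 + e1.
    rewrite -[l1](subrK y%:R) [X in `|X|]addrC (le_trans (ler_normD _ _)) // lerD //.
      by case: (y); rewrite ?normr1 ?normr0.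
    by rewrite distrC.
  have : `|x%:R : R| <= 1 by case: (x); rewrite ?normr1 ?normr0.
  have := normr_ge0 l1; have := normr_ge0 (y%:R - l1); have := normr_ge0 (x%:R - l2).
  have := normr_ge0 (x%:R : R).
  nra.
Qed.

End Combinations.

(** * Surjection counts approximate the indicator of an isomorphism class *)

Section Certificate.
Variable R : archiRealFieldType.
Implicit Types (f g : finZmodType -> R) (good : finZmodType -> Prop).

(** The number of pairs [X -> H], [ker -> V] of surjections is a combination of
    the [#|Sur(X, G)|] for the extensions [G] of [H] by [V]. *)
Lemma comb_sur_sur (H V : finZmodType) :
  comb (fun=> True) (fun X => (\sum_(phi in sur X H) #|sur (subz (kerz phi)) V|)%:R : R) 2.
Proof.
set n := (#|H| * #|V|)%N.
have n0 : (0 < n)%N by rewrite muln_gt0; apply/andP; split; apply/card_gt0P; exists 0.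
(* One generator more than [n]: as [2 ^ n / 2 ^ N = 1/2], at least half of the maps from [X0] to a
   group of order [n] are onto. *)
pose N := n.+1; pose X0 := Xp n N.
have s0 (G : finZmodType) : #|G| = n -> (n ^ N <= 2 * #|sur X0 G|)%N.
  move=> Gn; have Gn' (x : G) : x *+ n = 0 by rewrite -Gn mulrn_card.
  have := card_sur_Xp_ge n0 N Gn'; rewrite Gn -/X0 {2 4}/N.
  rewrite [in X in (_ <= X + _)%N -> _]expnS [in X in (X <= _)%N -> _]expnS.
  rewrite !mulnA [(2 ^ n * _)%N]mulnC -mulnDl leq_pmul2r ?expn_gt0 //.
  by rewrite muln2 -addnn leq_add2r mulnC.
have s1 (G : finZmodType) : #|G| = n -> (0 < #|sur X0 G|)%N.
  by move=> /s0; rewrite lt0n; apply: contraTneq => ->; rewrite muln0 -ltnNge expn_gt0 n0.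
pose F (B : finZmodType) : R := (kappa H V B)%:R.
have Fi B C : zisog B C -> F B = F C by move=> /kappa_iso e; rewrite /F e.
have kn (X : finZmodType) (L : {group X}) : #|quo L| != n -> kappa H V (quo L) = 0%N.
  by move=> nn; apply/eqP; apply: contraR nn => /kappa_card/eqP.
exists {group X0}, (fun L0 => quo L0),
  (fun L0 => if #|quo L0| == n then F (quo L0) / #|sur X0 (quo L0)|%:R else 0).
split=> // [X|].
  rewrite kappa_sum natr_sum (bigID (fun L : {group X} => #|quo L| == n)) /=.
  rewrite [X in _ + X]big1 ?addr0; last by move=> L /kn ->.
  rewrite (@sum_quo_transfer _ F X X0 n Fi (fun L => s1 _)) big_mkcond; apply: eq_bigr => L0 _.
  by case: ifP; rewrite ?mul0r.
have nN : 0 < (n ^ N)%:R :> R by rewrite ltr0n expn_gt0 n0.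
(* Each denominator is at least [n ^ N / 2]. The remaining sum of [kappa] is evaluated by
   [kappa_sum] on [X0] itself and is at most [#|H| ^ N * #|V| ^ N = n ^ N]. *)
apply: (@le_trans _ _ (\sum_(L0 : {group X0}) F (quo L0) * (2 / (n ^ N)%:R))).
  apply: ler_sum => L0 _; case: ifP => [/eqP Ln|_].
    rewrite ger0_norm ?divr_ge0 ?ler0n // ler_wpM2l ?ler0n //.
    rewrite -[leRHS]invrK lef_pV2 ?posrE ?ltr0n ?s1 //; last first.
      by rewrite invr_gt0 divr_gt0.
    by rewrite invf_div ler_pdivrMr // -natrM ler_nat mulnC s0.
  by rewrite normr0 mulr_ge0 ?ler0n // divr_ge0 ?ler0n.
rewrite -mulr_suml -natr_sum -kappa_sum mulrA ler_pdivrMr // mulrC ler_wpM2l // ler_nat.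
have ex (G : finZmodType) : (#|G| %| n)%N -> forall x : G, x *+ n = 0.
  by case/dvdnP => k -> x; rewrite mulnC mulrnA mulrn_card mul0rn.
apply: (@leq_trans (\sum_(phi in sur X0 H) #|V| ^ N)%N).
  by apply: leq_sum => phi _; apply: card_sur_sub_Xp => //; apply: ex; apply: dvdn_mull.
rewrite sum_nat_const expnMn leq_mul2r card_sur_Xp_le ?orbT //.
by apply: ex; apply: dvdn_mulr.
Qed.

Lemma comb_lift (H : finZmodType) good f beta : comb good f beta ->
  comb (fun=> True) (fun X => \sum_(phi in sur X H) f (subz (kerz phi))) (beta * 2).
Proof.
move=> [I [V [c [_ fE cb]]]].
apply: (comb_weak (good := fun=> True) (beta := \sum_i `|c i| * 2)) => //.
  by rewrite -mulr_suml ler_pM2r.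
have h i : true -> comb (fun=> True) (fun X => c i *
    (\sum_(phi in sur X H) #|sur (subz (kerz phi)) (V i)|)%:R) (`|c i| * 2).
  by move=> _; apply: combZ; apply: comb_sur_sur.
apply: comb_ext (comb_sum (index_enum I) h) => X.
under [RHS]eq_bigr do rewrite fE.
rewrite exchange_big; apply: eq_bigr => i _; rewrite natr_sum mulr_sumr.
by [].
Qed.

(** A group killed by [a] has no surjection onto a group that is not, so those terms are replaced by
    the trivial group with coefficient [0]. *)
Lemma comb_restrict a good f beta : comb good f beta ->
  exists2 f', comb (fun V => forall x : V, x *+ a = 0) f' beta &
    forall X : finZmodType, (forall x : X, x *+ a = 0) -> f X = f' X.
Proof.
move=> [I [V [c [_ fE cb]]]].
pose b i := [forall x : V i, x *+ a == 0].
pose V' i : finZmodType := if b i then V i else 'I_1.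
pose c' i := if b i then c i else 0.
exists (fun K => \sum_i c' i * #|sur K (V' i)|%:R).
  exists I, V', c'; split=> // [i|].
    rewrite /V'; case bi : (b i) => x; first exact/eqP/(forallP bi).
    by apply/val_inj; case: (_ *+ _) => -[].
  apply: le_trans cb; apply: ler_sum => i _; rewrite /c'.
  by case: ifP; rewrite ?normr0.
move=> X Xa; rewrite fE; apply: eq_bigr => i _; rewrite /V' /c'.
case bi : (b i) => //; rewrite mul0r.
case: (set_0Vmem (sur X (V i))) => [->|[f' fs]]; first by rewrite cards0 mulr0.
by case/negP: (negbT bi); apply/forallP => x; rewrite (sur_exp fs Xa).
Qed.

Lemma card_hom_triv (K Y : finZmodType) : #|K| = 1%N -> #|hom K Y| = 1%N.
Proof.
move=> K1; rewrite -(cards1 ([ffun=> 0] : {ffun K -> Y})); apply: eq_card => f.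
rewrite in_set1; apply/homP/eqP => [fB|->]; last by move=> x y; rewrite !ffunE subr0.
apply/ffunP => x; rewrite ffunE -(zmorph0 fB); congr (f _).
by have /fintype_le1P/(_ x 0) : (#|K| <= 1)%N by rewrite K1.
Qed.

Lemma all_nchar1 a (K : finZmodType) : (0 < a)%N -> (forall x : K, x *+ a = 0) ->
  all (fun p => nchar p K == 1%N) (primes a) = (#|K| == 1)%N.
Proof.
move=> a0 Ka; apply/allP/eqP => [h|K1 p _]; last first.
  by rewrite /nchar card_hom_triv.
apply/eqP/negPn/negP => K1; set p := pdiv #|K|.
have K0 : (0 < #|K|)%N by apply/card_gt0P; exists 0.
have p_pr : prime p by apply: pdiv_prime; rewrite ltn_neqAle eq_sym K1.
have KT : (p %| #|[set: K]%G|)%N by rewrite cardsT pdiv_dvd.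
have [x _ ox] := Cauchy p_pr KT.
have pa : (p %| a)%N by rewrite -ox order_dvdn zmodXgE Ka.
have := h p; rewrite mem_primes p_pr a0 pa => /(_ isT) /eqP e.
by have := nchar_gt1 p_pr (pdiv_dvd #|K|); rewrite e.
Qed.

(** The numbers of surjections onto groups of exponent dividing [a] determine a
    group of exponent dividing [a], in a quantitative way. *)
Lemma certificate (a : nat) (H : finZmodType) (delta : R) : (0 < a)%N -> 0 < delta ->
  exists L E : finZmodType -> R,
  [/\ exists beta, comb (fun V => forall x : V, x *+ a = 0) L beta,
      comb (fun V => forall x : V, x *+ a = 0) E delta &
      forall X : finZmodType, (forall x : X, x *+ a = 0) ->
        `|(zisog X H)%:R - L X| <= E X].
Proof.
move=> a0 d0; have aut0 : (1 : R) <= #|iso H H|%:R by rewrite ler1n; exact: zisog_refl.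
have d2 : 0 < delta / 2 by rewrite divr_gt0.
have [L [E [[beta cL] cE LE]]] := detect_primes (all_prime_primes a) (primes_uniq a) d2.
pose S f (X : finZmodType) : R := #|iso H H|%:R^-1 * \sum_(phi in sur X H) f (subz (kerz phi)).
have cSL := combZ (#|iso H H|%:R^-1) (comb_lift H cL).
have cSE := combZ (#|iso H H|%:R^-1) (comb_lift H cE).
have [L' cL' eL'] := comb_restrict a cSL.
have [E' cE' eE'] := comb_restrict a cSE.
exists L', E'; split; first by eexists; exact: cL'.
  apply: comb_weak cE' => //; rewrite mulrC ger0_norm ?invr_ge0 ?(le_trans ler01) //.
  by rewrite divfK ?pnatr_eq0 // ler_piMr ?(ltW d0) // invf_le1 // (lt_le_trans ltr01).
move=> X Xa; rewrite -eL' // -eE' //.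
pose A (K : finZmodType) : R := (all (fun p => nchar p K == 1%N) (primes a))%:R.
(* An isomorphism is a surjection with trivial kernel, and a group isomorphic to [H] has as many
   isomorphisms to [H] as [H] has automorphisms. *)
have -> : (zisog X H)%:R = #|iso H H|%:R^-1 * \sum_(phi in sur X H) A (subz (kerz phi)).
  have -> : \sum_(phi in sur X H) A (subz (kerz phi)) = #|iso X H|%:R.
    rewrite -sum1_card natr_sum [RHS](eq_bigl (fun phi => (phi \in sur X H) && (phi \in iso X H))); last first.
      by move=> phi; rewrite andb_idl //; apply: iso_sur.
    rewrite big_mkcondr; apply: eq_bigr => phi ps; rewrite /A all_nchar1 //; last exact: subz_exp.
    rewrite ker_trivial_iso // card_subz -trivg_card1.
    rewrite (_ : (_ == _) = [forall x, (x \in kerz phi) ==> (x == 0)]); first by case: [forall x, _].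
    apply/eqP/forallP => [e x|h].
      by apply/implyP; rewrite e => /set1P->.
    by apply/trivgP/subsetP => x /(implyP (h x))/eqP->; apply: set11.
  have [i|] := boolP (zisog X H).
    have [_ _ ->] := eq_card_isogl H i; rewrite mulVf // pnatr_eq0 -lt0n; exact: zisog_refl.
  by rewrite /zisog -leqNgt leqn0 => /eqP->; rewrite mulr0.
rewrite -mulrBr -sumrB normrM normfV (ger0_norm (le_trans ler01 aut0)).
rewrite ler_wpM2l ?invr_ge0 ?(le_trans ler01) //.
by apply: (le_trans (ler_norm_sum _ _ _)); apply: ler_sum => phi _; apply: LE.
Qed.

End Certificate.

(** * Fourier analysis of random walks on finite abelian groups *)

Lemma closed_prim_root (C : numClosedFieldType) n : (0 < n)%N ->
  exists z : C, n.-primitive_root z.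
Proof.
move=> n_gt0; have [r Dp] := closed_field_poly_normal ('X^n - 1 : {poly C}).
rewrite (monicP _) ?monicXnsubC // scale1r in Dp.
have rn1 : all n.-unity_root r by apply/allP=> z; rewrite -root_prod_XsubC -Dp.
have sz_r : (n < (size r).+1)%N by rewrite -(size_prod_XsubC r id) -Dp size_XnsubC.
have [|z _ zp] := hasP (has_prim_root n_gt0 rn1 _ sz_r); last by exists z.
by rewrite -separable_prod_XsubC -Dp separable_Xn_sub_1 // pnatr_eq0 -lt0n.
Qed.

(** The law of the sum of independent variables of laws [p i]. *)
Definition convolution (R : comNzRingType) (G : finZmodType) (I : finType)
    (p : I -> G -> R) (x : G) : R :=
  \sum_(w : {ffun I -> G} | \sum_i w i == x) \prod_i p i (w i).

Section Fourier.
Variables (C : numClosedFieldType) (N : nat) (z : C).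
Hypothesis N_gt0 : (0 < N)%N.
Hypothesis zp : N.-primitive_root z.
Variable G : finZmodType.
Hypothesis GN : forall x : G, x *+ N = 0.
Implicit Types (l : {ffun G -> cyc N}) (f g : G -> C).

Definition ev l x : C := z ^+ \val (l x).

Lemma evD l x y : l \in hom G (cyc N) -> ev l (x + y) = ev l x * ev l y.
Proof.
move=> /homP/zmorphD lD; rewrite /ev lD -exprD /=.
by rewrite [X in (_ %% X)%N](prednK N_gt0) prim_expr_mod.
Qed.

Lemma evDl l l' x : ev (l + l') x = ev l x * ev l' x.
Proof.
rewrite /ev ffunE -exprD /=.
by rewrite [X in (_ %% X)%N](prednK N_gt0) prim_expr_mod.
Qed.

Lemma ev_eq1 l x : (ev l x == 1) = (l x == 0).
Proof.
rewrite /ev -(expr0 z) (eq_prim_root_expr zp) mod0n modn_small //.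
by have := ltn_ord (l x); rewrite [X in (_ < X)%N](prednK N_gt0).
Qed.

Lemma ev0 l : l \in hom G (cyc N) -> ev l 0 = 1.
Proof. by move=> /homP lB; apply/eqP; rewrite ev_eq1 (zmorph0 lB). Qed.

Lemma norm_ev l x : `|ev l x| = 1.
Proof.
apply/eqP; rewrite -(@pexpr_eq1 _ _ N) ?normr_ge0 // -normrX /ev -exprM mulnC exprM.
by rewrite (prim_expr_order zp) expr1n normr1.
Qed.

(** Orthogonality: translation by some [y] in [L] with [ev l y <> 1] multiplies the sum by [ev l y],
    so the sum is [0]. *)
Lemma sum_ev_group l (L : {group G}) : l \in hom G (cyc N) ->
  \sum_(x in L) ev l x = if L \subset kerz l then #|L|%:R else 0.
Proof.
move=> lh; case: ifP => [/subsetP s|/negbT].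
  rewrite (eq_bigr (fun=> 1)) ?sumr_const // => x /s; rewrite mem_kerz // -ev_eq1.
  by move/eqP.
case/subsetPn => y yL; rewrite mem_kerz // -ev_eq1 => y1.
set S := \sum_(x in L) _; have e : S = ev l y * S.
  rewrite /S [LHS](reindex_inj (addrI y)) mulr_sumr; apply: eq_big => [x|x _].
    by rewrite -[(y + x)%R]/(y * x)%g groupMl.
  by rewrite evD.
apply/eqP; have : (1 - ev l y) * S == 0 by rewrite mulrBl mul1r -e subrr.
by rewrite mulf_eq0 subr_eq0 eq_sym (negbTE y1).
Qed.

Lemma sum_ev_neq0 x : x != 0 -> \sum_(l in hom G (cyc N)) ev l x = 0.
Proof.
move=> x0; have [l0 l0h l0x] := exists_char N_gt0 GN x0.
rewrite -ev_eq1 in l0x; set S := \sum_(l in _) _.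
have e : S = ev l0 x * S.
  rewrite /S [LHS](reindex_inj (addrI l0)) mulr_sumr; apply: eq_big => [l|l _].
    apply/homP/homP => lB a b; last first.
      by rewrite !ffunE lB (homP _ l0h) opprD addrACA.
    have := lB a b; rewrite !ffunE (homP _ l0h) opprD addrACA.
    by move/addrI.
  by rewrite evDl.
apply/eqP; have : (1 - ev l0 x) * S == 0 by rewrite mulrBl mul1r -e subrr.
by rewrite mulf_eq0 subr_eq0 eq_sym (negbTE l0x).
Qed.

Lemma sum_ev0 : \sum_(l in hom G (cyc N)) ev l 0 = #|hom G (cyc N)|%:R.
Proof.
by rewrite (eq_bigr (fun=> 1)) ?sumr_const // => l lh; rewrite ev0.
Qed.

Lemma sum_annihilator (L : {group G}) :
  (#|[set l in hom G (cyc N) | L \subset kerz l]%SET| * #|L|)%:R =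
  #|hom G (cyc N)|%:R :> C.
Proof.
transitivity (\sum_(x in L) \sum_(l in hom G (cyc N)) ev l x); last first.
  rewrite (bigD1 0) ?zgroup0 //= sum_ev0 big1 ?addr0 // => x /andP[_].
  exact: sum_ev_neq0.
rewrite exchange_big /= (eq_bigr _ (fun l lh => @sum_ev_group l L lh)).
rewrite -big_mkcondr /= natrM mulr_natl -sumr_const.
by apply: eq_bigl => l; rewrite [LHS]in_set.
Qed.

Lemma card_chars : #|hom G (cyc N)| = #|G|.
Proof.
have := sum_annihilator [set: G]%G; rewrite cardsT => /eqP; rewrite eqr_nat => /eqP <-.
rewrite (_ : [set l in _ | _]%SET = [set [ffun=> 0]]%SET) ?cards1 ?mul1n //.
apply/setP => l; rewrite [LHS]in_set in_set1; apply/andP/eqP => [[lh /subsetP s]|->].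
  apply/ffunP => x; rewrite ffunE; apply/eqP; rewrite -mem_kerz //.
  by apply: s; rewrite inE.
split; first exact: hom0.
by apply/subsetP => x _; rewrite mem_kerz ?hom0 // ffunE.
Qed.

Lemma card_annihilator (L : {group G}) :
  (#|[set l in hom G (cyc N) | L \subset kerz l]%SET| * #|L| = #|G|)%N.
Proof.
by apply/eqP; rewrite -(eqr_nat C) sum_annihilator card_chars.
Qed.

Lemma sum_ev x : \sum_(l in hom G (cyc N)) ev l x = #|G|%:R * (x == 0)%:R.
Proof.
have [->|x0] := eqVneq x 0; first by rewrite sum_ev0 card_chars mulr1.
by rewrite sum_ev_neq0 // mulr0.
Qed.

Definition hat f l : C := \sum_x f x * ev l x.

Lemma hat_inv f x :
  \sum_(l in hom G (cyc N)) hat f l * ev l (- x) = #|G|%:R * f x.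
Proof.
under eq_bigr do rewrite mulr_suml.
rewrite exchange_big /= (bigD1 x) //= [X in _ + X]big1 ?addr0 => [|y yx].
  under eq_bigr => l lh do rewrite -mulrA -evD // subrr.
  by rewrite -mulr_sumr sum_ev eqxx mulr1 mulrC.
under eq_bigr => l lh do rewrite -mulrA -evD //.
by rewrite -mulr_sumr sum_ev subr_eq0 (negbTE yx) !mulr0.
Qed.

Lemma hat_inj f g : (forall l, l \in hom G (cyc N) -> hat f l = hat g l) -> f =1 g.
Proof.
move=> e x; have G0 : (#|G|%:R : C) != 0.
  by rewrite pnatr_eq0 -lt0n; apply/card_gt0P; exists 0.
by apply: (mulfI G0); rewrite -!hat_inv; apply: eq_bigr => l lh; rewrite e.
Qed.

Definition delta0 (x : G) : C := (x == 0)%:R.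
Definition conv2 f g x : C := \sum_y f y * g (x - y).

Lemma hat_delta0 l : l \in hom G (cyc N) -> hat delta0 l = 1.
Proof.
move=> lh; rewrite /hat (bigD1 0) //= big1 ?addr0 => [|x x0].
  by rewrite /delta0 eqxx mul1r ev0.
by rewrite /delta0 (negbTE x0) mul0r.
Qed.

Lemma hat_conv2 f g l : l \in hom G (cyc N) -> hat (conv2 f g) l = hat f l * hat g l.
Proof.
move=> lh; rewrite /hat /conv2 mulr_suml.
under eq_bigr do rewrite mulr_suml.
rewrite exchange_big; apply: eq_bigr => y _ /=.
rewrite (reindex_inj (addrI y)) mulr_sumr; apply: eq_bigr => x _ /=.
by rewrite evD // [y + x]addrC addrK mulrACA.
Qed.

Section Conv.
Variable I : finType.
Implicit Types p : I -> G -> C.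

Lemma hat_conv p l : l \in hom G (cyc N) -> hat (convolution p) l = \prod_i hat (p i) l.
Proof.
move=> lh; rewrite /hat /convolution bigA_distr_bigA /=.
rewrite [RHS](partition_big (fun w : {ffun I -> G} => \sum_i w i) predT) //=.
apply: eq_bigr => x _; rewrite mulr_suml; apply: eq_bigr => w /eqP <-.
rewrite big_split /=; congr (_ * _).
by elim/big_rec2 : _ => [|i a b _ <-]; rewrite ?ev0 // evD.
Qed.

Lemma conv_ge0 p x : (forall i y, 0 <= p i y) -> 0 <= convolution p x.
Proof. by move=> p0; apply: sumr_ge0 => w _; apply: prodr_ge0. Qed.

Lemma conv_total p : (forall i, \sum_y p i y = 1) -> \sum_x convolution p x = 1.
Proof.
move=> p1; have := hat_conv p (hom0 _ _).
have e f : hat f [ffun=> 0] = \sum_x f x.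
  by apply: eq_bigr => x _; rewrite /ev ffunE expr0 mulr1.
by rewrite e => ->; rewrite big1 // => i _; rewrite e.
Qed.

(** Both sides have the same Fourier transform: at each index one of the two factors is the point
    mass at [0], whose transform is [1]. *)
Lemma conv_split p (s : pred I) :
  convolution p =1 conv2 (convolution (fun i => if s i then p i else delta0))
                  (convolution (fun i => if s i then delta0 else p i)).
Proof.
apply: hat_inj => l lh; rewrite hat_conv2 // !hat_conv // -big_split /=.
apply: eq_bigr => i _; case: (s i); rewrite hat_delta0 ?mulr1 ?mul1r //.
Qed.

End Conv.

Lemma norm_hat_le1 f l : (forall x, 0 <= f x) -> \sum_x f x = 1 -> `|hat f l| <= 1.
Proof.
move=> f0 f1; rewrite -f1; apply: (le_trans (ler_norm_sum _ _ _)).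
by apply: ler_sum => x _; rewrite normrM norm_ev mulr1 ger0_norm.
Qed.

End Fourier.

(** [|E zeta^X|^2 = 1 - sum_(v, w) P(X = v) P(X = w) (1 - Re zeta^(v - w))], where
    the terms with [v <> w] are bounded away from 0. *)
Section Contraction.
Variables (C : numClosedFieldType) (N : nat) (z : C).
Hypothesis N_gt0 : (0 < N)%N.
Hypothesis zp : N.-primitive_root z.

Let gap (vw : cyc N * cyc N) : C := 1 - 'Re (z ^+ \val vw.1 * (z ^+ \val vw.2)^*).

(** Positive, at most [1] and at most every gap between distinct [N]-th roots of unity; the sum of
    reciprocals replaces a minimum. *)
Definition kap : C := (1 + \sum_(vw : cyc N * cyc N | vw.1 != vw.2) (gap vw)^-1)^-1.

Let normzX k : `|z ^+ k| = 1.
Proof.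
apply/eqP; rewrite -(@pexpr_eq1 _ _ N) ?normr_ge0 // -normrX -exprM mulnC exprM.
by rewrite (prim_expr_order zp) expr1n normr1.
Qed.

Lemma Re_lt1 (w : C) : `|w| = 1 -> w != 1 -> 'Re w < 1.
Proof.
move=> w1 wn; have [le e] := leif_Re_Creal w; rewrite w1 in le e.
rewrite lt_neqAle le andbT e; apply: contra wn => w0.
by rewrite -(ger0_norm w0) w1.
Qed.

Let gap_gt0 vw : vw.1 != vw.2 -> 0 < gap vw.
Proof.
move=> ne; rewrite subr_gt0; apply: Re_lt1; first by rewrite normrM norm_conjC !normzX mulr1.
apply: contra ne => /eqP e; have : z ^+ \val vw.1 = z ^+ \val vw.2.
  rewrite -[LHS]mulr1 -[in LHS](expr1n _ 2) -(normzX (\val vw.2)) normCK.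
  by rewrite mulrCA e mulr1.
move/eqP; rewrite (eq_prim_root_expr zp) !modn_small //.
- have := ltn_ord vw.2; by rewrite [X in (_ < X)%N](prednK N_gt0).
- have := ltn_ord vw.1; by rewrite [X in (_ < X)%N](prednK N_gt0).
Qed.

Let sum_gap_ge0 : 0 <= \sum_(vw : cyc N * cyc N | vw.1 != vw.2) (gap vw)^-1.
Proof. by apply: sumr_ge0 => vw ne; rewrite invr_ge0 ltW // gap_gt0. Qed.

Lemma kap_gt0 : 0 < kap.
Proof. by rewrite invr_gt0 ltr_wpDr. Qed.

Let kap_gap vw : vw.1 != vw.2 -> kap <= gap vw.
Proof.
move=> ne; rewrite -[leRHS]invrK lef_pV2 ?posrE ?invr_gt0 ?gap_gt0 //; last first.
  by rewrite ltr_wpDr.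
rewrite (bigD1 vw) //= addrCA lerDl addr_ge0 // sumr_ge0 // => i /andP[ne' _].
by rewrite invr_ge0 ltW // gap_gt0.
Qed.

Lemma norm_hat_contract (G : finZmodType) (f : G -> C) (l : {ffun G -> cyc N}) eps :
  0 <= eps -> (forall x, 0 <= f x) -> \sum_x f x = 1 ->
  (forall v, \sum_(x | l x == v) f x <= 1 - eps) ->
  `|hat z f l| <= 1 - kap * eps / 2.
Proof.
move=> eps0 f0 f1 fv; pose q v := \sum_(x | l x == v) f x.
have q0 v : 0 <= q v by apply: sumr_ge0.
have q1 : \sum_v q v = 1 by rewrite -f1 [RHS](partition_big l predT).
have hq : hat z f l = \sum_v q v * z ^+ \val v.
  rewrite /hat (partition_big l predT) //=; apply: eq_bigr => v _.
  by rewrite mulr_suml; apply: eq_bigr => x /eqP <-.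
(* Every pair of distinct values loses at least [kap], and two independent copies differ with
   probability at least [eps]. *)
have sq : `|hat z f l| ^+ 2 <= 1 - kap * eps.
  have -> : `|hat z f l| ^+ 2 = \sum_v \sum_w q v * q w * 'Re (z ^+ \val v * (z ^+ \val w)^*).
    have r : `|hat z f l| ^+ 2 \is Num.real by rewrite rpredX // normr_real.
    rewrite -(Creal_ReP _ r) normCK hq [X in _ * X]rmorph_sum mulr_suml raddf_sum.
    apply: eq_bigr => v _; rewrite mulr_sumr raddf_sum; apply: eq_bigr => w _.
    rewrite rmorphM /= mulrACA; have /CrealP -> : q w \is Num.real by apply: ger0_real.
    by rewrite [LHS]ReMl ?rpredM ?ger0_real.
  apply: (@le_trans _ _ (\sum_v \sum_w (q v * q w - kap * (q v * q w * (v != w)%:R)))).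
    apply: ler_sum => v _; apply: ler_sum => w _; have [->|ne] /= := eqVneq v w.
      by rewrite mulr0 mulr0 subr0 -normCK normzX expr1n (Creal_ReP _ _) ?mulr1.
    rewrite mulr1 [kap * _]mulrC -[X in _ <= X - _]mulr1 -mulrBr ler_wpM2l ?mulr_ge0 //.
    by rewrite lerBrDr addrC -lerBrDr; apply: (kap_gap (vw := (v, w))).
  have e1 v : \sum_w q v * q w = q v by rewrite -mulr_sumr q1 mulr1.
  under eq_bigr => v _ do rewrite sumrB e1 -mulr_sumr.
  rewrite sumrB q1 -mulr_sumr lerD2l lerN2 ler_wpM2l ?(ltW kap_gt0) //.
  apply: (@le_trans _ _ (\sum_v q v * eps)); first by rewrite -mulr_suml q1 mul1r.
  apply: ler_sum => v _; under eq_bigr do rewrite -mulrA.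
  rewrite -mulr_sumr ler_wpM2l //.
  have -> : \sum_w q w * (v != w)%:R = 1 - q v.
    suff e : \sum_w q w = q v + \sum_w q w * (v != w)%:R by rewrite -[X in _ = X - _]q1 e [RHS]addrC addKr.
    rewrite (bigD1 v) //= [in RHS](bigD1 v) //= eqxx mulr0 add0r; congr (_ + _).
    by apply: eq_bigr => w wv; rewrite eq_sym wv mulr1.
  by rewrite lerBrDl -lerBrDr; apply: fv.
have h0 : 0 <= 1 - kap * eps by apply: le_trans sq; rewrite exprn_ge0.
have h1 : 0 <= 1 - kap * eps / 2.
  have -> : 1 - kap * eps / 2 = (1 + (1 - kap * eps)) / 2 by field.
  by rewrite divr_ge0 // addr_ge0.
rewrite -ler_sqr ?nnegrE //; apply: (le_trans sq).
have -> : (1 - kap * eps / 2) ^+ 2 = 1 - kap * eps + (kap * eps / 2) ^+ 2 by field.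
rewrite lerDl exprn_ge0 // divr_ge0 // mulr_ge0 // ltW //; exact: kap_gt0.
Qed.

End Contraction.

Section WalkC.
Variables (C : numClosedFieldType) (N : nat) (z : C).
Hypothesis N_gt0 : (0 < N)%N.
Hypothesis zp : N.-primitive_root z.
Variables (G : finZmodType) (L : {group G}) (I : finType).
Hypothesis GN : forall x : G, x *+ N = 0.
Variables (eps : C) (D : nat).
Hypothesis eps01 : 0 <= eps <= 1.

Let rho := 1 - kap N z * eps / 2.

Lemma kap_le1 : kap N z <= 1.
Proof.
have k0 := kap_gt0 N_gt0 zp; move: k0; rewrite /kap invr_gt0 => k0.
rewrite invf_le1 // lerDl sumr_ge0 // => vw _; rewrite invr_ge0.
rewrite subr_ge0; apply: le_trans (leif_Re_Creal _).1 _.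
have h k : `|z ^+ k| = 1.
  apply/eqP; rewrite -(@pexpr_eq1 _ _ N) ?normr_ge0 // -normrX -exprM mulnC exprM.
  by rewrite (prim_expr_order zp) expr1n normr1.
by rewrite normrM norm_conjC !h mulr1.
Qed.

Lemma rho_ge0 : 0 <= rho.
Proof.
case/andP: eps01 => e0 e1; have k0 := ltW (kap_gt0 N_gt0 zp).
rewrite subr_ge0 ler_pdivrMr // mul1r (@le_trans _ _ 1) ?ler1n //.
by rewrite mulr_ile1 // kap_le1.
Qed.

Lemma rho_le1 : rho <= 1.
Proof.
case/andP: eps01 => e0 e1; have k0 := ltW (kap_gt0 N_gt0 zp).
by rewrite /rho lerBlDr lerDl divr_ge0 // mulr_ge0.
Qed.

Implicit Types p : I -> G -> C.

(** The mixing condition on [L]: every character that is not trivial on [L] is contracted by at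
    least [D] of the steps in [S]. *)
Definition spread p (S : pred I) : Prop :=
  forall l, l \in hom G (cyc N) -> ~~ (L \subset kerz l) ->
    (D <= #|[pred i | S i && [forall v, (\sum_(x | l x == v) p i x <= 1 - eps)%R]]|)%N.

(** Fourier inversion: the characters trivial on [L] contribute [1 / #|L|], and each of the others,
    at most [#|G|] in number, has transform at most [rho ^ D]. *)
Lemma conv_equidist p y : (forall i x, 0 <= p i x) -> (forall i, \sum_x p i x = 1) ->
  (forall i x, x \notin L -> p i x = 0) -> spread p predT -> y \in L ->
  `|convolution p y - #|L|%:R^-1| <= rho ^+ D.
Proof.
move=> p0 p1 pL sp yL.
have G0 : (0 : C) < #|G|%:R by rewrite ltr0n; apply/card_gt0P; exists 0.
have L0 : (0 : C) < #|L|%:R by rewrite ltr0n; apply/card_gt0P; exists 0; apply: zgroup0.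
have := hat_inv N_gt0 zp GN (convolution p) y.
rewrite (bigID (fun l => L \subset kerz l)) /=.
have -> : \sum_(l in hom G (cyc N) | L \subset kerz l) hat z (convolution p) l * ev z l (- y) =
    #|G|%:R / #|L|%:R.
  rewrite -(card_annihilator N_gt0 zp GN L) natrM mulfK ?gt_eqF // -sumr_const.
  rewrite [RHS](eq_bigl (fun l => (l \in hom G (cyc N)) && (L \subset kerz l))); last first.
    by move=> l; rewrite [LHS]in_set.
  apply: eq_bigr => l /andP[lh /subsetP s].
  have e1 x : x \in L -> ev z l x = 1.
    by move=> /s; rewrite mem_kerz // -(ev_eq1 N_gt0 zp) => /eqP.
  rewrite e1 ?zgroupN // mulr1 (hat_conv N_gt0 zp) // big1 // => i _.
  rewrite -(p1 i); apply: eq_bigr => x _; have [xL|xL] := boolP (x \in L).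
    by rewrite e1 // mulr1.
  by rewrite pL // mul0r.
set S := \sum_(l in _ | _) _ => e.
have Sb : `|S| <= #|G|%:R * rho ^+ D.
  apply: (le_trans (ler_norm_sum _ _ _)).
  apply: (@le_trans _ _ (\sum_(l in hom G (cyc N) | ~~ (L \subset kerz l)) rho ^+ D)).
    apply: ler_sum => l /andP[lh ls]; rewrite normrM (norm_ev N_gt0 zp) mulr1.
    rewrite (hat_conv N_gt0 zp) // normr_prod.
    set A := [pred i | predT i && [forall v, (\sum_(x | l x == v) p i x <= 1 - eps)%R]].
    apply: (@le_trans _ _ (\prod_i (if A i then rho else 1))).
      apply: ler_prod => i _; rewrite normr_ge0 /=; case: ifP => [/forallP iA|_].
        by case/andP: eps01 => e0 _; apply: (norm_hat_contract N_gt0 zp e0 (p0 i) (p1 i) iA).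
      exact: norm_hat_le1.
    rewrite -big_mkcond prodr_const /=.
    by apply: ler_wiXn2l; rewrite ?rho_ge0 ?rho_le1 //; apply: sp.
  rewrite sumr_const -[leLHS]mulr_natl ler_wpM2r ?exprn_ge0 ?rho_ge0 // ler_nat.
  rewrite -(card_chars N_gt0 zp GN); apply/subset_leq_card/subsetP => l.
  by case/andP.
rewrite -(ler_pM2l G0) -[X in X * `|_|](ger0_norm (ltW G0)) -normrM mulrBr.
by rewrite -e addrAC subrr add0r.
Qed.

Lemma conv_supp p y : (forall i x, x \notin L -> p i x = 0) -> y \notin L -> convolution p y = 0.
Proof.
move=> pL yL; rewrite /convolution big1 // => w /eqP wy.
have [i|n] := pickP (fun i => w i \notin L); first by move=> /pL e; rewrite (bigD1 i) //= e mul0r.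
case/negP: yL; rewrite -wy; elim/big_ind : _ => [|a b|i _].
- exact: zgroup0.
- exact: zgroupD.
- by have /negbFE := n i.
Qed.

(** The steps outside [s] stay in [L] and are nearly uniform there. So the walk returns to [0] only
    if the steps in [s] add up to an element of [L], and whatever the others do, step [i0] allows
    this with probability at most [1 - eps]. *)
Lemma conv_escape p (s : pred I) (i0 : I) :
  (forall i x, 0 <= p i x) -> (forall i, \sum_x p i x = 1) ->
  (forall i x, ~~ s i -> x \notin L -> p i x = 0) -> spread p (predC s) -> s i0 ->
  (forall y, \sum_(x | x + y \in L) p i0 x <= 1 - eps) ->
  convolution p 0 <= (1 - eps) * (#|L|%:R^-1 + rho ^+ D).
Proof.
move=> p0 p1 pL sp si0 pe.
have d0 x : 0 <= delta0 C x :> C by [].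
have d1 : \sum_x delta0 C (x : G) = 1.
  by rewrite (bigD1 0) //= big1 ?addr0 /delta0 ?eqxx // => x /negbTE->.
pose pa i := if s i then p i else delta0 C (G := G).
pose pb i := if s i then delta0 C (G := G) else p i.
have pa0 i x : 0 <= pa i x by rewrite /pa; case: (s i).
have pb0 i x : 0 <= pb i x by rewrite /pb; case: (s i).
have pa1 i : \sum_x pa i x = 1 by rewrite /pa; case: (s i).
have pb1 i : \sum_x pb i x = 1 by rewrite /pb; case: (s i).
have pbL i x : x \notin L -> pb i x = 0.
  rewrite /pb; case: ifP => [_ xL|/negbT h]; last exact: pL.
  by rewrite /delta0; case: eqP xL => // ->; rewrite zgroup0.
have spb : spread pb predT.
  move=> l lh lL; apply: leq_trans (sp l lh lL) _; apply/subset_leq_card/subsetP => i.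
  case/andP => /negbTE e h; by apply/andP; split=> //; rewrite /pb e.
rewrite (conv_split N_gt0 zp GN p s 0) -/pa -/pb /conv2.
have caL y : convolution pb (0 - y) <= (y \in L)%:R * (#|L|%:R^-1 + rho ^+ D).
  rewrite sub0r; have [yL|yL] := boolP (y \in L); last first.
    rewrite conv_supp ?mul0r // -?zmodVgE ?groupV //.
  rewrite mul1r; have := conv_equidist pb0 pb1 pbL spb (zgroupN yL).
  have r : convolution pb (- y) - #|L|%:R^-1 \is Num.real.
    by rewrite rpredB // ger0_real // ?conv_ge0 // invr_ge0.
  by move=> /(le_trans (real_ler_norm r)); rewrite lerBlDl.
apply: (@le_trans _ _ (\sum_y convolution pa y * ((y \in L)%:R * (#|L|%:R^-1 + rho ^+ D)))).
  by apply: ler_sum => y _; rewrite ler_wpM2l // conv_ge0.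
under eq_bigr do rewrite mulrA.
rewrite -mulr_suml ler_wpM2r ?addr_ge0 ?invr_ge0 ?exprn_ge0 ?rho_ge0 //.
(* The step [i0] is separated from the other steps in [s]. *)
pose qa i := if predC1 i0 i then pa i else delta0 C (G := G).
have qa0 i x : 0 <= qa i x by rewrite /qa; case: (predC1 _ _).
have qa1 i : \sum_x qa i x = 1 by rewrite /qa; case: (predC1 _ _).
have e : convolution (fun i => if predC1 i0 i then delta0 C (G := G) else pa i) =1 p i0.
  apply: (hat_inj N_gt0 zp GN) => l lh; rewrite (hat_conv N_gt0 zp) // (bigD1 i0) //=.
  rewrite eqxx /= /pa si0 big1 ?mulr1 // => i ->; exact: hat_delta0.
have -> : \sum_y convolution pa y * (y \in L)%:R =
    \sum_u convolution qa u * \sum_(y in L) p i0 (y - u).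
  under eq_bigr => y _ do rewrite (conv_split N_gt0 zp GN pa (predC1 i0) y) /conv2 mulr_suml.
  rewrite exchange_big; apply: eq_bigr => u _; rewrite mulr_sumr [RHS]big_mkcond.
  apply: eq_bigr => y _; rewrite e -/qa; case: (y \in L); rewrite ?mulr1 ?mulr0 //.
apply: (@le_trans _ _ (\sum_u convolution qa u * (1 - eps))); last first.
  by rewrite -mulr_suml (conv_total N_gt0 zp) // mul1r.
apply: ler_sum => u _; rewrite ler_wpM2l ?conv_ge0 //.
rewrite (reindex_inj (addIr u)) /=; apply: le_trans (pe u).
by under eq_bigr do rewrite addrK.
Qed.

End WalkC.

Section WalkR.
Variables (R : rcfType) (N : nat).
Hypothesis N_gt0 : (0 < N)%N.

Definition spreadR (kN : nat) (G : finZmodType) (L : {group G}) (I : finType) (eps : R)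
    (D : nat) (p : I -> G -> R) (S : pred I) : Prop :=
  forall l, l \in hom G (cyc kN) -> ~~ (L \subset kerz l) ->
    (D <= #|[pred i | S i && [forall v, (\sum_(x | l x == v) p i x <= 1 - eps)%R]]|)%N.

Definition walk_bound (kappa : R) : Prop :=
  forall (G : finZmodType) (L : {group G}) (I : finType) (eps : R) (D : nat)
    (p : I -> G -> R),
    (forall x : G, x *+ N = 0) -> 0 <= eps <= 1 ->
    (forall i x, 0 <= p i x) -> (forall i, \sum_x p i x = 1) ->
    ((forall i x, x \notin L -> p i x = 0) -> spreadR N L eps D p predT ->
      forall y, y \in L -> `|convolution p y - #|L|%:R^-1| <= (1 - kappa * eps / 2) ^+ D) /\
    (forall (s : pred I) i0,
      (forall i x, ~~ s i -> x \notin L -> p i x = 0) ->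
      spreadR N L eps D p (predC s) -> s i0 ->
      (forall y, \sum_(x | x + y \in L) p i0 x <= 1 - eps) ->
      convolution p 0 <= (1 - eps) * (#|L|%:R^-1 + (1 - kappa * eps / 2) ^+ D)).

(** The estimates are proved in [R[i]], which has the roots of unity, and read back through the
    embedding of [R]. The constant depends on the exponent [N] only. *)
Lemma walk_bounds : exists2 kappa : R, 0 < kappa <= 1 & walk_bound kappa.
Proof.
have [z zp] := closed_prim_root R[i] N_gt0.
have k0 := kap_gt0 N_gt0 zp; have k1 := kap_le1 N_gt0 zp.
have /complex_realP[k ek] : kap N z \is Num.real by rewrite ger0_real // ltW.
rewrite ek in k0 k1.
rewrite ltcR in k0; rewrite lecR in k1; exists k; first by rewrite k0.
move=> G L I eps D p GN /andP[e0 e1] p0 p1.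
pose pc i x : R[i] := (p i x)%:C%C.
have convE y : convolution pc y = (convolution p y)%:C%C.
  by rewrite /convolution rmorph_sum; apply: eq_bigr => w _; rewrite rmorph_prod.
have pc0 i x : 0 <= pc i x by rewrite lecR.
have pc1 i : \sum_x pc i x = 1 by rewrite -rmorph_sum p1.
have ec : 0 <= eps%:C%C <= (1 : R[i]) by rewrite !lecR e0 e1.
have sE l i v : (\sum_(x | l x == v) pc i x <= 1 - eps%:C%C) =
    (\sum_(x | l x == v :> cyc N) p i x <= 1 - eps).
  by rewrite -rmorph_sum -[1 in LHS]/(1%:C%C) -rmorphB lecR.
have spE S : spreadR N L eps D p S -> spread N L (eps%:C%C) D pc S.
  move=> sp l lh lL; apply: leq_trans (sp l lh lL) _; apply/subset_leq_card/subsetP => i.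
  move=> /andP[Si /forallP h]; apply/andP; split=> //.
  by apply/forallP => v; rewrite sE.
have rE : 1 - kap N z * eps%:C%C / 2 = (1 - k * eps / 2)%:C%C.
  by rewrite ek rmorphB rmorph1 !rmorphM fmorphV rmorph_nat.
have LE : (#|L|%:R)^-1 = ((#|L|%:R : R)^-1)%:C%C :> R[i] by rewrite fmorphV rmorph_nat.
split=> [pL sp y yL|s i0 pL sp si0 pe].
  have := conv_equidist N_gt0 zp GN ec pc0 pc1 _ (spE _ sp) yL.
  rewrite convE rE LE -rmorphXn -rmorphB.
  rewrite normc_def /= expr0n addr0 sqrtr_sqr lecR; apply=> i x xL.
  by rewrite /pc pL.
have := conv_escape N_gt0 zp GN ec pc0 pc1 _ (spE _ sp) si0.
rewrite convE rE LE -rmorphXn -rmorphD.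
rewrite -[1 - _]/(1%:C%C - _) -rmorphB -rmorphM lecR; apply=> [i x ns xL|y].
  by rewrite /pc pL.
by rewrite -rmorph_sum lecR.
Qed.

End WalkR.

From mathcomp Require Import all_classical all_reals all_analysis.

Import Order.TTheory GRing.Theory Num.Theory FinRing.Theory.
Import numFieldNormedType.Exports.

Local Open Scope classical_set_scope.
Local Open Scope ring_scope.

(** * Probabilities as real numbers *)

Section Probability.
Context d (T : measurableType d) (R : realType) (P : probability T R).

Definition pr (A : set T) : R := fine (P A).

Lemma prE A : measurable A -> P A = (pr A)%:E.
Proof. by move=> mA; rewrite /pr fineK // fin_num_measure. Qed.

Lemma pr_ge0 A : 0 <= pr A. Proof. exact: fine_ge0. Qed.

Lemma pr_le A B : measurable A -> measurable B -> A `<=` B -> pr A <= pr B.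
Proof. by move=> mA mB AB; rewrite -lee_fin -!prE // le_measure ?inE. Qed.

Lemma pr_setT : pr setT = 1.
Proof. by rewrite /pr probability_setT. Qed.

Lemma pr_set0 : pr set0 = 0.
Proof. by rewrite /pr measure0. Qed.

Lemma discrete_rv_meas (E : Type) (X : T -> E) (S : set E) :
  discrete_rv X -> measurable [set t | S (X t)].
Proof. by move=> dX; apply: dX; exists S. Qed.

Lemma discrete_rv_comp (E F : Type) (X : T -> E) (f : E -> F) :
  discrete_rv X -> discrete_rv (f \o X).
Proof.
move=> dX A [S _ <-]; rewrite -[_ @^-1` _]/[set t | (f @^-1` S) (X t)].
exact: discrete_rv_meas.
Qed.

Lemma pr_sum (E : finType) (X : T -> E) (Q : pred E) : discrete_rv X ->
  pr [set t | Q (X t)] = \sum_(x | Q x) pr [set t | X t = x].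
Proof.
move=> dX.
have h (s : seq E) : uniq s ->
    pr [set t | X t \in s] = \sum_(x <- s) pr [set t | X t = x].
  elim: s => [_|x s IH /= /andP[xs us]].
    by rewrite big_nil -pr_set0; congr pr; apply/seteqP; split=> t.
  have m (S : set E) : measurable [set t | S (X t)] := discrete_rv_meas S dX.
  have m1 := m [set x]; have m2 := m [set` s]; have m3 := m [set` x :: s].
  rewrite big_cons -IH //; apply: EFin_inj; rewrite EFinD.
  rewrite -(prE m1) -(prE m2) -(prE m3) -measureU //; first congr (P _).
  - apply/seteqP; split=> t /=; rewrite in_cons.
      by case/orP => [/eqP|]; [left|right].
    by case=> [->|->]; rewrite ?eqxx ?orbT.
  - apply/seteqP; split=> t //= [e]; by rewrite e (negbTE xs).
rewrite -[RHS]big_filter -h ?filter_uniq ?index_enum_uniq //.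
congr pr; apply/seteqP; split=> t /=; first by rewrite mem_filter mem_index_enum andbT.
by rewrite mem_filter => /andP[].
Qed.

Lemma pr_total (E : finType) (X : T -> E) : discrete_rv X ->
  \sum_x pr [set t | X t = x] = 1.
Proof.
move=> dX; rewrite -(pr_sum predT dX) -pr_setT; congr pr.
by apply/seteqP; split.
Qed.

(** Balancedness, in the form of bounds for the preimages of differences-closed sets. *)
Lemma balanced_bound (E : zmodType) eps (X : T -> E) (K S : set E) :
  balanced P eps X -> is_subgroup K -> K <> setT ->
  (forall a b, S a -> S b -> K (a - b)) -> pr [set t | S (X t)] <= 1 - eps.
Proof.
move=> [dX bX] sK KT SK; have [[g Sg]|nS] := pselect (exists g, S g); last first.
  have := bX K 0 sK KT; rewrite prE ?lee_fin; last exact: (discrete_rv_meas [set (0 + x)%R | x in K]).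
  apply: le_trans; rewrite (_ : [set t | _] = set0) ?pr_set0 ?pr_ge0 //.
  by apply/seteqP; split=> // t St; apply: nS; exists (X t).
have := bX K g sK KT; rewrite prE ?lee_fin; last exact: (discrete_rv_meas [set (g + x)%R | x in K]).
apply: le_trans; apply: pr_le.
- exact: discrete_rv_meas.
- exact: (discrete_rv_meas [set (g + x)%R | x in K]).
- by move=> t St; exists (X t - g); [apply: SK|rewrite addrC subrK].
Qed.

Lemma pr_indep (K : finType) (D : {pred K}) (F : K -> set (set T)) (E : K -> set T) :
  (forall k, k \in D -> measurable (E k)) ->
  mutually_independent P [set k | k \in D] F -> (forall k, k \in D -> F k (E k)) ->
  pr (\bigcap_(k in [set k | k \in D]) E k) = \prod_(k in D) pr (E k).
Proof.
move=> mE ind FE; pose J := [fset k in enum D]%fset.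
have JD k : (k \in J) = (k \in D) by rewrite inE /= mem_enum.
have JE : [set` J] = [set k | k \in D] by apply/seteqP; split=> k /=; rewrite JD.
rewrite /pr -JE ind; last by move=> k; rewrite JD => kD; split=> //; apply: FE.
rewrite (eq_big_seq (fun k => (pr (E k))%:E)); last first.
  by move=> k; rewrite JD => kD; rewrite prE //; apply: mE.
by rewrite prodEFin /= big_uniq ?fset_uniq //=; apply: eq_bigl.
Qed.

End Probability.

(** * The vector [F M] and its independent blocks *)

Section ColumnCombination.
Variables (n m : nat) (G : finZmodType) (F : {ffun 'I_n -> G}).

Definition colcomb (M : 'M[int]_(n, m)) : {ffun 'I_m -> G} :=
  [ffun j => \sum_i F i *~ M i j].

(** The contribution of one block to [F M], extended by [0] off the columns [B] so that all
    contributions live in the same group. *)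
Definition blockcomb (A : {set 'I_n}) (B : {set 'I_m}) (b : 'M[int]_(#|A|, #|B|)) :
    {ffun 'I_m -> G} :=
  [ffun j => \sum_(j' | enum_val j' == j) \sum_i F (enum_val i) *~ b i j'].

Lemma blockcombB (A : {set 'I_n}) (B : {set 'I_m}) : zmod_morphism (@blockcomb A B).
Proof.
move=> b c; apply/ffunP => j; rewrite !ffunE -sumrB; apply: eq_bigr => j' _.
by rewrite -sumrB; apply: eq_bigr => i _; rewrite !mxE mulrzBr.
Qed.

Lemma blockcomb_block (A : {set 'I_n}) (B : {set 'I_m}) (M : 'M[int]_(n, m)) j :
  blockcomb (block A B M) j = if j \in B then \sum_(i in A) F i *~ M i j else 0.
Proof.
rewrite ffunE.
transitivity (\sum_(j' < #|B| | enum_val j' == j) \sum_(i in A) F i *~ M i (enum_val j')).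
  apply: eq_bigr => j' _; rewrite [RHS]big_enum_val; apply: eq_bigr => i _.
  by rewrite mxE.
rewrite -(big_enum_val_cond (A := mem B) (fun x => x == j) (fun x => \sum_(i in A) F i *~ M i x)) /=.
case: ifP => jB.
  rewrite (eq_bigl (fun x => x == j)) ?big_pred1_eq // => x.
  by case: eqP => [->|]; rewrite ?jB ?andbF.
by rewrite big_pred0 // => x; case: eqP => [->|]; rewrite ?jB ?andbF.
Qed.

Lemma blockcomb_delta (A : {set 'I_n}) (B : {set 'I_m}) (i : 'I_#|A|) (j : 'I_#|B|) :
  blockcomb (delta_mx i j) = [ffun k => if k == enum_val j then F (enum_val i) else 0].
Proof.
apply/ffunP => k; rewrite !ffunE; case: eqP => [->|ne].
  rewrite (eq_bigl (fun x => x == j)); last first.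
    by move=> x; rewrite (inj_eq enum_val_inj).
  rewrite big_pred1_eq (bigD1 i) //= mxE !eqxx mulr1z big1 ?addr0 // => i' ne.
  by rewrite mxE (negbTE ne) mulr0z.
apply: big1 => j' /eqP e; apply: big1 => i' _; rewrite mxE.
by case: eqP => [_|_]; case: eqP => [ej|_] /=; rewrite ?mulr0z //; case: ne; rewrite -e ej.
Qed.

End ColumnCombination.

Section ProductFormula.
Context d (T : measurableType d) (R : realType) (P : probability T R).
Variables (n m : nat) (M : T -> 'M[int]_(n, m)).
Hypothesis dM : discrete_rv M.
Variables (PP : {set {set 'I_n}}) (QQ : {set {set 'I_m}}).
Hypothesis PPp : finset.partition PP [set: 'I_n]%SET.
Hypothesis QQp : finset.partition QQ [set: 'I_m]%SET.
Hypothesis ind : mutually_independent P [set AB | AB.1 \in PP /\ AB.2 \in QQ]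
  (fun AB => sigma_discrete (fun t => block AB.1 AB.2 (M t))).
Variables (G : finZmodType) (F : {ffun 'I_n -> G}).

Let K := ({set 'I_n} * {set 'I_m})%type.
Let D : {pred K} := [pred k | (k.1 \in PP) && (k.2 \in QQ)].

(** Zero for a pair that is not a block, so that the index set is a full product type; such a pair
    has the point mass at [0] as its law. *)
Definition blockrv (k : K) (t : T) : {ffun 'I_m -> G} :=
  if (k.1 \in PP) && (k.2 \in QQ) then blockcomb F (block k.1 k.2 (M t)) else 0.

Definition blocklaw (A : {set 'I_n}) (B : {set 'I_m}) (x : {ffun 'I_m -> G}) : R :=
  pr P [set t | blockrv (A, B) t = x].

Lemma blockrv_meas k (S : set {ffun 'I_m -> G}) : measurable [set t | S (blockrv k t)].
Proof.
pose f (N : 'M[int]_(n, m)) : {ffun 'I_m -> G} :=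
  if (k.1 \in PP) && (k.2 \in QQ) then blockcomb F (block k.1 k.2 N) else 0.
exact: (discrete_rv_meas (f @^-1` S) dM).
Qed.

Lemma blockrv_discrete k : discrete_rv (blockrv k).
Proof. by move=> A [S _ <-]; apply: blockrv_meas. Qed.

Lemma joint_law (w : {ffun K -> {ffun 'I_m -> G}}) :
  pr P [set t | [ffun k => blockrv k t] = w] = \prod_k blocklaw k.1 k.2 (w k).
Proof.
have off k t : k \notin D -> blockrv k t = 0 by rewrite /blockrv => /negbTE; rewrite inE => ->.
have [k|wD] := pickP (fun k => (k \notin D) && (w k != 0)).
  case/andP => kD wk; rewrite (bigD1 k) //= /blocklaw -surjective_pairing.
  rewrite (_ : [set t | blockrv k t = w k] = set0) ?pr_set0 ?mul0r.
    rewrite (_ : [set t | _] = set0) ?pr_set0 //; apply/seteqP; split=> // t /= e.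
    by move: wk; rewrite -e ffunE off // eqxx.
  by apply/seteqP; split=> // t /= e; move: wk; rewrite -e off // eqxx.
have w0 k : k \notin D -> w k = 0.
  by move=> kD; have := wD k; rewrite kD /= => /negbFE/eqP.
rewrite (bigID (mem D)) /= [X in _ * X]big1 ?mulr1; last first.
  move=> k kD; rewrite /blocklaw -surjective_pairing w0 // -(pr_setT P); congr pr.
  by apply/seteqP; split=> // t _ /=; apply: off.
have -> : \prod_(k in D) blocklaw k.1 k.2 (w k) =
    \prod_(k in D) pr P [set t | blockrv k t = w k].
  by apply: eq_bigr => k _; rewrite /blocklaw -surjective_pairing.
rewrite -(pr_indep (F := fun AB => sigma_discrete (fun t => block AB.1 AB.2 (M t)))).
- congr pr; apply/seteqP; split=> t /=.
    by move=> e k _ /=; rewrite -e ffunE.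
  move=> e; apply/ffunP => k; rewrite ffunE; have [kD|kD] := boolP (k \in D).
    exact: (e k kD).
  by rewrite off // w0.
- move=> k _; exact: (@blockrv_meas k [set w k]).
- move=> J E h; apply: ind => k kJ; have [kD ?] := h k kJ; split=> //.
  by move: kD => /= /andP[].
- move=> k /= kD; exists [set b | blockcomb F b = w k] => //.
  by rewrite /blockrv; rewrite inE in kD; rewrite kD.
Qed.

Lemma sum_blockrv B t j : (\sum_A blockrv (A, B) t) j =
  if (B \in QQ) && (j \in B) then colcomb F (M t) j else 0.
Proof.
rewrite sum_ffunE; have [BQ|BQ] /= := boolP (B \in QQ); last first.
  by rewrite big1 // => A _; rewrite /blockrv /= (negbTE BQ) andbF ffunE.
transitivity (\sum_(A in PP) if j \in B then \sum_(i in A) F i *~ M t i j else 0).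
  rewrite [RHS]big_mkcond; apply: eq_bigr => A _; rewrite /blockrv /= BQ andbT.
  by case: ifP => _; [exact: blockcomb_block|rewrite ffunE].
case: ifP => _; last by rewrite big1.
rewrite ffunE -(set_partition_big _ PPp) /=.
by apply: eq_bigl => i; rewrite inE.
Qed.

Lemma colcomb_eq0 t : (colcomb F (M t) == 0) =
  [forall B, \sum_A [ffun k => blockrv k t] (A, B) == 0].
Proof.
have e B : \sum_A [ffun k => blockrv k t] (A, B) = \sum_A blockrv (A, B) t.
  by apply: eq_bigr => A _; rewrite ffunE.
apply/eqP/forallP => [c0 B|h].
  by apply/eqP/ffunP => j; rewrite e sum_blockrv c0 !ffunE; case: ifP.
apply/ffunP => j; have jQ : j \in finset.cover QQ by rewrite (finset.cover_partition QQp) inE.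
have := h (finset.pblock QQ j); rewrite e => /eqP/ffunP/(_ j); rewrite sum_blockrv.
by rewrite finset.pblock_mem // finset.mem_pblock jQ.
Qed.

(** [F M] vanishes when its restriction to every column block does. Such a restriction is a sum of
    independent contributions of the row blocks, and different column blocks are independent. *)
Lemma product_formula :
  pr P [set t | colcomb F (M t) = 0] =
  \prod_(B in QQ) convolution (blocklaw^~ B) (0 : {ffun 'I_m -> G}).
Proof.
have dW : discrete_rv (fun t => [ffun k => blockrv k t]).
  pose f (N : 'M[int]_(n, m)) : {ffun K -> {ffun 'I_m -> G}} :=
    [ffun k => if (k.1 \in PP) && (k.2 \in QQ) then blockcomb F (block k.1 k.2 N) else 0].
  have -> : (fun t => [ffun k => blockrv k t]) = f \o M.
    by apply: funext => t; apply/ffunP => k; rewrite /= !ffunE.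
  exact: discrete_rv_comp.
pose Q (w : {ffun K -> {ffun 'I_m -> G}}) := [forall B, \sum_A w (A, B) == 0].
rewrite (_ : [set t | _] = [set t | Q [ffun k => blockrv k t]]); last first.
  apply/seteqP; split=> t /=; first by move=> /eqP; rewrite colcomb_eq0.
  by move=> h; apply/eqP; rewrite colcomb_eq0.
rewrite (pr_sum _ Q dW).
rewrite (eq_bigr _ (fun w _ => joint_law w)).
have -> : \prod_(B in QQ) convolution (blocklaw^~ B) 0 = \prod_B convolution (blocklaw^~ B) 0.
  rewrite big_mkcond; apply: eq_bigr => B _; case: ifPn => // BQ.
  have law0 A x : blocklaw A B x = (x == 0)%:R.
    rewrite /blocklaw /blockrv /= (negbTE BQ) andbF; case: eqP => [->|ne].
      by rewrite -[RHS]/(1 : R) -(pr_setT P); congr pr; apply/seteqP; split.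
    by rewrite -[RHS]/(0 : R) -(pr_set0 P); congr pr; apply/seteqP; split=> // t /= e; apply: ne.
  rewrite /convolution (bigD1 [ffun=> 0]) /=; last by rewrite big1 // => A _; rewrite ffunE.
  rewrite big1 => [|A _]; last by rewrite law0 ffunE eqxx.
  rewrite big1 ?addr0 // => v /andP[_ v0].
  have [A vA|e] := pickP (fun A => v A != 0).
    by rewrite (bigD1 A) //= law0 (negbTE vA) mul0r.
  case/eqP: v0; apply/ffunP => A; rewrite ffunE; apply/eqP; exact: (negbFE (e A)).
have convE B : convolution (blocklaw^~ B) 0 =
    \sum_(v : {ffun {set 'I_n} -> {ffun 'I_m -> G}})
       (\sum_A v A == 0)%:R * \prod_A blocklaw A B (v A).
  rewrite /convolution big_mkcond; apply: eq_bigr => v _; case: ifP; rewrite ?mul1r ?mul0r //.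
under [RHS]eq_bigr do rewrite convE.
rewrite bigA_distr_bigA /=.
(* Currying turns the sum over families indexed by pairs into a product over [B] of sums over
   families indexed by [A]. *)
pose cur (w : {ffun K -> {ffun 'I_m -> G}}) :
  {ffun {set 'I_m} -> {ffun {set 'I_n} -> {ffun 'I_m -> G}}} := [ffun B => [ffun A => w (A, B)]].
pose unc (v : {ffun {set 'I_m} -> {ffun {set 'I_n} -> {ffun 'I_m -> G}}}) :
  {ffun K -> {ffun 'I_m -> G}} := [ffun k => v k.2 k.1].
have cK : cancel unc cur by move=> v; apply/ffunP => B; apply/ffunP => A; rewrite !ffunE.
have uK : cancel cur unc by move=> w; apply/ffunP => -[A B]; rewrite !ffunE.
rewrite [LHS]big_mkcond (reindex unc) /=; last by exists cur => v _; rewrite ?cK ?uK.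
apply: eq_bigr => v _; rewrite big_split /=.
have -> : \prod_k blocklaw k.1 k.2 (unc v k) = \prod_B \prod_A blocklaw A B (v B A).
  rewrite exchange_big pair_bigA /=; apply: eq_bigr => -[A B] _ /=.
  by rewrite ffunE.
have Qe : Q (unc v) = [forall B, \sum_A v B A == 0].
  by apply: eq_forallb => B; congr (_ == _); apply: eq_bigr => A _; rewrite ffunE.
rewrite Qe; case: ifP => [/forallP h|/negbT].
  by rewrite [X in X * _]big1 ?mul1r // => B _; rewrite h.
by rewrite negb_forall => /existsP[B /negbTE nB]; rewrite (bigD1 B) //= nB !mul0r.
Qed.

End ProductFormula.

Lemma prod_near (R : realFieldType) (I : Type) (r : seq I) (a b : I -> R) e :
  0 <= e -> (forall i, 0 <= b i) -> (forall i, `|a i - b i| <= b i * e) ->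
  `|\prod_(i <- r) a i - \prod_(i <- r) b i| <= \prod_(i <- r) b i * ((1 + e) ^+ size r - 1).
Proof.
move=> e0 b0 ab; elim: r => [|i r IH].
  by rewrite !big_nil /= expr0 !subrr normr0 mulr0.
rewrite !big_cons /= exprS; set A := \prod_(j <- r) a j; set B := \prod_(j <- r) b j in IH *.
have B0 : 0 <= B by apply: prodr_ge0.
have -> : a i * A - b i * B = a i * (A - B) + (a i - b i) * B by ring.
apply: (le_trans (ler_normD _ _)); rewrite !normrM (ger0_norm B0).
have ai : `|a i| <= b i * (1 + e).
  rewrite -[a i](subrK (b i)) (le_trans (ler_normD _ _)) // (ger0_norm (b0 i)).
  by rewrite mulrDr mulr1 addrC lerD2l.
apply: (@le_trans _ _ (b i * (1 + e) * (B * ((1 + e) ^+ size r - 1)) + b i * e * B)).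
  by apply: lerD; [apply: ler_pM|apply: ler_wpM2r].
by rewrite le_eqVlt; apply/orP; left; apply/eqP; ring.
Qed.

(** * The law of [F M] for a fixed vector [F] *)

Section PerVector.
Context d (T : measurableType d) (R : realType) (P : probability T R).
Variables (n m : nat) (M : T -> 'M[int]_(n, m)) (eps : R).
Hypothesis dM : discrete_rv M.
Variables (PP : {set {set 'I_n}}) (QQ : {set {set 'I_m}}).
Hypothesis PPp : finset.partition PP [set: 'I_n]%SET.
Hypothesis QQp : finset.partition QQ [set: 'I_m]%SET.
Hypothesis ind : mutually_independent P [set AB | AB.1 \in PP /\ AB.2 \in QQ]
  (fun AB => sigma_discrete (fun t => block AB.1 AB.2 (M t))).
Hypothesis bal : forall A B, A \in PP -> B \in QQ -> balanced P eps (fun t => block A B (M t)).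
Variables (G : finZmodType) (F : {ffun 'I_n -> G}).

Let V : finZmodType := {ffun 'I_m -> G}.
Implicit Types H : {group G}.

Definition inside (A : {set 'I_n}) H := [forall i in A, F i \in H].

(** The subgroup [H ^ B] of [G ^ m]. *)
Definition colgroup (B : {set 'I_m}) H : {group V} :=
  grp [set y : V | [forall j, if j \in B then y j \in H else y j == 0]]%SET.

Lemma mem_colgroup B H (y : V) :
  (y \in colgroup B H) = [forall j, if j \in B then y j \in H else y j == 0].
Proof.
rewrite mem_grp; first by rewrite finset.in_set.
split.
  by rewrite finset.in_set; apply/forallP => j; rewrite !ffunE; case: ifP => // _; apply: zgroup0.
move=> a b; rewrite !finset.in_set => /forallP ha /forallP hb; apply/forallP => j.
have := ha j; have := hb j; rewrite !ffunE; case: ifP => _.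
  by move=> h1 h2; apply: zgroupB.
by move=> /eqP-> /eqP->; rewrite subr0.
Qed.

Lemma card_colgroup B H : #|colgroup B H| = (#|H| ^ #|B|)%N.
Proof.
rewrite -(card_pffun_on (0 : G) (mem B) (mem H)); apply: eq_card => y.
rewrite mem_colgroup; apply/forallP/pffun_onP => [h|[h1 h2] j].
  split=> [|x].
    apply/supportP => j jB; have := h j; rewrite (negbTE jB) => /eqP //.
  by case/fintype.imageP => j jB ->; have := h j; rewrite jB.
case: ifPn => jB; first by apply: h2; apply: fintype.image_f.
by apply/eqP; move/supportP: h1 => /(_ j jB).
Qed.

Definition unitv (j : 'I_m) (x : G) : V := [ffun k => if k == j then x else 0].

Lemma unitvB j : zmod_morphism (unitv j).
Proof. by move=> x y; apply/ffunP => k; rewrite !ffunE; case: eqP; rewrite ?subr0. Qed.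

Lemma unitv_sum (y : V) : y = \sum_j unitv j (y j).
Proof.
apply/ffunP => k; rewrite sum_ffunE (bigD1 k) //= ffunE eqxx big1 ?addr0 // => j jk.
by rewrite ffunE eq_sym (negbTE jk).
Qed.

Lemma blockrv_colgroup A B H t : (A \in PP -> inside A H) ->
  blockrv M PP QQ F (A, B) t \in colgroup B H.
Proof.
move=> ins; rewrite /blockrv /=; case: ifP => [/andP[AP BQ]|_]; last exact: zgroup0.
rewrite mem_colgroup; apply/forallP => j.
case: ifP => jB; rewrite blockcomb_block jB //; elim/big_ind : _ => [|a b|i iA].
- exact: zgroup0.
- exact: zgroupD.
- have FiH : F i \in H by have /forallP/(_ i)/implyP/(_ iA) := ins AP.
  case: (M t i j) => k; first exact: zgroupMn.
  by rewrite NegzE mulrNz; apply/zgroupN/zgroupMn.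
Qed.

Lemma blocklaw_sum A B (Q : pred V) :
  \sum_(x | Q x) blocklaw P M PP QQ F A B x = pr P [set t | Q (blockrv M PP QQ F (A, B) t)].
Proof. by rewrite (pr_sum P Q (@blockrv_discrete _ _ _ _ _ dM PP QQ _ F (A, B))). Qed.

Lemma blocklaw_supp A B H x : (A \in PP -> inside A H) -> x \notin colgroup B H ->
  blocklaw P M PP QQ F A B x = 0.
Proof.
move=> ins xL; rewrite /blocklaw -(pr_set0 P); congr pr; apply/seteqP; split=> // t /= e.
by case/negP: xL; rewrite -e; apply: blockrv_colgroup.
Qed.

Variables (N : nat) (D : nat) (H : {group G}).
(** Robust spreading of [F] over [H], like a code of distance [D]: to make the blocks inside [H]
    generate less than [H], at least [D] of them must be dropped. Supplied by [core_code]. *)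
Hypothesis code : forall H' : {group G}, H' \subset H -> H' != H ->
  (D <= #|[pred A | [&& A \in PP, inside A H & ~~ inside A H']]|)%N.

(** A character that is nontrivial on [H ^ B] is nontrivial at some coordinate [j], where it is
    trivial only on a proper subgroup [H'] of [H]. By [code], [D] row blocks lie inside [H] but not
    inside [H']; on each of them the character is a nonzero homomorphism of the matrix block, to
    which balancedness applies. *)
Lemma block_spread B (S : pred {set 'I_n}) : B \in QQ ->
  (forall A, A \in PP -> inside A H -> S A) ->
  spreadR N (colgroup B H) eps D (blocklaw P M PP QQ F ^~ B) S.
Proof.
move=> BQ hS l lh; case/fintype.subsetPn => y yL; rewrite mem_kerz // => ly.
have /homP lB := lh.
have [j lj] : exists j, l (unitv j (y j)) != 0.
  apply/existsP; apply: contraR ly => /existsPn h.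
  rewrite [y]unitv_sum (zmorph_sum lB) big1 // => j _; apply/eqP.
  by have := h j; rewrite negbK.
have := yL; rewrite mem_colgroup => /forallP/(_ j); have [jB yjH|jB /eqP yj0] := ifP; last first.
  by case/negP: lj; rewrite yj0 (zmorph0 (@unitvB j)) (zmorph0 lB).
pose H' : {group G} := grp [set x in H | l (unitv j x) == 0]%SET.
have mH' x : (x \in H') = (x \in H) && (l (unitv j x) == 0).
  rewrite mem_grp; first by rewrite finset.in_set.
  split.
    by rewrite finset.in_set zgroup0 (zmorph0 (@unitvB j)) (zmorph0 lB) /=.
  move=> a b; rewrite !finset.in_set => /andP[aH /eqP la] /andP[bH /eqP lb].
  by rewrite zgroupB //= unitvB lB la lb subrr.
have H'H : H' \subset H by apply/fintype.subsetP => x; rewrite mH' => /andP[].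
have nH' : H' != H.
  by apply: contra lj => /eqP e; have := yjH; rewrite -e mH' => /andP[].
apply: leq_trans (code H'H nH') _; apply/subset_leq_card/fintype.subsetP => A.
rewrite !inE => /and3P[AP AH AH']; rewrite (hS _ AP AH) /=.
have [i hi] := forallPn AH'; move: hi; rewrite negb_imply => /andP[iA iH'].
have FiH : F i \in H by have /forallP/(_ i)/implyP/(_ iA) := AH.
rewrite mH' FiH /= in iH'.
apply/forallP => v; rewrite blocklaw_sum.
have -> : [set t | l (blockrv M PP QQ F (A, B) t) == v] =
    [set t | (l (blockcomb F (block A B (M t))) == v)].
  by apply/seteqP; split=> t /=; rewrite /blockrv /= AP BQ.
apply: (balanced_bound (K := [set b | l (blockcomb F b) = 0]) (S := [set b | l (blockcomb F b) == v]) (bal AP BQ)).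
- have h0 := @blockcombB _ m _ F A B; split => [|b c /= hb hc].
    by rewrite /= (zmorph0 h0) (zmorph0 lB).
  by rewrite h0 lB hb hc subrr.
- pose i' := enum_rank_in iA i; pose j' := enum_rank_in jB j.
  move=> e; have : [set b | l (blockcomb F b) = 0] (delta_mx i' j') by rewrite e.
  rewrite /= blockcomb_delta !enum_rankK_in // => e0.
  by case/negP: iH'; apply/eqP.
- by move=> a b /= /eqP ha /eqP hb; rewrite (@blockcombB _ m _ F A B) lB ha hb subrr.
Qed.

(** The matrix blocks that [F] sends into [H ^ B] form a proper subgroup: a single entry in a row
    [i] with [F i] outside [H] is not among them. *)
Lemma block_escape A B : A \in PP -> B \in QQ -> ~~ inside A H ->
  forall y, \sum_(x | x + y \in colgroup B H) blocklaw P M PP QQ F A B x <= 1 - eps.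
Proof.
move=> AP BQ nA y; rewrite blocklaw_sum.
have -> : [set t | blockrv M PP QQ F (A, B) t + y \in colgroup B H] =
    [set t | (blockcomb F (block A B (M t)) + y \in colgroup B H)].
  by apply/seteqP; split=> t /=; rewrite /blockrv /= AP BQ.
apply: (balanced_bound (K := [set b | blockcomb F b \in colgroup B H])
   (S := [set b | blockcomb F b + y \in colgroup B H]) (bal AP BQ)).
- have h0 := @blockcombB _ m _ F A B; split => [|b c /= hb hc].
    by rewrite /= (zmorph0 h0) zgroup0.
  by rewrite h0 zgroupB.
- have [i hi] := forallPn nA; move: hi; rewrite negb_imply => /andP[iA iH].
  have [j jB] : exists j, j \in B.
    have : B != finset.set0.
      by have /and3P[_ _] := QQp; apply: contra => /eqP <-.
    by case/set0Pn => j; exists j.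
  pose i' := enum_rank_in iA i; pose j' := enum_rank_in jB j.
  move=> e; have : [set b | blockcomb F b \in colgroup B H] (delta_mx i' j') by rewrite e.
  rewrite /= blockcomb_delta !enum_rankK_in // mem_colgroup => /forallP/(_ j).
  by rewrite jB ffunE eqxx (negbTE iH).
- move=> a b /= ha hb; rewrite (@blockcombB _ m _ F A B).
  rewrite (_ : _ - _ = (blockcomb F a + y) - (blockcomb F b + y)) ?zgroupB //.
  by rewrite opprD addrACA subrr addr0.
Qed.

Hypothesis N_gt0 : (0 < N)%N.
Hypothesis GN : forall x : G, x *+ N = 0.
Hypothesis eps01 : 0 <= eps <= 1.
Variables (kappa : R) (W : nat).
Hypothesis k0 : 0 < kappa <= 1.
Hypothesis walk : walk_bound N kappa.
Hypothesis Wb : forall B, B \in QQ -> (#|B| <= W)%N.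

Let rho := 1 - kappa * eps / 2.
(** Bounds the error [rho ^ D] relative to the main term [#|H| ^- #|B|], uniformly over blocks of at
    most [W] columns. *)
Definition walk_err : R := #|G|%:R ^+ W * rho ^+ D.

Let rho0 : 0 <= rho.
Proof.
case/andP: eps01 => e0 e1; case/andP: k0 => k0' k1; rewrite subr_ge0 ler_pdivrMr // mul1r.
by rewrite (@le_trans _ _ 1) ?ler1n // mulr_ile1 // ltW.
Qed.

Let VN (x : V) : x *+ N = 0.
Proof.
apply/ffunP => j; have -> : (x *+ N) j = x j *+ N.
  by elim: (N) => [|k IH]; rewrite ?mulr0n ?ffunE // !mulrS ffunE IH.
by rewrite GN ffunE.
Qed.

Let H0 : (0 : R) < #|H|%:R.
Proof. by rewrite ltr0n; apply/card_gt0P; exists 0; apply: zgroup0. Qed.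

Let errB B : B \in QQ -> rho ^+ D <= #|H|%:R ^- #|B| * walk_err.
Proof.
move=> BQ; rewrite ler_pdivlMl ?exprn_gt0 // ler_wpM2r ?exprn_ge0 // -!natrX ler_nat.
apply: (@leq_trans (#|G| ^ #|B|)%N).
  have HG : (#|H| <= #|G|)%N by rewrite -[#|G|]cardsT subset_leq_card // subsetT.
  by case: #|B| => // k; rewrite leq_exp2r.
rewrite leq_pexp2l ?Wb //; by apply/card_gt0P; exists 0.
Qed.

Let sumB : (\sum_(B in QQ) #|B| = m)%N.
Proof. by rewrite -(finset.card_partition QQp) cardsT card_ord. Qed.

Let prodH : \prod_(B in QQ) #|H|%:R ^- #|B| = #|H|%:R ^- m :> R.
Proof.
transitivity (#|H|%:R ^- (\sum_(B in QQ) #|B|)%N : R); last by rewrite sumB.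
rewrite prodfV; congr (_^-1).
by elim/big_rec2 : _ => [|B a b _ ->]; rewrite ?expr0 // exprD.
Qed.

Lemma law_escape A0 : A0 \in PP -> ~~ inside A0 H ->
  pr P [set t | colcomb F (M t) = 0] <=
  (1 - eps) ^+ #|QQ| * #|H|%:R ^- m * (1 + walk_err) ^+ #|QQ|.
Proof.
move=> AP nA; rewrite (product_formula dM PPp QQp ind F).
apply: (@le_trans _ _ (\prod_(B in QQ) ((1 - eps) * #|H|%:R ^- #|B| * (1 + walk_err)))); last first.
  by rewrite !big_split /= prodH !prodr_const.
apply: ler_prod => B BQ; apply/andP; split.
  by apply: sumr_ge0 => w _; apply: prodr_ge0 => A _; apply: pr_ge0.
have [_ esc] := walk (colgroup B H) D (p := blocklaw P M PP QQ F ^~ B) VN eps01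
   (fun A x => pr_ge0 _ _) (fun A => pr_total P (@blockrv_discrete _ _ _ _ _ dM PP QQ _ F (A, B))).
apply: le_trans (esc (fun A => (A \in PP) && ~~ inside A H) A0 _ _ _ _) _.
- move=> A x; rewrite negb_and negbK => h; apply: blocklaw_supp => AP'.
  by move: h; rewrite AP'.
- by apply: block_spread => // A AP' iA /=; rewrite iA andbF.
- by rewrite AP nA.
- exact: block_escape.
case/andP: eps01 => e0 e1; rewrite -[leRHS]mulrA ler_wpM2l ?subr_ge0 // [leRHS]mulrDr mulr1.
by rewrite card_colgroup natrX lerD2l errB.
Qed.

Lemma law_code : (forall A, A \in PP -> inside A H) ->
  `|pr P [set t | colcomb F (M t) = 0] - #|H|%:R ^- m| <=
  #|H|%:R ^- m * ((1 + walk_err) ^+ #|QQ| - 1).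
Proof.
move=> ins; rewrite (product_formula dM PPp QQp ind F) -prodH.
have e0 : 0 <= walk_err by rewrite /walk_err mulr_ge0 ?exprn_ge0.
pose a B := if B \in QQ then convolution (blocklaw P M PP QQ F ^~ B) (0 : V) else 0.
pose b B : R := if B \in QQ then #|H|%:R ^- #|B| else 0.
have b0 B : 0 <= b B by rewrite /b; case: ifP => // _; rewrite invr_ge0 exprn_ge0.
have ab B : `|a B - b B| <= b B * walk_err.
  rewrite /a /b; case: ifP => [BQ|_]; last by rewrite subrr normr0 mul0r.
  have [eq_ _] := walk (colgroup B H) D (p := blocklaw P M PP QQ F ^~ B) VN eps01
     (fun A x => pr_ge0 _ _) (fun A => pr_total P (@blockrv_discrete _ _ _ _ _ dM PP QQ _ F (A, B))).
  have := eq_ _ _ 0 (zgroup0 _); rewrite card_colgroup natrX => h.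
  apply: le_trans (h _ _) (errB BQ).
    by move=> A x; apply: blocklaw_supp; apply: ins.
  exact: block_spread.
have := prod_near (enum QQ) e0 b0 ab; rewrite -cardE.
have eqa : \prod_(B <- enum QQ) a B = \prod_(B in QQ) convolution (blocklaw P M PP QQ F ^~ B) 0.
  by rewrite big_enum; apply: eq_bigr => B BQ; rewrite /a BQ.
have eqb : \prod_(B <- enum QQ) b B = \prod_(B in QQ) #|H|%:R ^- #|B|.
  by rewrite big_enum; apply: eq_bigr => B BQ; rewrite /b BQ.
by rewrite eqa eqb.
Qed.

End PerVector.

(** * The core of a vector, and the number of vectors with a given core *)

Section CountVectors.
Variables (n : nat) (PP : {set {set 'I_n}}) (G : finZmodType).
Hypothesis PPp : finset.partition PP [set: 'I_n]%SET.
Implicit Types (F : {ffun 'I_n -> G}) (H : {group G}).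

Definition outside F H : nat := #|[pred A : {set 'I_n} | (A \in PP) && ~~ inside F A H]|.

(** The entries of [F] generate [G], so [F] is a surjection [Z ^ n -> G]. *)
Definition genvec F := [forall H : {group G}, [forall i, F i \in H] ==> (H == [set: G]%G)].

Lemma card_vec_off (U : {set 'I_n}) H :
  (#|[set F : {ffun 'I_n -> G} | [forall (i | i \notin U), F i \in H]]%SET| <= #|G| ^ #|U| * #|H| ^ n)%N.
Proof.
have H0 : (0 < #|H|)%N by apply/card_gt0P; exists 0; apply: zgroup0.
pose S i : {set G} := if i \in U then [set: G]%SET else H.
have -> : #|[set F : {ffun 'I_n -> G} | [forall (i | i \notin U), F i \in H]]%SET| = (\prod_i #|S i|)%N.
  transitivity (\sum_(F : {ffun 'I_n -> G}) \prod_i (F i \in S i))%N.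
    rewrite -sum1_card big_mkcond; apply: eq_bigr => F _; rewrite finset.in_set.
    case: ifP => [/forallP h|/negbT].
      rewrite big1 // => i _; have := h i; rewrite /S; case: ifP => //=; last by move=> _ ->.
      by move=> _ _; rewrite inE.
    case/forallPn => i; rewrite negb_imply => /andP[iU iH].
    by rewrite (bigD1 i) //= /S (negbTE iU) (negbTE iH).
  rewrite -(bigA_distr_bigA (fun i (x : G) => (x \in S i) : nat)) /=; apply: eq_bigr => i _.
  by rewrite -sum1_card [RHS]big_mkcond; apply: eq_bigr.
apply: (@leq_trans (\prod_i ((if i \in U then #|G| else 1) * #|H|))%N).
  apply: leq_prod => i _; rewrite /S; case: ifP => _; last by rewrite mul1n.
  by rewrite cardsT leq_pmulr.
by rewrite big_split /= -big_mkcond !prod_nat_const card_ord.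
Qed.

Lemma card_vec_outside (hh k : nat) H : (forall A, A \in PP -> (#|A| <= hh)%N) ->
  (#|[set F : {ffun 'I_n -> G} | (outside F H <= k)%N]%SET| <= n.+1 ^ k * #|G| ^ (hh * k) * #|H| ^ n)%N.
Proof.
move=> hA.
pose U (f : {ffun 'I_k -> option 'I_n}) : {set 'I_n} :=
  (\bigcup_(j < k) (if f j is Some i then finset.pblock PP i else finset.set0))%SET.
have U_card f : (#|U f| <= hh * k)%N.
  apply: (@leq_trans (\sum_(j < k) hh)%N); last by rewrite sum_nat_const card_ord mulnC.
  rewrite /U; elim/big_rec2 : _ => [|j a B _ le]; first by rewrite cards0.
  apply: leq_trans (leq_card_setU _ _).1 _; apply: leq_add => //.
  case: (f j) => [i|]; last by rewrite cards0.
  by apply: hA; apply: finset.pblock_mem; rewrite (finset.cover_partition PPp) inE.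
have H1 : (#|[set F : {ffun 'I_n -> G} | (outside F H <= k)%N]%SET| <=
    \sum_f #|[set F : {ffun 'I_n -> G} | [forall (i | i \notin U f), F i \in H]]%SET|)%N.
  rewrite -sum1_card big_mkcond.
  rewrite [leqRHS](eq_bigr (fun f => \sum_(F : {ffun 'I_n -> G}) ([forall (i | i \notin U f), F i \in H] : nat))%N); last first.
    move=> f _; rewrite -sum1_card big_mkcond; apply: eq_bigr => F _.
    by rewrite finset.in_set; case: ifP.
  rewrite exchange_big; apply: leq_sum => F _; rewrite finset.in_set; case: ifP => // Fk.
  pose s := enum [pred A : {set 'I_n} | (A \in PP) && ~~ inside F A H].
  have sk : (size s <= k)%N by rewrite -cardE.
  pose f : {ffun 'I_k -> option 'I_n} := [ffun j : 'I_k => [pick i in nth finset.set0 s j]].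
  rewrite (bigD1 f) //= (_ : [forall (i | _), _]) //.
  apply/forallP => i; apply/implyP => iU; apply: contraR iU => FiH.
  have iP : finset.pblock PP i \in PP.
    by apply: finset.pblock_mem; rewrite (finset.cover_partition PPp) inE.
  have ii : i \in finset.pblock PP i by rewrite finset.mem_pblock (finset.cover_partition PPp) inE.
  have bs : finset.pblock PP i \in s.
    rewrite mem_enum inE iP /=; apply/forallPn; exists i.
    by rewrite negb_imply ii FiH.
  have jk : (index (finset.pblock PP i) s < k)%N by apply: leq_trans sk; rewrite index_mem.
  apply/finset.bigcupP; exists (Ordinal jk) => //; rewrite ffunE /= nth_index //.
  case: pickP => [i' i'P|/(_ i)]; last by rewrite ii.
  suff <- : finset.pblock PP i = finset.pblock PP i' by [].
  have tP : finset.trivIset PP by have /and3P[] := PPp.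
  by apply/esym; apply: finset.same_pblock.
apply: leq_trans H1 _.
apply: (@leq_trans (\sum_(f : {ffun 'I_k -> option 'I_n}) #|G| ^ (hh * k) * #|H| ^ n)%N).
  apply: leq_sum => f _; apply: leq_trans (card_vec_off _ _) _.
  rewrite leq_mul2r leq_pexp2l ?U_card ?orbT //.
  by apply/card_gt0P; exists 0.
by rewrite sum_nat_const card_ffun card_option !card_ord mulnA.
Qed.

Variable D : nat.
Hypothesis D_gt0 : (0 < D)%N.

Let cost F H := (outside F H + D * #|H|)%N.

(** A subgroup carrying most of the blocks of [F], minimal up to the penalty [D]:
    the blocks inside it are then robustly spread over it. *)
Definition core F : {group G} := [arg min_(H < [set: G]%G) cost F H].

Lemma core_min F H : (cost F (core F) <= cost F H)%N.
Proof. by rewrite /core; case: arg_minnP => // H' _; apply. Qed.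

Lemma outsideT F : outside F [set: G]%G = 0%N.
Proof.
apply: eq_card0 => A; rewrite inE; apply/negbTE; rewrite negb_and negbK.
by apply/orP; right; apply/forallP => i; apply/implyP => _; rewrite inE.
Qed.

Lemma core_outside F : (outside F (core F) <= D * #|G|)%N.
Proof.
have := core_min F [set: G]%G; rewrite /cost outsideT add0n cardsT.
by apply: leq_trans; apply: leq_addr.
Qed.

(** Passing from the core to [H'] expels [c] more blocks and saves at least [D] in the penalty, so
    minimality forces [D <= c]. *)
Lemma core_code F (H' : {group G}) : H' \subset core F -> H' != core F ->
  (D <= #|[pred A : {set 'I_n} | [&& A \in PP, inside F A (core F) & ~~ inside F A H']]|)%N.
Proof.
move=> sub ne; set c := #|_|.
have sub' : forall A, inside F A H' -> inside F A (core F).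
  move=> A /forallP h; apply/forallP => i; apply/implyP => iA.
  by apply: (fintype.subsetP sub); have /implyP := h i; apply.
have e : outside F H' = (outside F (core F) + c)%N.
  rewrite /outside /c -!sum1_card (bigID (fun A => inside F A (core F))) /= addnC.
  congr (_ + _)%N; apply: eq_bigl => A; rewrite !inE -andbA.
    case: (A \in PP) => //=; have [iA|] := boolP (inside F A H'); first by rewrite sub'.
    by [].
  by case: (A \in PP) => //=; rewrite andbC.
have lt : (#|H'| < #|core F|)%N.
  by apply: proper_card; rewrite finset.properEneq sub andbT; apply: contra ne => /eqP h; apply/eqP/val_inj.
have := core_min F H'; rewrite /cost e -addnA leq_add2l => h.
rewrite -(leq_add2r (D * #|H'|)); apply: leq_trans h.
by rewrite -mulnS leq_mul2l lt orbT.
Qed.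

(** A proper subgroup containing all entries would cost [D * #|H|], less than the cost [D * #|G|] of
    [G]. *)
Lemma core_full_gen F : core F = [set: G]%G -> genvec F.
Proof.
move=> cT; apply/forallP => H; apply/implyP => /forallP FH; apply/negPn/negP => HT.
have := core_min F H; rewrite /cost cT outsideT add0n.
have -> : outside F H = 0%N.
  apply: eq_card0 => A; rewrite inE; apply/negbTE; rewrite negb_and negbK.
  by apply/orP; right; apply/forallP => i; apply/implyP => _.
rewrite add0n leq_pmul2l // leqNgt; case/negP; apply: proper_card.
by rewrite finset.properT; apply: contra HT => /eqP h; apply/eqP/val_inj.
Qed.

Lemma core_escape F : genvec F -> core F != [set: G]%G ->
  exists2 A, A \in PP & ~~ inside F A (core F).
Proof.
move=> /forallP/(_ (core F)) gF cT; have : ~~ [forall i, F i \in core F].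
  by apply: contra cT; move/implyP: gF; apply.
case/forallPn => i FiH.
have iC : i \in finset.cover PP by rewrite (finset.cover_partition PPp) inE.
exists (finset.pblock PP i); first exact: finset.pblock_mem.
by apply/forallPn; exists i; rewrite negb_imply FiH finset.mem_pblock iC.
Qed.

Lemma card_core (hh : nat) H : (forall A, A \in PP -> (#|A| <= hh)%N) ->
  (#|[set F | core F == H]%SET| <= n.+1 ^ (D * #|G|) * #|G| ^ (hh * (D * #|G|)) * #|H| ^ n)%N.
Proof.
move=> hA; apply: leq_trans (card_vec_outside (D * #|G|) H hA).
apply/subset_leq_card/fintype.subsetP => F; rewrite !finset.in_set => /eqP <-.
exact: core_outside.
Qed.

End CountVectors.

Lemma card_subgroups (G : finZmodType) : (#|{group G}| <= 2 ^ #|G|)%N.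
Proof.
rewrite -cardsT -(card_imset _ val_inj) /=.
apply: leq_trans (subset_leq_card (finset.subsetT _)) _.
by rewrite -finset.powersetT finset.card_powerset cardsT.
Qed.

(** * A bound for the moments at fixed [n] *)

Section MomentBound.
Context d (T : measurableType d) (R : realType) (P : probability T R).
Variables (n u : nat) (M : T -> 'M[int]_(n, n + u)) (eps : R).
Hypothesis dM : discrete_rv M.
Variables (PP : {set {set 'I_n}}) (QQ : {set {set 'I_(n + u)}}).
Hypothesis PPp : finset.partition PP [set: 'I_n]%SET.
Hypothesis QQp : finset.partition QQ [set: 'I_(n + u)]%SET.
Hypothesis ind : mutually_independent P [set AB | AB.1 \in PP /\ AB.2 \in QQ]
  (fun AB => sigma_discrete (fun t => block AB.1 AB.2 (M t))).
Hypothesis bal : forall A B, A \in PP -> B \in QQ -> balanced P eps (fun t => block A B (M t)).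
Variables (G : finZmodType) (N : nat).
Hypothesis GN : forall x : G, x *+ N = 0.
Hypothesis eps01 : 0 <= eps <= 1.
Variables (kappa : R) (W hh D : nat).
Hypothesis k0 : 0 < kappa <= 1.
Hypothesis walk : walk_bound N kappa.
Hypothesis Wb : forall B, B \in QQ -> (#|B| <= W)%N.
Hypothesis hA : forall A, A \in PP -> (#|A| <= hh)%N.
Hypothesis D_gt0 : (0 < D)%N.

(** The expected number of surjections from the cokernel to [G], by [mean_sur_cokmod]. *)
Definition moment : R :=
  \sum_(F : {ffun 'I_n -> G} | genvec F) pr P [set t | colcomb F (M t) = 0].

(** Every vector is compared with [#|G| ^- (n + u)], which sums to [#|G| ^- u] over [G ^ n]. Vectors
    with full core give the relative error [E - 1]. A proper core [H] belongs to at most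
    [C * #|H| ^ n] vectors, each costing the escape bound and the subtracted term; the latter sum to
    at most [C * 2 ^ -n] because [#|H| <= #|G| / 2]. There are at most [2 ^ #|G|] subgroups. *)
Lemma moment_bound (E C : R) :
  E = (1 + walk_err eps G D kappa W) ^+ #|QQ| ->
  C = (n.+1 ^ (D * #|G|) * #|G| ^ (hh * (D * #|G|)))%:R ->
  `|moment - #|G|%:R ^- u| <=
    (E - 1) + 2 ^+ #|G| * C * (2^-1 ^+ n + (1 - eps) ^+ #|QQ| * E).
Proof.
move=> Ed Cd; pose TT : {group G} := [set: G]%G.
have [e0 e1] := andP eps01.
have G0 : (0 : R) < #|G|%:R by rewrite ltr0n; apply/card_gt0P; exists 0.
have werr0 : 0 <= walk_err eps G D kappa W.
  rewrite /walk_err mulr_ge0 ?exprn_ge0 // subr_ge0 ler_pdivrMr // mul1r.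
  have [k0' k1] := andP k0.
  by rewrite (@le_trans _ _ 1) ?ler1n // mulr_ile1 // ltW.
have E1 : 1 <= E by rewrite Ed; apply: exprn_ege1; rewrite lerDl.
have E0 : 0 <= E := le_trans ler01 E1.
have C0 : 0 <= C by rewrite Cd; apply: ler0n.
have ee0 : 0 <= (1 - eps) ^+ #|QQ| by rewrite exprn_ge0 // subr_ge0.
pose p (F : {ffun 'I_n -> G}) := pr P [set t | colcomb F (M t) = 0].
pose c (F : {ffun 'I_n -> G}) := core PP D F.
have gm : \sum_(F : {ffun 'I_n -> G}) #|G|%:R ^- (n + u) = #|G|%:R ^- u :> R.
  rewrite sumr_const card_ffun card_ord -[LHS]mulr_natl natrX exprD invfM mulrA mulfV ?mul1r //.
  by rewrite expf_neq0 // gt_eqF.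
rewrite /moment big_mkcond -gm -sumrB.
pose bnd F := if c F == TT then #|G|%:R ^- (n + u) * (E - 1)
  else (1 - eps) ^+ #|QQ| * #|c F|%:R ^- (n + u) * E + #|G|%:R ^- (n + u) : R.
apply: (@le_trans _ _ (\sum_F bnd F)).
  apply: (le_trans (ler_norm_sum _ _ _)); apply: ler_sum => F _; rewrite /bnd.
  have code := @core_code n PP G D F; case: eqP => [cT|/eqP cT].
    rewrite (core_full_gen D_gt0 cT); have := law_code dM PPp QQp ind bal code GN eps01 k0 walk Wb.
    rewrite -Ed -/(c F) cT cardsT; apply => A _; apply/forallP => i; apply/implyP => _.
    by rewrite inE.
  (* A vector that does not generate is absent from the moment and costs only the subtracted
     term. *)
  case: ifP => [gF|_]; last first.
    by rewrite sub0r normrN ger0_norm ?invr_ge0 ?exprn_ge0 // lerDr !mulr_ge0 // invr_ge0 exprn_ge0.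
  have [A AP nA] := core_escape PPp gF cT.
  have esc := law_escape dM PPp QQp ind bal code GN eps01 k0 walk Wb AP nA.
  rewrite -Ed in esc.
  apply: (le_trans (ler_normB _ _)); apply: lerD; first by rewrite ger0_norm ?pr_ge0.
  by rewrite ger0_norm // invr_ge0 exprn_ge0.
rewrite (bigID (fun F => c F == TT)) /=; apply: lerD.
  rewrite (eq_bigr (fun=> #|G|%:R ^- (n + u) * (E - 1))); last by move=> F cT; rewrite /bnd cT.
  apply: (@le_trans _ _ (\sum_(F : {ffun 'I_n -> G}) #|G|%:R ^- (n + u) * (E - 1))).
    rewrite [leRHS](bigID (fun F => c F == TT)) /= lerDl sumr_ge0 // => F _.
    by rewrite mulr_ge0 ?invr_ge0 ?exprn_ge0 // subr_ge0.
  rewrite -mulr_suml gm ler_piMl ?subr_ge0 // invf_le1 ?exprn_gt0 // exprn_ege1 //.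
  by rewrite ler1n -(ltr0n R).
rewrite (partition_big c (fun H => H != TT)) //=.
apply: (@le_trans _ _ (\sum_(H : {group G}) C * (2^-1 ^+ n + (1 - eps) ^+ #|QQ| * E))); last first.
  rewrite sumr_const -[leLHS]mulr_natl -mulrA ler_wpM2r //.
    by rewrite mulr_ge0 // addr_ge0 ?mulr_ge0 // exprn_ge0 // invr_ge0.
  by rewrite -natrX ler_nat card_subgroups.
have half0 : 0 <= 2^-1 ^+ n + (1 - eps) ^+ #|QQ| * E.
  by rewrite addr_ge0 ?mulr_ge0 // exprn_ge0 // invr_ge0.
rewrite big_mkcond; apply: ler_sum => H _; case: ifP => [HT|_]; last by rewrite mulr_ge0.
have H0 : (0 : R) < #|H|%:R by rewrite ltr0n; apply/card_gt0P; exists 0; apply: zgroup0.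
set b := (1 - eps) ^+ #|QQ| * #|H|%:R ^- (n + u) * E + #|G|%:R ^- (n + u).
rewrite (eq_bigr (fun=> b)); last first.
  by move=> F /andP[cT /eqP cH]; rewrite /bnd (negbTE cT) cH.
have b0 : 0 <= b.
  rewrite /b; apply: addr_ge0; last by rewrite invr_ge0 exprn_ge0 ?ler0n.
  by apply: mulr_ge0 => //; apply: mulr_ge0 => //; rewrite invr_ge0 exprn_ge0 ?ler0n.
rewrite sumr_const -[leLHS]mulr_natl.
apply: (@le_trans _ _ (C * #|H|%:R ^+ n * b)).
  rewrite ler_wpM2r // Cd -natrX -natrM ler_nat; apply: leq_trans (@card_core n PP G PPp D hh H hA).
  by apply/subset_leq_card/fintype.subsetP => F /andP[_ cH]; rewrite finset.in_set.
rewrite -mulrA ler_wpM2l // /b mulrDr addrC; apply: lerD.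
  rewrite exprD invfM mulrA -[leRHS]mulr1; apply: ler_pM.
  - by rewrite divr_ge0 // exprn_ge0.
  - by rewrite invr_ge0 exprn_ge0.
  - rewrite -exprVn -exprMn; apply: lerXn2r; rewrite ?nnegrE ?divr_ge0 ?invr_ge0 //.
    rewrite ler_pdivrMr // mulrC ler_pdivlMr // -natrM ler_nat.
    have := card_proper_sub (G := G) (H := H); rewrite (_ : (_ != _) = true); last first.
      by apply: contra HT => /eqP h; apply/eqP/val_inj.
    move=> /(_ isT) h; rewrite muln2 -[leqRHS]odd_double_half.
    by apply: leq_trans (leq_addl _ _); rewrite leq_double.
  - rewrite invf_le1 ?exprn_gt0 // exprn_ege1 // ler1n -(ltr0n R) //.
set r := (1 - eps) ^+ #|QQ|; set h := #|H|%:R; set x := h ^- (n + u).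
have -> : h ^+ n * (r * x * E) = r * E * (h ^+ n * x) by ring.
apply: ler_piMr; first exact: mulr_ge0.
rewrite /x exprD invfM mulrA mulfV ?mul1r ?expf_neq0 ?gt_eqF //.
by rewrite invf_le1 ?exprn_gt0 // exprn_ege1 // ler1n -(ltr0n R).
Qed.

End MomentBound.

(** * The choice of the threshold [D] *)

Section Asymptotics.
Variable R : realType.

(** From [exp t >= t ^ 2 / 2], with [M] chosen so that [4 K <= c delta ^ 2 l]. *)
Lemma linear_le_exp (K c delta : R) : 0 <= K -> 0 < c -> 0 < delta ->
  exists2 M, 1 <= M & forall l, M <= l -> K * (1 + l) <= c * expR (delta * l).
Proof.
move=> K0 c0 d0; have cd0 : 0 < c * delta ^+ 2 by rewrite mulr_gt0 ?exprn_gt0.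
exists (1 + 4 * K / (c * delta ^+ 2)); first by rewrite lerDl divr_ge0 ?mulr_ge0 // ltW.
move=> l Ml; have l1 : 1 <= l.
  by apply: le_trans Ml; rewrite lerDl divr_ge0 ?mulr_ge0 // ltW.
have l0 := le_trans ler01 l1.
have Kl : 4 * K <= c * delta ^+ 2 * l.
  rewrite [leRHS]mulrC -ler_pdivrMr //; apply: le_trans Ml; by rewrite lerDr.
have := expR_ge1Dxn 1 (mulr_ge0 (ltW d0) l0) => /= h.
apply: (@le_trans _ _ (c * ((delta * l) ^+ 2 / 2))); last first.
  by rewrite ler_pM2l //; apply: le_trans h; rewrite lerDr.
have -> : c * ((delta * l) ^+ 2 / 2) = c * delta ^+ 2 * l * l / 2 by field.
nra.
Qed.

Variables (alpha1 alpha2 beta A1 A2 B kappa g : R).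
Hypothesis (a1_ge0 : 0 <= alpha1) (a2_ge0 : 0 <= alpha2) (b_ge0 : 0 <= beta).
Hypothesis hab : 2 * alpha1 + alpha2 < 1 - 2 * beta.
Hypothesis (A1_gt0 : 0 < A1) (A2_gt0 : 0 < A2) (B_gt0 : 0 < B) (k_gt0 : 0 < kappa).
Hypothesis g_ge1 : 1 <= g.

(** The exponent of [D], which equates the two margins [gam - beta - alpha1] and
    [1 - beta - alpha1 - (gam + alpha2)]. Their common value [delta] is positive exactly under
    [hab]. *)
Definition gam : R := (1 - alpha2) / 2.
Let delta := gam - alpha1 - beta.

Let delta_gt0 : 0 < delta.
Proof. by rewrite /delta /gam; move: hab; lra. Qed.

(** Here [l = ln n] and [g = #|G|]. The first inequality makes the walk error at most [(e n) ^ -2],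
    since [eps D] outgrows [W]; the second lets [exp (- eps n / (2 W))] beat the number of vectors
    with a given proper core. After division by the dominant power of [n], both compare a linear
    function of [l] with [exp (delta l)]. *)
Lemma exponent_bounds : exists2 M, 1 <= M & forall (l W h eps D : R), M <= l ->
  0 < W <= A1 * expR (alpha1 * l) -> 0 <= h <= A2 * expR (alpha2 * l) ->
  B * expR (- beta * l) <= eps -> expR (gam * l) <= D <= 2 * expR (gam * l) ->
  W * ln g - kappa * eps * D / 2 <= - (2 * (1 + l)) /\
  D * g * (1 + l) + h * D * g * ln g - eps * expR l / (2 * W) <= - (1 + l).
Proof.
have lg0 : 0 <= ln g by rewrite ln_ge0.
pose c1 := kappa * B / 2; have c10 : 0 < c1 by rewrite divr_gt0 // mulr_gt0.
pose c2 := B / (2 * A1); have c20 : 0 < c2 by rewrite divr_gt0 // mulr_gt0.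
have g0 : 0 < g := lt_le_trans ltr01 g_ge1.
have K1 : 0 <= A1 * ln g + 2 by rewrite addr_ge0 // mulr_ge0 // ltW.
have K2 : 0 <= 2 * g + 2 * A2 * g * ln g + 1.
  by rewrite !addr_ge0 // !mulr_ge0 // ltW.
have [M1 M11 H1] := linear_le_exp K1 c10 delta_gt0.
have [M2 M21 H2] := linear_le_exp K2 c20 delta_gt0.
exists (Num.max M1 M2); first by rewrite le_max M11.
move=> l W h eps D; rewrite ge_max => /andP[/[dup] /H1 h1 M1l /H2 h2].
move=> /andP[W0 Wle] /andP[h0 hle] epsge /andP[Dge Dle].
have l1 : 1 <= l := le_trans M11 M1l; have l0 := le_trans ler01 l1.
set x := expR (delta * l) in h1 h2 *.
have x0 : 0 < x := expR_gt0 _.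
have eps0 : 0 < eps by apply: lt_le_trans epsge; rewrite mulr_gt0 ?expR_gt0.
have D0 : 0 < D by apply: lt_le_trans Dge; apply: expR_gt0.
have ge1 a : 0 <= a -> 1 <= expR (a * l) by move=> a0; rewrite -expR0 ler_expR mulr_ge0.
split.
  set y := expR (alpha1 * l) in Wle *; have y1 : 1 <= y := ge1 _ a1_ge0.
  have e1 : c1 * (y * x) <= kappa * eps * D / 2.
    have -> : y * x = expR (- beta * l) * expR (gam * l).
      by rewrite /y /x -!expRD /delta; congr expR; ring.
    have : B * expR (- beta * l) * expR (gam * l) <= eps * D.
      by apply: ler_pM => //; rewrite ?mulr_ge0 ?expR_ge0 // ltW.
    rewrite /c1 => h'; have -> : kappa * B / 2 * (expR (- beta * l) * expR (gam * l)) =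
       kappa / 2 * (B * expR (- beta * l) * expR (gam * l)) by ring.
    have -> : kappa * eps * D / 2 = kappa / 2 * (eps * D) by ring.
    by rewrite ler_pM2l // divr_gt0.
  have e2 : W * ln g <= A1 * y * ln g by rewrite ler_wpM2r.
  have e3 : A1 * ln g + 2 * (1 + l) <= c1 * x.
    apply: le_trans h1; rewrite [leRHS]mulrDl lerD2r ler_peMr ?lerDl //.
    by rewrite mulr_ge0 // ltW.
  have e4 : y * (A1 * ln g + 2 * (1 + l)) <= y * (c1 * x).
    by rewrite ler_pM2l // (lt_le_trans ltr01).
  have e5 : 2 * (1 + l) <= y * (2 * (1 + l)).
    by rewrite ler_peMl // mulr_ge0 // addr_ge0.
  nra.
set y := expR ((gam + alpha2) * l).
have gam0 : 0 <= gam by move: delta_gt0 a1_ge0 b_ge0; rewrite /delta /gam; lra.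
have y1 : 1 <= y by apply: ge1; rewrite addr_ge0.
have yE : y = expR (gam * l) * expR (alpha2 * l) by rewrite /y -expRD; congr expR; ring.
have e1 : c2 * (y * x) <= eps * expR l / (2 * W).
  rewrite ler_pdivlMr ?mulr_gt0 //.
  apply: (@le_trans _ _ (c2 * (y * x) * (2 * (A1 * expR (alpha1 * l))))).
    apply: ler_wpM2l; first by apply: mulr_ge0; [exact: ltW|apply: mulr_ge0; [exact: le_trans y1|exact: ltW]].
    by rewrite ler_pM2l.
  have -> : c2 * (y * x) * (2 * (A1 * expR (alpha1 * l))) = B * (y * x * expR (alpha1 * l)).
    by rewrite /c2; field; rewrite gt_eqF.
  have -> : y * x * expR (alpha1 * l) = expR (- beta * l) * expR l.
    by rewrite /y /x -!expRD /delta /gam; congr expR; field.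
  by rewrite mulrA ler_pM2r ?expR_gt0.
have e2 : D * g * (1 + l) <= y * (2 * g * (1 + l)).
  have -> : y * (2 * g * (1 + l)) = 2 * y * (g * (1 + l)) by ring.
  rewrite -mulrA; apply: ler_wpM2r; first by rewrite mulr_ge0 ?addr_ge0 // ltW.
  apply: le_trans Dle _; rewrite ler_pM2l // yE ler_peMr ?expR_ge0 //; exact: ge1.
have e3 : h * D * g * ln g <= y * (2 * A2 * g * ln g).
  have -> : y * (2 * A2 * g * ln g) = (A2 * expR (alpha2 * l)) * (2 * expR (gam * l)) * (g * ln g).
    by rewrite yE; ring.
  rewrite -mulrA; apply: ler_wpM2r; first by rewrite mulr_ge0 // ltW.
  by apply: ler_pM => //; apply: ltW.
have e4 : 2 * g * (1 + l) + 2 * A2 * g * ln g + (1 + l) <= c2 * x.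
  apply: le_trans h2; have : 0 <= 2 * A2 * g * ln g by rewrite !mulr_ge0 // ltW.
  set q := 2 * A2 * g * ln g; nra.
have e5 : y * (2 * g * (1 + l) + 2 * A2 * g * ln g + (1 + l)) <= y * (c2 * x).
  by rewrite ler_pM2l // (lt_le_trans ltr01).
have e6 : (1 + l) <= y * (1 + l) by rewrite ler_peMl // addr_ge0.
nra.
Qed.

End Asymptotics.

Section RealFacts.
Variable R : realFieldType.
Implicit Types x y a b q : R.

Lemma succ_le_mul x y : 1 <= x -> 2 <= y -> x + 1 <= y * x.
Proof. nra. Qed.

Lemma inv_1B_le y : 0 <= y -> y <= 2^-1 -> (1 - y)^-1 <= 1 + 2 * y.
Proof.
move=> y0 y2; have y1 : 0 < 1 - y by lra.
rewrite -[leLHS]mul1r ler_pdivrMr //.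
have : y * (1 - 2 * y) >= 0 by rewrite mulr_ge0 //; lra.
nra.
Qed.

Lemma half_eq : 2^-1 = 1 + - 2^-1 :> R. Proof. by field. Qed.

Lemma le_double x y : 0 <= y -> x <= y -> x <= 2 * y. Proof. lra. Qed.

Lemma le_triple a b q : a <= q -> b <= q * 2 -> a + b <= q * 3. Proof. lra. Qed.

Lemma le_two e y : e - 1 <= 2 * y -> y <= 2^-1 -> e <= 2. Proof. lra. Qed.

Lemma mul_div_eq a b : b != 0 -> (b * b)^-1 * (a * b) = a / b.
Proof. by move=> b0; field. Qed.

Lemma bound_eq a b c : c != 0 -> (2 * a + 3 * b) / c = 2 * (a / c) + b * (3 / c).
Proof. by move=> c0; field. Qed.

End RealFacts.

(** * Convergence of the moments *)

Section MomentLimit.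
Variables (R : realType) (u : nat) (w h eps : nat -> R) (alpha1 alpha2 beta : R).
Hypothesis hw : bigO_pow w alpha1.
Hypothesis hh : bigO_pow h alpha2.
Hypothesis heps : bigOmega_pow eps (- beta).
Hypothesis halpha1 : 0 <= alpha1 < 1.
Hypothesis halpha2 : 0 <= alpha2 < 1.
Hypothesis hbeta : 0 <= beta < 1.
Hypothesis hab : 2 * alpha1 + alpha2 < 1 - 2 * beta.
Variables (d : nat -> measure_display) (T : forall n, measurableType (d n))
    (P : forall n, probability (T n) R)
    (M : forall n, T n -> 'M[int]_(n, n + u)).
Hypothesis hM : forall n, (0 < n)%N ->
       balanced_mx (P n) (w n) (h n) (eps n) (@M n).
Variable G : finZmodType.

Lemma powR_nat n a : (0 < n)%N -> n%:R `^ a = expR (a * ln n%:R) :> R.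
Proof. by move=> n0; rewrite /powR pnatr_eq0 -[(n == 0)%N]negbK -lt0n n0. Qed.

Lemma moment_near : exists K : R, \forall n \near \oo,
  `|moment (P n) (@M n) G - #|G|%:R ^- u| <= K / n.+1%:R.
Proof.
have [A1 hA1] := hw; have [A2 hA2] := hh; have [B B0 hB] := heps.
(* The maximum with [1] makes the constants positive, as [exponent_bounds] asks. *)
pose a1 := Num.max A1 1; pose a2 := Num.max A2 1.
have a10 : 0 < a1 by rewrite lt_max ltr01 orbT.
have a20 : 0 < a2 by rewrite lt_max ltr01 orbT.
have [al10 _] := andP halpha1; have [al20 _] := andP halpha2; have [be0 _] := andP hbeta.
pose N := #|G|; have N0 : (0 < N)%N by apply/card_gt0P; exists 0.
have GN (x : G) : x *+ N = 0 by apply: mulrn_card.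
have [kappa k01 walk] := walk_bounds R N0; have [k0 k1] := andP k01.
have g1 : 1 <= N%:R :> R by rewrite ler1n.
have g0 : 0 < N%:R :> R := lt_le_trans ltr01 g1.
have [L L1 bounds] := exponent_bounds al10 al20 be0 hab a10 a20 B0 k0 g1.
exists (2 * (u.+1)%:R + 3 * 2 ^+ N).
have [n0 n0L] : exists n0 : nat, expR L <= n0%:R.
  exists (Num.truncn (expR L)).+1; have /andP[_ /ltW//] := truncn_itv (expR_ge0 L).
(* Beyond [exp L] the exponent bounds apply; beyond [2 (u + 1)] the quantity [y] below is at most
   [1/2]. *)
exists (maxn n0 (2 * u.+1)).+1 => // n /=; rewrite gtn_max => /andP[n0n un].
have n1 : (0 < n)%N by apply: leq_trans n0n.
have nR : 0 < n%:R :> R by rewrite ltr0n.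
pose l : R := ln n%:R.
have nE : expR l = n%:R by rewrite lnK.
have Ll : L <= l by rewrite -(ler_expR L l) nE (le_trans n0L) // ler_nat ltnW.
have l1 : 1 <= l := le_trans L1 Ll; have l0 := le_trans ler01 l1.
have [dM [QQ [PP [[QQp PPp] [wb hb] bal ind]]]] := hM n1.
set W := (\max_(B in QQ) #|B|)%N in wb; set H := (\max_(A in PP) #|A|)%N in hb.
have Wb (B' : {set 'I_(n + u)}) : B' \in QQ -> (#|B'| <= W)%N by move=> BQ; apply: leq_bigmax_cond.
have Hb (A' : {set 'I_n}) : A' \in PP -> (#|A'| <= H)%N by move=> AP; apply: leq_bigmax_cond.
have sumB : (\sum_(B in QQ) #|B| = n + u)%N.
  by rewrite -(finset.card_partition QQp) cardsT card_ord.
have rW : (n + u <= #|QQ| * W)%N.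
  apply: (@leq_trans (\sum_(B in QQ) #|B|)%N); first by rewrite sumB.
  by rewrite -sum_nat_const; apply: leq_sum => B' /Wb.
have W1 : (0 < W)%N.
  by rewrite lt0n; apply/eqP => W0; move: rW; rewrite W0 muln0 leqn0 addn_eq0 -[n == _]negbK -lt0n n1.
have blk (B' : {set 'I_(n + u)}) : B' \in QQ -> exists j, j \in B'.
  move=> BQ; have : B' != finset.set0.
    by have /and3P[_ _] := QQp; apply: contra => /eqP <-.
  by case/set0Pn => j; exists j.
have blkP (A' : {set 'I_n}) : A' \in PP -> exists j, j \in A'.
  move=> BQ; have : A' != finset.set0.
    by have /and3P[_ _] := PPp; apply: contra => /eqP <-.
  by case/set0Pn => j; exists j.
have rm : (#|QQ| <= n + u)%N.
  apply: (@leq_trans (\sum_(B in QQ) #|B|)%N); last by rewrite sumB.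
  rewrite -sum1_card; apply: leq_sum => B' /blk[j jB].
  by apply/card_gt0P; exists j.
have epsB : B * expR (- beta * l) <= eps n by rewrite -powR_nat // hB.
have eps0 : 0 < eps n by apply: lt_le_trans epsB; rewrite mulr_gt0 ?expR_gt0.
(* Balancedness of some block, applied to the trivial subgroup, which is proper because the block is
   nonempty, and to the empty event. *)
have eps1 : eps n <= 1.
  have [j jQ] : exists j : 'I_(n + u), j \in finset.cover QQ.
    by exists (Ordinal (ltn_addr u n1)); rewrite (finset.cover_partition QQp) inE.
  have iQ : Ordinal n1 \in finset.cover PP by rewrite (finset.cover_partition PPp) inE.
  have BQ := finset.pblock_mem jQ; have AP := finset.pblock_mem iQ.
  rewrite -finset.mem_pblock in jQ; rewrite -finset.mem_pblock in iQ.
  have := @balanced_bound _ _ _ _ _ _ _ [set 0] set0 (bal _ _ AP BQ).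
  rewrite (_ : [set t | set0 _] = set0) ?pr_set0; last by apply/seteqP; split.
  rewrite subr_ge0; apply => //; first by split=> // x y /= -> ->; rewrite subr0.
  pose i' := enum_rank_in iQ (Ordinal n1); pose j' := enum_rank_in jQ j.
  move=> e; have : [set 0 : 'M[int]_(_, _)] (delta_mx i' j') by rewrite e.
  by move=> /= /matrixP/(_ i' j'); rewrite !mxE !eqxx.
have eps01 : 0 <= eps n <= 1 by rewrite ltW.
pose x := expR (gam alpha2 * l).
have gam0 : 0 <= gam alpha2 by rewrite /gam divr_ge0 // subr_ge0; case/andP: halpha2 => _ /ltW.
have x1 : 1 <= x by rewrite -expR0 ler_expR mulr_ge0.
pose D := (Num.truncn x).+1.
have Dx : x <= (D%:R : R) <= 2 * x.
  have /andP[h1 h2] := truncn_itv (le_trans ler01 x1).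
  by rewrite (ltW h2) /= /D -natr1 mulr2n mulrDl mul1r lerD.
have WR : (0 : R) < W%:R <= a1 * expR (alpha1 * l).
  rewrite ltr0n W1 /=; apply: (le_trans wb); apply: (le_trans (hA1 n n1)).
  by rewrite -powR_nat // ler_wpM2r ?powR_ge0 // le_max lexx.
have HR : (0 : R) <= H%:R <= a2 * expR (alpha2 * l).
  rewrite ler0n /=; apply: (le_trans hb); apply: (le_trans (hA2 n n1)).
  by rewrite -powR_nat // ler_wpM2r ?powR_ge0 // le_max lexx.
have [b1 b2] := bounds l _ _ _ _ Ll WR HR epsB Dx; rewrite nE in b2.
have n2 : n.+1%:R <= expR (1 + l) :> R.
  rewrite expRD nE -natr1; apply: succ_le_mul; first by rewrite ler1n.
  exact: le_trans (expR_ge1Dx 1).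
have n1R : 0 < n.+1%:R :> R by [].
pose e := walk_err (eps n) G D kappa W.
have rho0 : 0 <= 1 - kappa * eps n / 2.
  by rewrite subr_ge0 ler_pdivrMr // mul1r (@le_trans _ _ 1) ?ler1n // mulr_ile1 // ltW.
have powE k : N%:R ^+ k = expR (k%:R * ln N%:R) :> R by rewrite mulrC expRM_natr lnK.
have e_le : e <= (n.+1%:R * n.+1%:R)^-1.
  apply: (@le_trans _ _ (expR (- (2 * (1 + l))))).
    apply: (@le_trans _ _ (expR (W%:R * ln N%:R - kappa * eps n * D%:R / 2))); last by rewrite ler_expR.
    rewrite expRD /e /walk_err powE ler_wpM2l ?expR_ge0 //.
    have -> : - (kappa * eps n * D%:R / 2) = - (kappa * eps n / 2) * D%:R by ring.
    rewrite expRM_natr lerXn2r ?nnegrE ?expR_ge0 //.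
    exact: expR_ge1Dx.
  rewrite expRN lef_pV2 ?posrE ?expR_gt0 ?mulr_gt0 //.
  have -> : 2 * (1 + l) = (1 + l) + (1 + l) by ring.
  by rewrite expRD ler_pM.
have e0 : 0 <= e by rewrite /e /walk_err mulr_ge0 ?exprn_ge0.
pose E := (1 + e) ^+ #|QQ|.
(* A bound for [e * #|QQ|], because [e <= (n + 1) ^ -2] and [#|QQ| <= n + u]. *)
pose y : R := u.+1%:R / n.+1%:R.
have y0 : 0 <= y by rewrite divr_ge0.
have y2 : y <= 2^-1.
  by rewrite ler_pdivrMr // mulrC ler_pdivlMr // -natrM ler_nat mulnC (leq_trans (ltnW un)).
have Ey : E <= (1 - y)^-1.
  apply: (@le_trans _ _ (expR y)).
    apply: (@le_trans _ _ (expR (e * #|QQ|%:R))).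
      rewrite /E expRM_natr; apply: lerXn2r; rewrite ?nnegrE ?expR_ge0 //.
        by rewrite addr_ge0.
      exact: expR_ge1Dx.
    rewrite ler_expR; apply: (@le_trans _ _ ((n.+1%:R * n.+1%:R)^-1 * (u.+1%:R * n.+1%:R))).
      apply: ler_pM => //; rewrite -natrM ler_nat (leq_trans rm) //.
      by rewrite mulSn mulnS; apply: leq_add; [exact: leqnSn|exact: leq_addr].
    by rewrite /y mul_div_eq // gt_eqF.
  rewrite -[expR y]invrK -expRN lef_pV2 ?posrE ?expR_gt0 ?subr_gt0 //; last first.
    by apply: le_lt_trans y2 _; rewrite invf_lt1 // ltr1n.
  exact: expR_ge1Dx.
have y1 : 0 < 1 - y.
  by rewrite subr_gt0; apply: le_lt_trans y2 _; rewrite invf_lt1 // ltr1n.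
have E1 : E - 1 <= 2 * y.
  by rewrite lerBlDl; apply: le_trans Ey (inv_1B_le y0 y2).
have E2 : E <= 2 := le_two E1 y2.
have E0 : 0 <= E by rewrite exprn_ge0 // addr_ge0.
pose C : R := (n.+1 ^ (D * #|G|) * #|G| ^ (H * (D * #|G|)))%:R.
have mb := moment_bound dM PPp QQp ind bal GN eps01 k01 walk Wb Hb (ltn0Sn _)
   (erefl E) (erefl C).
apply: (le_trans mb); have C0 : 0 <= C by [].
(* Half of the natural exponent [eps n / W], so that [2 ^ -n] as well as [(1 - eps) ^ #|QQ|] is at
   most [exp (- q)]. *)
pose q := eps n * n%:R / (2 * W%:R).
have W0 : 0 < W%:R :> R by rewrite ltr0n.
have CE : C <= expR (D%:R * N%:R * (1 + l) + H%:R * D%:R * N%:R * ln N%:R).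
  rewrite /C natrM !natrX expRD; apply: ler_pM; rewrite ?exprn_ge0 //.
    apply: (@le_trans _ _ (expR (1 + l) ^+ (D * #|G|))).
      by rewrite lerXn2r ?nnegrE ?expR_ge0.
    by rewrite -expRM_natr natrM mulrC.
  by rewrite powE !natrM !mulrA.
have q1 : 2^-1 ^+ n <= expR (- q).
  apply: (@le_trans _ _ (expR (- 2^-1) ^+ n)).
    rewrite lerXn2r ?nnegrE ?expR_ge0 ?invr_ge0 //.
    by rewrite [leLHS]half_eq expR_ge1Dx.
  rewrite -expRM_natr ler_expR mulNr lerN2 /q ler_pdivrMr ?mulr_gt0 //.
  rewrite mulrACA mulVf // mul1r [leRHS]mulrC.
  rewrite ler_pM2r //; apply: le_trans eps1 _; by rewrite ler1n.
have q2 : (1 - eps n) ^+ #|QQ| <= expR (- q).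
  apply: (@le_trans _ _ (expR (- eps n) ^+ #|QQ|)).
    by rewrite lerXn2r ?nnegrE ?expR_ge0 ?subr_ge0 // expR_ge1Dx.
  rewrite -expRM_natr ler_expR mulNr lerN2 /q ler_pdivrMr ?mulr_gt0 //.
  rewrite -mulrA ler_pM2l // mulrCA -natrM.
  apply: le_double => //.
  by rewrite ler_nat (leq_trans _ rW) // leq_addr.
have tail : C * (2^-1 ^+ n + (1 - eps n) ^+ #|QQ| * E) <= 3 / n.+1%:R.
  apply: (@le_trans _ _ (C * (expR (- q) * 3))).
    rewrite ler_wpM2l //.
    apply: le_triple => //.
    by apply: ler_pM => //; rewrite exprn_ge0 // subr_ge0.
  rewrite mulrA mulrC ler_pM2l //.
  apply: (@le_trans _ _ (expR (- (1 + l)))).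
    apply: (@le_trans _ _ (expR (D%:R * N%:R * (1 + l) + H%:R * D%:R * N%:R * ln N%:R) * expR (- q))).
      by rewrite ler_pM2r ?expR_gt0.
    by rewrite -expRD ler_expR.
  by rewrite expRN lef_pV2 ?posrE ?expR_gt0.
rewrite bound_eq ?gt_eqF //.
apply: lerD => //; rewrite -mulrA ler_pM2l // exprn_gt0 //.
Qed.

Lemma moment_cvg : moment (P n) (@M n) G @[n --> \oo] --> (#|G|%:R ^- u : R).
Proof.
have [K near_K] := moment_near.
have cK : K * harmonic n @[n --> \oo] --> K * (0 : R) by apply: cvgMr; exact: cvg_harmonic.
rewrite mulr0 in cK; apply/cvgrPdist_le => e e0.
have /cvgrPdist_le/(_ e e0) near_e := cK.
near=> n; rewrite distrC; apply: (@le_trans _ _ (K / n.+1%:R)).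
  by near: n.
apply: (le_trans (ler_norm _)); rewrite -normrN -sub0r.
by near: n.
Unshelve. all: by end_near.
Qed.

End MomentLimit.

(** * The tensor product with [Z/a] as the quotient [X / aX] *)

Section Tensor.

Definition additive_of (X Y : zmodType) (f : X -> Y) (fB : zmod_morphism f) :
    {additive X -> Y} :=
  HB.pack f (GRing.isZmodMorphism.Build X Y f fB).

Lemma additive_ofE (X Y : zmodType) (f : X -> Y) (fB : zmod_morphism f) :
  additive_of fB =1 f.
Proof. by []. Qed.

Definition reduction (a : nat) (X H : zmodType) (q : X -> H) : Prop :=
  [/\ zmod_morphism q, forall h, exists x, q x = h &
      forall x, q x = 0 <-> exists y, x = y *+ a].

Lemma mulrnz_cyc a (V : zmodType) (v : V) : (0 < a)%N -> v *+ a = 0 ->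
  zmod_morphism (fun k : 'I_a.-1.+1 => v *+ k).
Proof.
move=> a0 va; apply/zmorphP => c d; rewrite /= -mulrnDr.
by rewrite [X in (_ %% X)%N](prednK a0) mulrn_mod.
Qed.

Lemma reduction_tensor a (X H : zmodType) (q : X -> H) : (0 < a)%N ->
  reduction a q ->
  let b := fun x (k : 'I_a.-1.+1) => q x *+ k in biadditive b /\
    forall (Z : zmodType) (c : X -> 'I_a.-1.+1 -> Z), biadditive c ->
      exists f : {additive H -> Z}, (forall x y, f (b x y) = c x y) /\
        (forall g : {additive H -> Z}, (forall x y, g (b x y) = c x y) -> g =1 f).
Proof.
move=> a0 [qB qs qk] b; have qa x : q x *+ a = 0.
  by rewrite -(zmorphMn qB); apply/qk; exists x.
split; first split.
- by move=> k x y; rewrite /b qB mulrnBl.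
- by move=> x; apply: mulrnz_cyc.
move=> Z c [cl cr]; pose s h := xget 0 [set x | q x = h].
have sK h : q (s h) = h by rewrite /s; case: xgetP => [? _ //|]; have [x e] := qs h; move=> /(_ x).
pose f h := c (s h) (cyc1 a).
have fq x : f (q x) = c x (cyc1 a).
  have /qk[y e] : q (s (q x) - x) = 0 by rewrite qB sK subrr.
  apply/eqP; rewrite -subr_eq0 -(cl (cyc1 a)) e (zmorphMn (cl _)).
  by rewrite -(zmorphMn (cr y)) cyc_exp // (zmorph0 (cr y)).
have fB : zmod_morphism f.
  by move=> h k; rewrite -[in LHS](sK h) -[in LHS](sK k) -qB fq cl -!fq !sK.
exists (additive_of fB); split=> [x k|g gb h].
  by rewrite /b additive_ofE (zmorphMn fB) fq -(zmorphMn (cr x)) -(cyc_mul1 a0).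
rewrite -[h]sK additive_ofE fq -gb /b; congr (g _).
have -> : (cyc1 a : 'I_a.-1.+1) = (1 %% a)%N :> nat by exact: (val_cyc1Mn a0 1).
by rewrite mulrn_mod ?mulr1n.
Qed.

Definition multiples (a : nat) (X : zmodType) : {pred X} :=
  fun x => `[< exists y, x = y *+ a >].

Lemma multiples_zmod_closed a X : zmod_closed (@multiples a X).
Proof.
split; first by apply/asboolP; exists 0; rewrite mul0rn.
move=> x y /asboolP[x' ->] /asboolP[y' ->].
by apply/asboolP; exists (x' - y'); rewrite mulrnBl.
Qed.

Definition multiples_group a X : zmodClosed X :=
  HB.pack (@multiples a X)
    (GRing.isZmodClosed.Build X (@multiples a X) (multiples_zmod_closed a X)).

Definition qproj (X : zmodType) (I : zmodClosed X) (x : X) : Quotient.quot I :=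
  (\pi_(Quotient.quot I) x)%qT.

Lemma qprojB (X : zmodType) (I : zmodClosed X) : zmod_morphism (qproj I).
Proof. by move=> x y; rewrite /qproj raddfB. Qed.

Lemma qproj_repr (X : zmodType) (I : zmodClosed X) (x : Quotient.quot I) :
  qproj I (generic_quotient.repr x) = x.
Proof. exact: reprK. Qed.

Lemma qproj_eq0 (X : zmodType) (I : zmodClosed X) x : (qproj I x == 0) = (x \in I).
Proof. by rewrite -(zmorph0 (@qprojB X I)) /qproj -Quotient.idealrBE subr0. Qed.

(** Both [H] and [X / aX] carry a universal biadditive map, so they are isomorphic, and the quotient
    map followed by this isomorphism is the reduction. *)
Lemma tensor_ZmodP a (X H : zmodType) : (0 < a)%N ->
  tensor_Zmod X a H <-> exists q : X -> H, reduction a q.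
Proof.
move=> a0; split=> [[b [bB bU]]|[q qr]]; last first.
  by exists (fun x (k : 'I_a.-1.+1) => q x *+ k); apply: reduction_tensor.
pose B : zmodType := Quotient.quot (multiples_group a X).
pose p : X -> B := qproj (multiples_group a X).
have pB : zmod_morphism p by apply: qprojB.
have pr : reduction a p.
  split=> // [h|x]; first by exists (generic_quotient.repr h); rewrite /p qproj_repr.
  split=> [/eqP|xa]; first by rewrite /p qproj_eq0 => /asboolP.
  by apply/eqP; rewrite /p qproj_eq0; apply/asboolP.
have [cB cU] := reduction_tensor a0 pr.
have [f [fb _]] := cU _ _ bB; have [g [gb _]] := bU _ _ cB.
have fB : zmod_morphism f by move=> x y; rewrite raddfB.
have gB : zmod_morphism g by move=> x y; rewrite raddfB.
have gK : cancel f g.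
  have [i [_ iU]] := cU _ _ cB => x.
  have e1 : additive_of (zmorph_comp gB fB) =1 i by apply: iU => y k; rewrite /= fb gb.
  have e2 : additive_of (fun x y => erefl (x - y) : id (x - y) = id x - id y) =1 i by apply: iU.
  by have := e1 x; rewrite -e2.
have fK : cancel g f.
  have [i [_ iU]] := bU _ _ bB => x.
  have e1 : additive_of (zmorph_comp fB gB) =1 i by apply: iU => y k; rewrite /= gb fb.
  have e2 : additive_of (fun x y => erefl (x - y) : id (x - y) = id x - id y) =1 i by apply: iU.
  by have := e1 x; rewrite -e2.
have [_ ps pk] := pr.
exists (f \o p); split; first exact: (zmorph_comp fB pB).
  by move=> h; have [x e] := ps (g h); exists x; rewrite /= e fK.
move=> x /=; rewrite -pk; split=> [e|->]; last exact: zmorph0 fB.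
by rewrite -[p x]gK e (zmorph0 gB).
Qed.

(** As the kernel of [r] lies in [aX], the map [r] identifies [X / aX] with [X' / aX']. *)
Lemma tensor_transfer a (X X' : zmodType) (r : X -> X') (H : zmodType) : (0 < a)%N ->
  zmod_morphism r -> (forall x', exists x, r x = x') ->
  (forall x, r x = 0 -> exists y, x = y *+ a) ->
  tensor_Zmod X a H <-> tensor_Zmod X' a H.
Proof.
move=> a0 rB rs rk; rewrite !tensor_ZmodP //; split=> [[q [qB qs qk]]|[q [qB qs qk]]].
  pose s x' := xget 0 [set x | r x = x'].
  have sK x' : r (s x') = x'.
    by rewrite /s; case: xgetP => [? _ //|]; have [x e] := rs x'; move=> /(_ x).
  have qr x : q (s (r x)) = q x.
    have /rk e : r (s (r x) - x) = 0 by rewrite rB sK subrr.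
    by apply/eqP; rewrite -subr_eq0 -qB; apply/eqP/qk.
  exists (q \o s); split=> [x' y'|h|x'] /=.
  - by rewrite -{1}[x']sK -{1}[y']sK -rB qr qB.
  - by have [x <-] := qs h; exists (r x); rewrite qr.
  rewrite qk; split=> [[y e]|[y ->]].
    by exists (r y); rewrite -(zmorphMn rB) -e sK.
  by apply/qk; rewrite -[y]sK -(zmorphMn rB) qr; apply/qk; exists (s y).
exists (q \o r); split=> [|h|x] /=; first exact: zmorph_comp.
  by have [x' <-] := qs h; have [x <-] := rs x'; exists x.
rewrite qk; split=> [[y' e]|[y ->]]; last by exists (r y); rewrite (zmorphMn rB).
have [y ry] := rs y'; have /rk[z ez] : r (x - y *+ a) = 0.
  by rewrite rB e -ry (zmorphMn rB) subrr.
by exists (z + y); rewrite mulrnDl -ez subrK.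
Qed.

Lemma tensor_exp a (X H : zmodType) : (0 < a)%N -> exponent_dvd X a ->
  tensor_Zmod X a H <-> zmod_isom X H.
Proof.
move=> a0 Xa; rewrite tensor_ZmodP //; split=> [[q [qB qs qk]]|[f [g fK gK]]].
  have [g gK] := choice qs.
  exists (additive_of qB), g => // x; apply/eqP; rewrite -subr_eq0; apply/eqP.
  have /qk[y ->] : q (g (q x) - x) = 0 by rewrite qB gK subrr.
  exact: Xa.
exists f; split=> [x y|h|x]; first by rewrite raddfB.
  by exists (g h); rewrite gK.
split=> [e|[y ->]]; last by rewrite Xa raddf0.
by exists 0; rewrite mul0rn -[x]fK e -(raddf0 f) fK.
Qed.

Lemma zmod_isomP (X Y : finZmodType) : zmod_isom X Y <-> zisog X Y.
Proof.
split=> [[f fb]|/zisogP[f fB fb]].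
  by apply/zisogP; exists f => // x y; rewrite raddfB.
by exists (additive_of fB).
Qed.

Lemma zmod_isom_refl (X : zmodType) : zmod_isom X X.
Proof. by exists (additive_of (fun x y => erefl (x - y) : id (x - y) = id x - id y)); exists id. Qed.

Lemma zmod_isom_sym (X Y : zmodType) : zmod_isom X Y -> zmod_isom Y X.
Proof.
move=> [f [g fK gK]]; have gB : zmod_morphism g.
  by apply: (zmorph_inv _ fK gK) => x y; rewrite raddfB.
by exists (additive_of gB), f.
Qed.

Lemma zmod_isom_trans (X Y Z : zmodType) : zmod_isom X Y -> zmod_isom Y Z -> zmod_isom X Z.
Proof.
move=> [f fb] [g gb]; have cB : zmod_morphism (g \o f) by move=> x y; rewrite /= !raddfB.
by exists (additive_of cB); apply: bij_comp.
Qed.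

End Tensor.

(** * A finite model of the cokernel modulo [a] *)

Section CokernelModel.
Variables (a n m : nat) (M : 'M[int]_(n, m)).
Hypothesis a_gt0 : (0 < a)%N.

Definition redmx : {ffun {ffun 'I_m -> cyc a} -> {ffun 'I_n -> cyc a}} :=
  [ffun y : {ffun 'I_m -> cyc a} => [ffun i => \sum_j y j *~ M i j]].

Definition cokmod : finZmodType := quo (imz redmx).

Lemma redmxE y i : redmx y i = \sum_j y j *~ M i j.
Proof. by rewrite !ffunE. Qed.

Lemma redmx_hom : redmx \in hom {ffun 'I_m -> cyc a} {ffun 'I_n -> cyc a}.
Proof.
apply/homP => x y; apply/ffunP => i; rewrite !ffunE -sumrB; apply: eq_bigr => j _.
by rewrite !ffunE mulrzBl.
Qed.

Lemma ffun_cyc_exp k (x : {ffun 'I_k -> cyc a}) : x *+ a = 0.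
Proof. by apply/ffunP => i; rewrite ffunMnE cyc_exp // ffunE. Qed.

Lemma cokmod_exp (x : cokmod) : x *+ a = 0.
Proof. by apply: (sur_exp (piz_sur (imz redmx))) x; apply: ffun_cyc_exp. Qed.

Definition redcol k (x : 'cV[int]_k) : {ffun 'I_k -> cyc a} :=
  [ffun i => cyc1 a *~ x i 0].

Lemma redcolB k : zmod_morphism (@redcol k).
Proof. by move=> x y; apply/ffunP => i; rewrite !ffunE !mxE mulrzBr. Qed.

Lemma redcol_surj k (z : {ffun 'I_k -> cyc a}) : exists x, redcol x = z.
Proof.
exists (\col_i (z i : 'I_a.-1.+1)%:Z); apply/ffunP => i; rewrite ffunE mxE.
by rewrite [RHS](cyc_mul1 a_gt0).
Qed.

Lemma cyc1_eq0 (k : int) : cyc1 a *~ k = 0 -> exists l, k = l *+ a.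
Proof.
have nat_case (N : nat) : cyc1 a *+ N = 0 -> (a %| N)%N.
  by move=> e; have := val_cyc1Mn a_gt0 N; rewrite e /dvdn => <-.
case: k => N e.
  by have /nat_case/dvdnP[l ->] := e; exists l%:Z; rewrite PoszM -mulr_natr natz.
have /nat_case/dvdnP[l el] : cyc1 a *+ N.+1 = 0 by apply/eqP; rewrite -oppr_eq0; apply/eqP.
by exists (- l%:Z); rewrite NegzE el PoszM mulNrn -mulr_natr natz.
Qed.

Lemma redcol_eq0 k (x : 'cV[int]_k) : redcol x = 0 -> exists y, x = y *+ a.
Proof.
move=> e; have h i : exists l, x i 0 = l *+ a.
  by apply: cyc1_eq0; move/ffunP: e => /(_ i); rewrite !ffunE.
have [l hl] := choice h; exists (\col_i l i); apply/matrixP => i j.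
by rewrite ord1 hl mulmxnE mxE.
Qed.

Lemma redcol_mul (y : 'cV[int]_m) : redcol (M *m y) = redmx (redcol y).
Proof.
apply/ffunP => i; rewrite !ffunE mxE.
rewrite (big_morph (fun k : int => cyc1 a *~ k) (fun k l => mulrzDr _ k l) (mulr0z _)).
by apply: eq_bigr => j _; rewrite ffunE mulrC mulrzA.
Qed.

(** Right exactness: reducing coordinates modulo [a] induces a surjection from [coker M] onto
    [cokmod], and its kernel consists of multiples of [a]. *)
Lemma tensor_coker H : tensor_Zmod (coker M) a H <-> zmod_isom cokmod H.
Proof.
rewrite -(tensor_exp _ a_gt0 cokmod_exp).
pose s (c : coker M) : 'cV[int]_n := generic_quotient.repr c.
pose r c := pi_quo (imz redmx) (redcol (s c)).
have rq x : r (qproj (@mx_image _ _ M) x) = pi_quo (imz redmx) (redcol x).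
  apply/eqP; rewrite -subr_eq0 -pi_quoB -redcolB pi_quo_eq0; apply/(mem_imz _ redmx_hom).
  have : s (qproj (@mx_image _ _ M) x) - x \in @mx_image _ _ M.
    by rewrite -qproj_eq0 qprojB qproj_repr subrr.
  by case/asboolP => y ->; exists (redcol y); rewrite redcol_mul.
have cE (c : coker M) : c = qproj (@mx_image _ _ M) (s c) by rewrite qproj_repr.
apply: (tensor_transfer (r := r)) => //.
- by move=> x y; rewrite [x]cE [y]cE -qprojB !rq redcolB pi_quoB.
- move=> z; have [w <-] := pi_quo_surj z; have [x <-] := redcol_surj w.
  by exists (qproj (@mx_image _ _ M) x); rewrite rq.
move=> c; rewrite [c]cE rq => /eqP; rewrite pi_quo_eq0 => /(mem_imz _ redmx_hom)[z].
have [y <-] := redcol_surj z; rewrite -redcol_mul => e.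
have /redcol_eq0[w ew] : redcol (s c - M *m y) = 0 by rewrite redcolB e subrr.
exists (qproj (@mx_image _ _ M) w); rewrite -(zmorphMn (@qprojB _ _)) -ew qprojB.
suff -> : qproj (@mx_image _ _ M) (M *m y) = 0 by rewrite subr0.
by apply/eqP; rewrite qproj_eq0; apply/asboolP; exists y.
Qed.

Section Count.
Variable G : finZmodType.
Hypothesis Ga : forall x : G, x *+ a = 0.

Definition vechom (F : {ffun 'I_n -> G}) : {ffun {ffun 'I_n -> cyc a} -> G} :=
  [ffun z : {ffun 'I_n -> cyc a} => \sum_i cyc_hom a (F i) (z i)].

Lemma vechom_hom F : vechom F \in hom {ffun 'I_n -> cyc a} G.
Proof.
apply/homP => x y; rewrite [LHS]ffunE [vechom F x]ffunE [vechom F y]ffunE -sumrB.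
apply: eq_bigr => i _; have -> : (x - y) i = x i - y i by rewrite !ffunE.
exact: (homP _ (cyc_homP a_gt0 (Ga (F i)))).
Qed.

Lemma vechom_unit F i c : vechom F (unitv i c) = cyc_hom a (F i) c.
Proof.
rewrite ffunE (bigD1 i) //= [unitv i c i]ffunE eqxx big1 ?addr0 // => j ji.
rewrite [unitv i c j]ffunE (negbTE ji); exact: zmorph0 (homP _ (cyc_homP a_gt0 (Ga (F j)))).
Qed.

(** A map [(Z/a)^n -> G] is the vector [F] of images of the unit vectors. It is onto when [F]
    generates [G], and it kills the image of [M] when [F M = 0]. *)
Lemma card_sur_cokmod :
  #|sur cokmod G| = #|[pred F : {ffun 'I_n -> G} | genvec F && (colcomb F M == 0)]|.
Proof.
have vinj : injective vechom.
  move=> F F' e; apply/ffunP => i.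
  by rewrite -(cyc_hom1 a_gt0 (Ga (F i))) -vechom_unit e vechom_unit cyc_hom1.
rewrite -sum1_card (big_sur_quo (piz_sur (imz redmx))) sum1dep_card -(card_imset _ vinj).
apply: eq_card => f; rewrite inE ker_piz; apply/andP/imsetP => [[fs ks]|[F]].
  have /homP fB := sur_hom fs.
  pose F := [ffun i => f (unitv i (cyc1 a))].
  have fF : f = vechom F.
    apply/ffunP => z; rewrite [in LHS](unitv_sum z) (zmorph_sum fB) ffunE.
    apply: eq_bigr => i _; rewrite /cyc_hom !ffunE -(zmorphMn fB); congr (f _).
    apply/ffunP => k; rewrite ffunMnE !ffunE; case: eqP => _; last by rewrite mul0rn.
    exact: cyc_mul1.
  exists F => //; rewrite inE; apply/andP; split.
    apply/forallP => H; apply/implyP => /forallP FH; apply/eqP/val_inj/finset.setP => y; rewrite [RHS]inE.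
    have /surP[_ /(_ y)[z <-]] := fs; rewrite fF ffunE; apply: group_prod => i _.
    by rewrite ffunE; apply: zgroupMn.
  apply/eqP/ffunP => j; rewrite ffunE [RHS]ffunE.
  have : redmx (unitv j (cyc1 a)) \in kerz f.
    by move/fintype.subsetP: ks; apply; apply/(mem_imz _ redmx_hom); eexists.
  rewrite (mem_kerz _ (sur_hom fs)) => /eqP; rewrite fF ffunE => e; rewrite -[RHS]e.
  apply: eq_bigr => i _; have cB := homP _ (cyc_homP a_gt0 (Ga (F i))).
  rewrite redmxE (zmorph_sum cB) (bigD1 j) //= (zmorphMz cB) [unitv _ _ j]ffunE eqxx.
  rewrite cyc_hom1 ?Ga // big1 ?addr0 // => k kj.
  by rewrite (zmorphMz cB) [unitv _ _ k]ffunE (negbTE kj) (zmorph0 cB) mul0rz.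
rewrite inE => /andP[gF /eqP cF] ->; have vh := vechom_hom F.
have /homP vB := vh.
split.
  apply/surP; split=> // y.
  have : y \in imz (vechom F).
    move/forallP: gF => /(_ (imz (vechom F)))/implyP h.
    rewrite (eqP (h _)) ?inE //; apply/forallP => i; apply/(mem_imz _ vh).
    by exists (unitv i (cyc1 a)); rewrite vechom_unit cyc_hom1.
  by move=> /(mem_imz _ vh).
apply/fintype.subsetP => z /(mem_imz _ redmx_hom)[y <-]; rewrite (mem_kerz _ vh).
rewrite ffunE; apply/eqP.
rewrite (eq_bigr (fun i => \sum_j F i *~ M i j *+ (y j : 'I_a.-1.+1))); last first.
  move=> i _; have cB := homP _ (cyc_homP a_gt0 (Ga (F i))).
  rewrite redmxE (zmorph_sum cB); apply: eq_bigr => j _.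
  by rewrite (zmorphMz cB) [cyc_hom _ _ _]ffunE !pmulrn mulrzAC.
rewrite exchange_big big1 //= => j _; rewrite sumrMnl.
by move/ffunP: cF => /(_ j); rewrite !ffunE => ->; rewrite mul0rn.
Qed.

End Count.
End CokernelModel.

(** * The surjection moments of the Cohen-Lenstra weights *)

Section SubgroupsOfKernel.
Variables X G : finZmodType.

Lemma card_quo_below (phi : {ffun X -> G}) m : phi \in sur X G ->
  #|[pred L : {group X} | (#|quo L| == (#|G| * m)%N) && (L \subset kerz phi)]| =
  #|[pred L : {group (subz (kerz phi) : finZmodType)} | #|quo L| == m]|.
Proof.
move=> ps; set K := kerz phi; have cK := card_ker_sur ps; rewrite -/K in cK.
have lift_inj : injective (@imsub X K).
  by move=> L L' e; apply/val_inj/finset.setP => x /=; rewrite -!mem_imsub e.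
rewrite -(card_imset _ lift_inj); apply/esym/eq_card => L.
have cim (L' : {group (subz K : finZmodType)}) : #|imsub L'| = #|L'|.
  rewrite -(card_imset _ (@subz_inj _ K)); apply: eq_card => x; apply/idP/imsetP => [xL|[y yL ->]].
    have [y ey] := subzE (fintype.subsetP (imsub_sub L') _ xL).
    by exists y => //; rewrite -mem_imsub ey.
  by rewrite mem_imsub.
have cidx (L' : {group (subz K : finZmodType)}) : (#|quo (imsub L')| == (#|G| * m)%N) = (#|quo L'| == m).
  have l0 : (0 < #|L'|)%N by apply/card_gt0P; exists 0; apply: zgroup0.
  have g0 : (0 < #|G|)%N by apply/card_gt0P; exists 0.
  have := card_quo L'; have := card_quo (imsub L'); rewrite card_subz cim -cK => e e'.
  by rewrite -(eqn_pmul2r l0) e -mulnA eqn_pmul2l // -e' eqn_pmul2r.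
apply/imsetP/andP => [[L' L'm ->]|[Lk LK]].
  by split; [move: L'm; rewrite inE -cidx|apply: imsub_sub].
pose L' : {group (subz K : finZmodType)} := grp [set x : subz K | sval x \in L]%SET.
have mL' x : (x \in L') = (sval x \in L).
  rewrite mem_grp ?inE //; split; first by rewrite inE; apply: zgroup0.
  by move=> y z; rewrite !inE; apply: zgroupB.
have eL : L = imsub L'.
  apply/val_inj/finset.setP => x /=; apply/idP/idP => [xL|xL].
    have [y ey] := subzE (fintype.subsetP LK _ xL).
    by rewrite -ey mem_imsub mL' ey.
  have [y ey] := subzE (fintype.subsetP (imsub_sub L') _ xL).
  by move: xL; rewrite -ey mem_imsub mL'.
by exists L' => //; rewrite inE -cidx -eL.
Qed.

(** Double count of the pairs [(L, phi)] with [L] inside the kernel of [phi], where [L] has index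
    [m]. *)
Lemma sum_sur_quo m :
  (\sum_(L : {group X} | #|quo L| == (#|G| * m)%N) #|sur (quo L) G| =
   \sum_(phi in sur X G) #|[pred L : {group (subz (kerz phi) : finZmodType)} | #|quo L| == m]|)%N.
Proof.
rewrite (eq_bigr (fun L : {group X} => \sum_(phi in sur X G | L \subset kerz phi) 1)%N); last first.
  by move=> L _; rewrite -sum1_card (big_sur_quo (piz_sur L)) ker_piz.
rewrite (exchange_big_dep (fun phi => phi \in sur X G)) /=; last by move=> L phi _ /andP[].
apply: eq_bigr => phi ps; rewrite -(card_quo_below m ps) -[RHS]sum1_card.
by apply: eq_bigl => L; rewrite ps.
Qed.

End SubgroupsOfKernel.

Section Weights.
Variables (R : realType) (wt : nat -> R) (u : nat).
Implicit Types F : finZmodType -> R.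

(** With [k + 1] generators, [card_sur_Xp_ge] makes every group of order [k] a quotient. *)
Definition free_cover (k : nat) : finZmodType := Xp k k.+1.

(** The part of the expectation of [F] that comes from the groups of order [k],
    when the isomorphism class of [B] has probability [wt #|B| / #|iso B B|]. *)
Definition part_mean (k : nat) F : R :=
  wt k * \sum_(L : {group free_cover k} | #|quo L| == k)
    F (quo L) / #|sur (free_cover k) (quo L)|%:R.

Lemma sur_free_cover k (V : finZmodType) : #|V| = k -> (0 < #|sur (free_cover k) V|)%N.
Proof.
move=> Vk; have k0 : (0 < k)%N by rewrite -Vk; apply/card_gt0P; exists 0.
have Vb (x : V) : x *+ k = 0 by rewrite -Vk mulrn_card.
rewrite lt0n; apply/eqP => e; have := card_sur_Xp_ge k0 k.+1 Vb.
rewrite -/(free_cover k) e mul0n add0n Vk mulnC leq_pmul2r ?expn_gt0 ?k0 //.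
by rewrite leq_exp2l // ltnn.
Qed.

Lemma part_mean_sum (X : finZmodType) k F : (forall B C, zisog B C -> F B = F C) ->
  wt k * \sum_(L : {group X} | #|quo L| == k) F (quo L) =
  part_mean k (fun B => F B * #|sur X B|%:R).
Proof.
move=> Fi; rewrite (@sum_quo_transfer R F X (free_cover k) k) //; last first.
  by move=> L; apply: sur_free_cover.
by congr (_ * _); apply: eq_bigr => L _; rewrite mulrAC.
Qed.

(** The number of subgroups of index [m] is a fixed combination of surjection counts onto groups of
    order [m], and these counts agree by [card_sur_ker_Xp]. *)
Lemma count_sub_ker b N (G : finZmodType) (phi : {ffun Xp b N -> G}) m : (0 < b)%N ->
  phi \in sur (Xp b N) G -> (#|G| * m %| b)%N ->
  #|[pred L : {group (subz (kerz phi) : finZmodType)} | #|quo L| == m]| =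
  #|[pred L : {group Xp b N} | #|quo L| == m]|.
Proof.
move=> b0 ps gb; apply/eqP; rewrite -(eqr_nat R) -[in X in X == _]sum1_card -[in X in _ == X]sum1_card !natr_sum; apply/eqP.
rewrite (@sum_quo_transfer R (fun=> 1) _ (free_cover m) m) //; last first.
  by move=> L; apply: sur_free_cover.
rewrite [RHS](@sum_quo_transfer R (fun=> 1) _ (free_cover m) m) //; last first.
  by move=> L; apply: sur_free_cover.
apply: eq_bigr => L /eqP Lm; congr (_ * _%:R).
by apply: card_sur_ker_Xp => //; rewrite Lm.
Qed.

(** Up to the weights, both sides count the pairs of a surjection [X -> G] and a subgroup of index
    [m] in its kernel; the kernel has as many of these as [X]. *)
Lemma part_mean_free (G : finZmodType) m N : wt (#|G| * m)%N = #|G|%:R ^- u * wt m ->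
  let X := Xp (#|G| * m) N in
  part_mean (#|G| * m) (fun B => #|sur B G|%:R * #|sur X B|%:R) =
  #|G|%:R ^- u * (#|sur X G|%:R * part_mean m (fun B => #|sur X B|%:R)).
Proof.
move=> ew X; have sB B C : zisog B C -> #|sur B G|%:R = #|sur C G|%:R :> R.
  by move=> /eq_card_isogl e; have [_ -> _] := e G.
case: (posnP m) => [m0|m_gt0].
  rewrite /part_mean m0 muln0 !big1 ?mulr0 // => L /eqP e.
    by have : (0 < #|quo L|)%N by [apply/card_gt0P; exists 0]; rewrite e.
  by have : (0 < #|quo L|)%N by [apply/card_gt0P; exists 0]; rewrite e.
have g0 : (0 < #|G|)%N by apply/card_gt0P; exists 0.
have b0 : (0 < #|G| * m)%N by rewrite muln_gt0 g0.
rewrite -(part_mean_sum X _ sB) -natr_sum sum_sur_quo.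
under eq_bigr => phi ps do rewrite (count_sub_ker b0 ps (dvdnn _)).
have -> : part_mean m (fun B => #|sur X B|%:R) = part_mean m (fun B => 1 * #|sur X B|%:R).
  by congr (_ * _); apply: eq_bigr => L _; rewrite mul1r.
rewrite -(part_mean_sum X m (F := fun=> 1)) // (sumr_const [pred L : {group X} | #|quo L| == m]) sum_nat_const ew natrM.
by rewrite [RHS]mulrCA !mulrA; congr (_ * _); rewrite mulrC mulrA.
Qed.

Lemma part_mean_cvg k F (f : nat -> finZmodType -> R) :
  (forall L : {group free_cover k}, #|quo L| = k -> f N (quo L) @[N --> \oo] --> F (quo L)) ->
  part_mean k (f N) @[N --> \oo] --> part_mean k F.
Proof.
move=> fF; apply: cvgMr; apply: cvg_big => [|L /eqP Lk]; first exact: add_continuous.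
by apply: cvgMl; apply: fF.
Qed.

Lemma defect_mul (a b c v : R) : c * b = 1 -> (1 - v * c) * a * b = a * b - v * a.
Proof.
by move=> cb; rewrite mulrBl mul1r mulrBl (mulrAC v c a) -(mulrA (v * a) c b) cb mulr1.
Qed.

Lemma sur_Xp_cvg b (V : finZmodType) : (0 < b)%N -> (forall x : V, x *+ b = 0) ->
  (#|sur (Xp b N) V|%:R / #|V|%:R ^+ N : R) @[N --> \oo] --> (1 : R).
Proof.
move=> b0 Vb; have v0 : (0 : R) < #|V|%:R by rewrite ltr0n; apply/card_gt0P; exists 0.
apply: (@squeeze_cvgr _ _ _ _ (fun N : nat => 1 - 2 ^+ #|V| * 2^-1 ^+ N) (fun=> 1)).
- apply: nearW => N; apply/andP; split; last first.
    rewrite ler_pdivrMr ?exprn_gt0 // mul1r -natrX ler_nat.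
    exact: card_sur_Xp_le.
  rewrite ler_pdivlMr ?exprn_gt0 // -(ler_pM2r (exprn_gt0 N (ltr0Sn R 1))).
  have cb : 2^-1 ^+ N * 2 ^+ N = 1 :> R by rewrite -exprMn mulVf ?expr1n // pnatr_eq0.
  rewrite (defect_mul _ _ cb) lerBlDr -!natrX -!natrM -natrD ler_nat.
  exact: card_sur_Xp_ge.
- rewrite -[X in _ --> X]subr0; apply: cvgB; first exact: cvg_cst.
  rewrite -[X in _ --> X](mulr0 (2 ^+ #|V|)); apply: cvgMr; apply: cvg_expr.
  by rewrite ger0_norm ?invr_ge0 // invf_lt1 // ltr1n.
exact: cvg_cst.
Qed.

(** Divide [part_mean_free] by [(#|G| * m) ^ N] and let the rank [N] tend to infinity: the
    proportion of maps [X -> B] that are onto tends to [1]. *)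
Lemma part_mean_sur (G : finZmodType) m : wt (#|G| * m)%N = #|G|%:R ^- u * wt m ->
  part_mean (#|G| * m) (fun B => #|sur B G|%:R) = #|G|%:R ^- u * part_mean m (fun=> 1).
Proof.
move=> ew; case: (posnP m) => [m0|m_gt0].
  rewrite /part_mean m0 muln0 !big1 ?mulr0 // => L /eqP e.
    by have : (0 < #|quo L|)%N by [apply/card_gt0P; exists 0]; rewrite e.
  by have : (0 < #|quo L|)%N by [apply/card_gt0P; exists 0]; rewrite e.
set g := #|G|; have g0 : (0 < g)%N by apply/card_gt0P; exists 0.
have b0 : (0 < g * m)%N by rewrite muln_gt0 g0.
have bV c (V : finZmodType) : (#|V| * c)%N = (g * m)%N -> forall x : V, x *+ (g * m) = 0.
  by move=> <- x; rewrite mulrnA mulrn_card mul0rn.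
pose X := Xp (g * m).
have lhs : part_mean (g * m) (fun B => #|sur B G|%:R * (#|sur (X N) B|%:R / #|B|%:R ^+ N))
    @[N --> \oo] --> part_mean (g * m) (fun B => #|sur B G|%:R).
  apply: part_mean_cvg => L Lk; rewrite -[X in _ --> X]mulr1; apply: cvgMr.
  by apply: sur_Xp_cvg => //; apply: (bV 1%N); rewrite Lk muln1.
have rhs : g%:R ^- u * (#|sur (X N) G|%:R / g%:R ^+ N *
      part_mean m (fun B => #|sur (X N) B|%:R / #|B|%:R ^+ N))
    @[N --> \oo] --> g%:R ^- u * (1 * part_mean m (fun=> 1)).
  apply: cvgMr; apply: cvgM; first by apply: sur_Xp_cvg => //; apply: (bV m).
  apply: part_mean_cvg => L Lm; apply: sur_Xp_cvg => //.
  by apply: (bV g); rewrite Lm mulnC.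
rewrite mul1r in rhs; apply: (cvg_unique (@norm_hausdorff _ R) lhs) => /=.
suff e N : part_mean (g * m)
      (fun B => #|sur B G|%:R * (#|sur (X N) B|%:R / #|B|%:R ^+ N)) =
    g%:R ^- u * (#|sur (X N) G|%:R / g%:R ^+ N *
      part_mean m (fun B => #|sur (X N) B|%:R / #|B|%:R ^+ N)).
  by rewrite (eq_cvg _ _ e); exact: rhs.
have scale k (f : finZmodType -> R) :
    part_mean k (fun B => f B / #|B|%:R ^+ N) = part_mean k f / k%:R ^+ N.
  rewrite /part_mean -mulrA; congr (_ * _); rewrite mulr_suml.
  by apply: eq_bigr => L /eqP->; rewrite mulrAC.
have -> : part_mean (g * m) (fun B => #|sur B G|%:R * (#|sur (X N) B|%:R / #|B|%:R ^+ N)) =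
    part_mean (g * m) (fun B => #|sur B G|%:R * #|sur (X N) B|%:R / #|B|%:R ^+ N).
  by congr (_ * _); apply: eq_bigr => L _; rewrite !mulrA.
rewrite !scale (part_mean_free N ew) -/g natrM exprMn invfM -/(X N).
by rewrite -[LHS]mulrA; congr (_ * _); apply: mulrACA.
Qed.

End Weights.

(** * Coprime factors and primary decomposition *)

Section CoprimeProducts.

Lemma sur_iso (X Y : finZmodType) : #|X| = #|Y| -> sur X Y = iso X Y.
Proof.
move=> c; apply/finset.setP => f; apply/idP/idP => [fs|]; last exact: iso_sur.
rewrite ker_trivial_iso //; apply/forallP => x; apply/implyP => xk.
have : #|kerz f| = 1%N.
  have y0 : (0 < #|Y|)%N by apply/card_gt0P; exists 0.
  by apply/eqP; rewrite -(eqn_pmul2l y0) (card_ker_sur fs) c muln1.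
by move=> /eqP; rewrite -trivg_card1 => /eqP t; move: xk; rewrite t => /set1P->.
Qed.

Lemma mulrn_coprime (V : zmodType) (x : V) s t : coprime s t ->
  x *+ s = 0 -> x *+ t = 0 -> x = 0.
Proof.
case: (posnP s) => [->|s0] co xs xt.
  by move: co; rewrite /coprime gcd0n => /eqP t1; rewrite -xt t1.
have [k _] := Bezoutl t s0; rewrite (eqP co) => /dvdnP[l el].
have : x *+ (1 + k * t) = 0 by rewrite el mulnC mulrnA xs mul0rn.
by rewrite mulrnDr mulnC [in X in _ + X]mulrnA xt mul0rn addr0.
Qed.

Lemma exp_coprime (V : finZmodType) s t : (0 < t)%N -> (forall x : V, x *+ s = 0) ->
  coprime s t -> coprime #|V| t.
Proof.
move=> t0 Vs st; apply/negPn/negP => n1.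
have p_pr : prime (pdiv (gcdn #|V| t)).
  by rewrite pdiv_prime // ltn_neqAle eq_sym n1 gcdn_gt0 t0 orbT.
have := pdiv_dvd (gcdn #|V| t); set p := pdiv _ in p_pr *; rewrite dvdn_gcd => /andP[pV pt].
have pT : (p %| #|[set: V]%G|)%N by rewrite cardsT.
have [x _ ox] := Cauchy p_pr pT.
have ps : (p %| s)%N by rewrite -ox order_dvdn zmodXgE Vs.
have : (p %| gcdn s t)%N by rewrite dvdn_gcd ps.
by rewrite (eqP st) dvdn1 => /eqP p1; rewrite p1 in p_pr.
Qed.

Lemma card_sur_prod_coprime (A1 A2 B : finZmodType) : coprime #|A2| #|B| ->
  #|sur (A1 * A2)%type B| = #|sur A1 B|.
Proof.
move=> co; pose h (g : {ffun A1 -> B}) : {ffun (A1 * A2)%type -> B} := [ffun x => g x.1].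
have hi : injective h.
  by move=> g g' e; apply/ffunP => x; have /ffunP/(_ (x, 0)) := e; rewrite !ffunE.
rewrite -(card_imset _ hi); apply: eq_card => f.
apply/idP/imsetP => [/surP[fB fs]|[g /surP[gB gs] ->]]; last first.
  apply/surP; split=> [x y|b]; first by rewrite !ffunE gB.
  by have [x <-] := gs b; exists (x, 0); rewrite ffunE.
have f2 x y : f (x, y) = f (x, 0).
  apply/eqP; rewrite -subr_eq0 -fB; apply/eqP.
  have -> : (x, y) - (x, 0) = (0, y) :> (A1 * A2)%type by congr (_, _); rewrite /= ?subrr ?subr0.
  apply: (mulrn_coprime co); last exact: mulrn_card.
  rewrite -(zmorphMn fB); have -> : (0, y) *+ #|A2| = 0 :> (A1 * A2)%type.
    have -> k : (0, y) *+ k = (0, y *+ k) :> (A1 * A2)%type.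
      by elim: k => // k IH; rewrite !mulrS IH; congr (_, _); rewrite /= addr0.
    by rewrite mulrn_card.
  exact: zmorph0 fB.
exists [ffun x => f (x, 0)]; last by apply/ffunP => -[x y]; rewrite !ffunE f2.
apply/surP; split=> [x y|b].
  by rewrite !ffunE -fB; congr (f (_, _)); rewrite /= subr0.
by have [[x y] <-] := fs b; exists x; rewrite ffunE (f2 x y).
Qed.

Lemma zisog_prodC (A B : finZmodType) : zisog (A * B)%type (B * A)%type.
Proof.
apply/zisogP; exists (fun x : A * B => (x.2, x.1) : (B * A)%type) => //.
by exists (fun x : B * A => (x.2, x.1)) => -[].
Qed.

Lemma card_iso_prod (A1 A2 B1 B2 : finZmodType) :
  coprime #|A1| #|B2| -> coprime #|A2| #|B1| -> coprime #|B1| #|B2| ->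
  #|iso (A1 * A2)%type (B1 * B2)%type| = (#|iso A1 B1| * #|iso A2 B2|)%N.
Proof.
move=> c12 c21 cB.
have iso0 (X Y : finZmodType) : #|X| != #|Y| -> #|iso X Y| = 0%N.
  by move=> n; apply/eqP; rewrite -leqn0 leqNgt; apply: contra n => /zisog_card/eqP.
have a0 (A : finZmodType) : (0 < #|A|)%N by apply/card_gt0P; exists 0.
have [e|n] := eqVneq (#|A1| * #|A2|)%N (#|B1| * #|B2|)%N; last first.
  rewrite iso0 ?card_prod //; have [e1|n1] := eqVneq #|A1| #|B1|; last by rewrite iso0.
  rewrite (iso0 A2) ?muln0 //; apply: contra n => /eqP e2; by rewrite e1 e2.
have e1 : #|A1| = #|B1|.
  apply/eqP; rewrite eqn_dvd -(Gauss_dvdl _ c12) -e dvdn_mulr //=.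
  by rewrite -(Gauss_dvdl _ (_ : coprime #|B1| #|A2|)) 1?coprime_sym // e dvdn_mulr.
have e2 : #|A2| = #|B2| by apply/eqP; rewrite -(eqn_pmul2l (a0 A1)) e e1.
rewrite -(sur_iso e1) -(sur_iso e2) -sur_iso ?card_prod ?e // card_sur_prod //.
rewrite card_sur_prod_coprime //; congr (_ * _)%N.
have [_ -> _] := eq_card_isogl B2 (zisog_prodC A1 A2).
by rewrite card_sur_prod_coprime.
Qed.

(** By Bezout [B] is the direct sum of its [s]-torsion and its [t]-torsion; coprimality then forces
    their orders. *)
Lemma coprime_split (B : finZmodType) s t : #|B| = (s * t)%N -> coprime s t ->
  exists B1 B2 : finZmodType,
    [/\ #|B1| = s, #|B2| = t & zisog (B1 * B2)%type B].
Proof.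
move=> Bst co; have B0 : (0 < #|B|)%N by apply/card_gt0P; exists 0.
have [s0 t0] : (0 < s)%N /\ (0 < t)%N by move: B0; rewrite Bst muln_gt0 => /andP[].
pose K n := kerz (mulz B n).
have KE n (x : subz (K n)) : x *+ n = 0.
  by apply: (@subz_inj _ (K n)); rewrite (zmorphMn (@sval_zmorph _ _)); apply/eqP;
    rewrite -mem_ker_mulz subz_in.
pose h (x : subz (K s) * subz (K t)) : B := sval x.1 + sval x.2.
have hB : zmod_morphism (h : (subz (K s) * subz (K t))%type -> B).
  move=> x y; rewrite /h (_ : (x - y).1 = x.1 - y.1) // (_ : (x - y).2 = x.2 - y.2) //.
  by rewrite (@sval_zmorph _ (K s)) (@sval_zmorph _ (K t)) opprD addrACA.
have hinj : injective h.
  move=> x y e; apply/eqP; rewrite -subr_eq0.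
  have : h (x - y) = 0 by rewrite hB e subrr.
  move: (x - y) => -[a b]; rewrite /h /= => /eqP; rewrite addr_eq0 => /eqP ab.
  have a0 : sval a = 0.
    apply: (mulrn_coprime co).
      by rewrite -(zmorphMn (@sval_zmorph _ _)) KE (zmorph0 (@sval_zmorph _ _)).
    by rewrite ab mulNrn -(zmorphMn (@sval_zmorph _ _)) KE (zmorph0 (@sval_zmorph _ _)) oppr0.
  have b0 : sval b = 0 by apply/eqP; rewrite -oppr_eq0 -ab a0.
  by apply/eqP; congr (_, _); apply: subz_inj; rewrite (zmorph0 (@sval_zmorph _ _)).
have hsurj y : exists x, h x = y.
  have [k _] := Bezoutl t s0; rewrite (eqP co) => /dvdnP[l el].
  have k1 : y *+ (k * t) *- 1 \in K s.
    rewrite mulr1n mem_ker_mulz mulNrn oppr_eq0 -mulrnA -mulnA [(t * s)%N]mulnC -Bst.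
    by rewrite mulnC mulrnA mulrn_card mul0rn.
  have k2 : y *+ (l * s) \in K t.
    by rewrite mem_ker_mulz -mulrnA -mulnA -Bst mulnC mulrnA mulrn_card mul0rn.
  have [a ea] := subzE k1; have [b eb] := subzE k2; exists (a, b).
  by rewrite /h /= ea eb -el mulrnDr mulr1n addrC addrK.
have iB : zisog (subz (K s) * subz (K t))%type B.
  apply/zisogP; exists h => //; pose g y := xget 0 [set x | h x = y].
  have gK : cancel g h.
    by move=> y; rewrite /g; case: xgetP => [? _ //|]; have [x e] := hsurj y; move=> /(_ x).
  by exists g => // x; apply: hinj; rewrite gK.
have c := zisog_card iB; rewrite card_prod Bst in c.
have c1 := exp_coprime t0 (@KE s) co.
have cots : coprime t s by rewrite coprime_sym.
have c2 := exp_coprime s0 (@KE t) cots.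
have e1 : #|subz (K s)| = s.
  apply/eqP; rewrite eqn_dvd -(Gauss_dvdl _ c1) -c dvdn_mulr //=.
  by rewrite -(Gauss_dvdl _ (_ : coprime s #|subz (K t)|)) 1?coprime_sym // c dvdn_mulr.
exists (subz (K s)), (subz (K t)); split=> //.
by apply/eqP; rewrite -(eqn_pmul2l s0) -{1}e1 c.
Qed.

End CoprimeProducts.

Section PrimaryDecomposition.
Implicit Types (A : primes_type -> finZmodType) (l : seq primes_type).

Fixpoint prodl A l : finZmodType :=
  if l is p :: l' then (A p * prodl A l')%type else 'I_1.

Definition primary A := forall p, (prime_of p).-nat #|A p|.

Lemma card_prodl A l : #|prodl A l| = (\prod_(p <- l) #|A p|)%N.
Proof.
by elim: l => [|p l IH]; rewrite ?big_nil ?card_ord // big_cons card_prod IH.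
Qed.

Lemma prime_of_inj : injective prime_of.
Proof. by move=> p q e; apply: val_inj. Qed.

Lemma prodl_pnat A l p : primary A -> p \notin l -> (negn (prime_of p)).-nat #|prodl A l|.
Proof.
move=> Ap; rewrite card_prodl; elim: l => [|q l IH]; first by rewrite big_nil.
rewrite in_cons negb_or big_cons => /andP[pq pl]; rewrite pnatM IH // andbT.
apply: sub_in_pnat (Ap q) => r _ /eqP->; rewrite !inE eq_sym.
by rewrite (inj_eq prime_of_inj).
Qed.

(** One prime is split off at a time. The last clause serves twice: its positivity says that
    isomorphism with [B] is tested prime by prime, and [A = Bp] gives the number of automorphisms of
    [B]. *)
Lemma primary_decomposition l (B : finZmodType) : uniq l ->
  (forall q, prime q -> (q %| #|B|)%N -> q \in map prime_of l) ->
  exists Bp, [/\ primary Bp, #|B| = (\prod_(p <- l) #|Bp p|)%N &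
    forall A, primary A ->
      #|iso (prodl A l) B| = (\prod_(p <- l) #|iso (A p) (Bp p)|)%N].
Proof.
elim: l B => [|p l IH] B /=.
  move=> _ Bl; have B1 : #|B| = 1%N.
    apply/eqP/negPn/negP => n1; have n2 : (1 < #|B|)%N.
      by rewrite ltn_neqAle eq_sym n1; apply/card_gt0P; exists 0.
    by have := Bl _ (pdiv_prime n2) (pdiv_dvd #|B|).
  exists (fun=> 'I_1); split=> [q||A _]; rewrite ?big_nil ?card_ord //.
  by rewrite card_iso_sym -sur_iso ?card_ord // card_sur_triv.
move=> /andP[pl ul] Bl; set P := prime_of p.
have B0 : (0 < #|B|)%N by apply/card_gt0P; exists 0.
have [|//|B1 [B2 [e1 e2 iB]]] := @coprime_split B (partn #|B| P) (partn #|B| (negn P)).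
- by rewrite partnC.
- by apply: pnat_coprime (part_pnat _ _) (part_pnat _ _).
have [q qp qd|Bp [pB cB hB]] := IH B2 ul.
  have : q \in P :: map prime_of l.
    by apply: Bl => //; apply: dvdn_trans qd _; rewrite e2 dvdn_part.
  rewrite in_cons => /orP[/eqP qP|//].
  have : (negn P).-nat #|B2| by rewrite e2 part_pnat.
  by move=> /(pnat_dvd qd); rewrite pnatE // qP !inE eqxx.
have nB1 : P.-nat #|B1| by rewrite e1 part_pnat.
have nB2 : (negn P).-nat #|B2| by rewrite e2 part_pnat.
exists (fun q => if q == p then B1 else Bp q).
have off (f : primes_type -> finZmodType -> nat) :
    (\prod_(q <- l) f q (if q == p then B1 else Bp q) = \prod_(q <- l) f q (Bp q))%N.
  rewrite big_seq [RHS]big_seq; apply: eq_bigr => q ql.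
  by case: eqP => // qp; move: pl; rewrite -qp ql.
split=> [q||A pA].
- by case: eqP => [->|_].
- rewrite big_cons eqxx (off (fun=> fun V => #|V|)) -cB e1 e2 partnC //.
rewrite big_cons eqxx (off (fun q V => #|iso (A q) V|)) -hB //=.
have [_ _ <-] := eq_card_isogr (A p * prodl A l)%type iB.
have nA := prodl_pnat pA pl.
rewrite card_iso_prod //; last exact: pnat_coprime nB1 nB2.
- exact: pnat_coprime (pA p) nB2.
by rewrite coprime_sym; apply: pnat_coprime nB1 nA.
Qed.

Lemma card_Aut_iso (B : finZmodType) : #|Aut [set: B]%SET| = #|iso B B|.
Proof.
pose h (s : {perm B}) : {ffun B -> B} := [ffun x => s x].
have hi : injective h.
  by move=> s t /ffunP e; apply/permP => x; have := e x; rewrite !ffunE.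
rewrite -(card_imset _ hi); apply: eq_card => f; apply/imsetP/idP => [[s sA ->]|/isoP[fB bf]].
  have /morphicP m := Aut_morphic sA.
  apply/isoP; split; last first.
    by apply: (eq_bij (f := s)) => [|x]; [exists (s^-1)%g; [apply: permK|apply: permKV]|rewrite ffunE].
  by apply/zmorphP => x y; rewrite !ffunE; apply: m; rewrite inE.
have [g fK gK] := bf; exists (perm (can_inj fK)); last by apply/ffunP => x; rewrite ffunE permE.
rewrite inE; apply/andP; split; first by apply/fintype.subsetP => x _; rewrite inE.
by apply/morphicP => x y _ _; rewrite !permE; apply: (zmorphD fB).
Qed.

End PrimaryDecomposition.

(** * Expectations of real functions *)

Section Mean.
Context d (T : measurableType d) (R : realType) (P : probability T R).
Implicit Types (f g : T -> R) (v w : R).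

(** Integrability and value in one predicate, so that linearity is used with real numbers only. *)
Definition mean f v : Prop :=
  P.-integrable setT (EFin \o f) /\ (\int[P]_x (f x)%:E = v%:E)%E.

Lemma mean_ext f g v : f =1 g -> mean f v -> mean g v.
Proof. by move=> /funext ->. Qed.

Lemma mean_indic (A : set T) : measurable A -> mean \1_A (pr P A).
Proof.
move=> mA; split; first exact: integrable_indic.
by rewrite integral_indic // setIT; apply: prE.
Qed.

Lemma meanD f g v w : mean f v -> mean g w -> mean (fun t => f t + g t) (v + w).
Proof.
move=> [fi fv] [gi gw]; split.
  by rewrite (_ : EFin \o _ = (EFin \o f) \+ (EFin \o g))%E //; apply: integrableD.
by rewrite EFinD -fv -gw -(@integralD_EFin _ _ _ P setT _ f g).
Qed.

Lemma meanZ f v a : mean f v -> mean (fun t => a * f t) (a * v).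
Proof.
move=> [fi fv]; split.
  by rewrite (_ : EFin \o _ = fun x => a%:E * (EFin \o f) x)%E //; apply: integrableZl.
rewrite EFinM -fv -(@integralZl _ _ _ P setT _ (EFin \o f)) //.
Qed.

Lemma mean_cst c : mean (fun=> c) c.
Proof.
have := meanZ c (mean_indic (@measurableT _ T)); rewrite pr_setT mulr1.
by apply: mean_ext => t; rewrite indicE in_setT mulr1.
Qed.

Lemma mean_sum (I : Type) (r : seq I) (Q : pred I) (F : I -> T -> R) (V : I -> R) :
  (forall i, Q i -> mean (F i) (V i)) ->
  mean (fun t => \sum_(i <- r | Q i) F i t) (\sum_(i <- r | Q i) V i).
Proof.
move=> h; elim: r => [|i r IH].
  by rewrite big_nil; apply: mean_ext (mean_cst 0) => t; rewrite big_nil.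
rewrite big_cons; case: ifP => Qi.
  by apply: mean_ext (meanD (h i Qi) IH) => t; rewrite big_cons Qi.
by apply: mean_ext IH => t; rewrite big_cons Qi.
Qed.

Lemma mean_le f g v w : mean f v -> mean g w -> (forall t, f t <= g t) -> v <= w.
Proof.
move=> [fi fv] [gi gw] fg; rewrite -lee_fin -fv -gw.
by apply: le_integral => // t _; rewrite lee_fin.
Qed.

Lemma mean_uniq f v w : mean f v -> mean f w -> v = w.
Proof. by move=> h k; apply/le_anti; rewrite (mean_le h k) // (mean_le k h). Qed.

Lemma mean_norm_le f g v w : mean f v -> mean g w -> (forall t, `|f t| <= g t) -> `|v| <= w.
Proof.
move=> h k fg; rewrite ler_norml; apply/andP; split.
  rewrite lerNl -mulN1r; apply: (mean_le (meanZ (-1) h) k) => t.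
  by rewrite mulN1r; apply: le_trans (fg t); rewrite -normrN ler_norm.
by apply: (mean_le h k) => t; apply: le_trans (fg t); rewrite ler_norm.
Qed.

End Mean.

(** * The law of [Y] at finitely many primes *)

Section LawOfProducts.
Context d (S : measurableType d) (R : realType) (Q : probability S R) (u : nat).
Variable (Y : primes_type -> S -> finZmodType).
Hypothesis hY : lambda_family Q u Y.

Lemma primaryY s : primary (fun p => Y p s).
Proof. by move=> p; have [] := hY. Qed.

Lemma isom_event p (B : finZmodType) :
  sigma_isom (Y p) [set s | zisog (Y p s) B].
Proof.
exists (fun X => zmod_isom X B); split.
  by move=> X X' XX'; apply: zmod_isom_trans; apply: zmod_isom_sym.
by apply/seteqP; split=> s /=; rewrite zmod_isomP.
Qed.

Lemma isom_event_meas p (B : finZmodType) : measurable [set s | zisog (Y p s) B].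
Proof. by have [_ m _ _] := hY; apply: (m p); apply: isom_event. Qed.

Definition sylow_limit (p : primes_type) : R :=
  limn (fun N => \prod_(u.+1 <= k < N) (1 - (prime_of p)%:R ^- k) : R).

Lemma pr_sylow p (B : finZmodType) : (prime_of p).-nat #|B| ->
  pr Q [set s | zisog (Y p s) B] =
  sylow_limit p / (#|B|%:R ^+ u * #|iso B B|%:R).
Proof.
move=> pB; have [_ _ _ /(_ p B pB)] := hY.
rewrite (_ : [set t | _] = [set s | zisog (Y p s) B]); last first.
  by apply/seteqP; split=> s /=; rewrite zmod_isomP.
rewrite (prE _ (isom_event_meas p B)) => -[->]; rewrite mulrC.
by congr (_ / (_ * _%:R)); apply: card_Aut_iso.
Qed.

Lemma pr_sylows (l : seq primes_type) (B : primes_type -> finZmodType) : uniq l ->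
  measurable (\bigcap_(p in [set` l]) [set s | zisog (Y p s) (B p)]) /\
  pr Q (\bigcap_(p in [set` l]) [set s | zisog (Y p s) (B p)]) =
  \prod_(p <- l) pr Q [set s | zisog (Y p s) (B p)].
Proof.
move=> ul; split.
  by apply: fin_bigcap_measurable => // p _; apply: isom_event_meas.
have [_ _ ind _] := hY; pose J := [fset p in l]%fset.
have JE : [set` J] = [set` l] by apply/seteqP; split=> k /=; rewrite inE.
rewrite /pr -JE ind; last by move=> p _; split=> //; apply: isom_event.
rewrite (eq_bigr (fun p => (pr Q [set s | zisog (Y p s) (B p)])%:E)); last first.
  by move=> p _; rewrite prE //; apply: isom_event_meas.
rewrite prodEFin /=; apply: perm_big; apply: uniq_perm => [|//|p]; [exact: fset_uniq|by rewrite inE].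
Qed.

Variable l : seq primes_type.
Hypothesis ul : uniq l.

Definition Yl (s : S) : finZmodType := prodl (fun p => Y p s) l.

Definition lnat (k : nat) : bool := all (fun q => q \in map prime_of l) (primes k).

Lemma lnatP k : (0 < k)%N ->
  reflect (forall q, prime q -> (q %| k)%N -> q \in map prime_of l) (lnat k).
Proof.
move=> k0; apply: (iffP allP) => h q.
  by move=> qp qk; apply: h; rewrite mem_primes qp k0.
by rewrite mem_primes => /and3P[qp _]; apply: h.
Qed.

Lemma lnatM j k : (0 < j)%N -> (0 < k)%N -> lnat (j * k)%N = lnat j && lnat k.
Proof.
move=> j0 k0; have jk : (0 < j * k)%N by rewrite muln_gt0 j0.
apply/(lnatP jk)/andP => [h|[/(lnatP j0) hj /(lnatP k0) hk] q qp].
  split; [apply/(lnatP j0)|apply/(lnatP k0)] => q qp qd; apply: h => //.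
    by rewrite dvdn_mulr.
  by rewrite dvdn_mull.
by rewrite Euclid_dvdM // => /orP[]; [apply: hj|apply: hk].
Qed.

Lemma card_finZmod_gt0 (B : finZmodType) : (0 < #|B|)%N.
Proof. by apply/card_gt0P; exists 0. Qed.

Lemma Yl_lnat s : lnat #|Yl s|.
Proof.
apply/(lnatP (card_finZmod_gt0 _)) => q qp; rewrite card_prodl Euclid_dvd_prod //.
rewrite big_has => /hasP[p pl qd]; apply/mapP; exists p => //.
by have := pnat_dvd qd (primaryY s p); rewrite pnatE // => /eqP.
Qed.

(** The probability of a class [B] of order [k], times [#|Aut B|]. It depends on the order alone,
    and [weight_mul] makes it fit [part_mean_sur]. *)
Definition weight (k : nat) : R :=
  if lnat k then (\prod_(p <- l) sylow_limit p) / k%:R ^+ u else 0.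

Lemma Yl_event (B : finZmodType) : measurable [set s | zisog (Yl s) B] /\
  pr Q [set s | zisog (Yl s) B] = weight #|B| / #|iso B B|%:R.
Proof.
rewrite /weight; case: ifP => [/(lnatP (card_finZmod_gt0 _)) Bl|nB]; last first.
  suff -> : [set s | zisog (Yl s) B] = set0 by rewrite pr_set0 mul0r.
  apply/seteqP; split=> // s /= /zisog_card e.
  by move: nB; rewrite -e Yl_lnat.
have [Bp [pB cB hB]] := primary_decomposition ul Bl.
have eE : [set s | zisog (Yl s) B] = \bigcap_(p in [set` l]) [set s | zisog (Y p s) (Bp p)].
  apply/seteqP; split=> s /=; rewrite /zisog hB; try exact: primaryY.
    move=> h p /= pl; move: h; rewrite lt0n; apply: contraNT; rewrite -leqNgt leqn0 => /eqP e.
    by apply/eqP; rewrite (big_rem p) //= e mul0n.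
  by move=> h; rewrite big_seq; apply: prodn_cond_gt0 => p /h.
rewrite eE; have [m ->] := pr_sylows Bp ul; split=> //.
rewrite (eq_bigr (fun p => sylow_limit p / (#|Bp p|%:R ^+ u * #|iso (Bp p) (Bp p)|%:R))); last first.
  by move=> p _; apply: pr_sylow.
have iB : #|iso B B|%:R = \prod_(p <- l) #|iso (Bp p) (Bp p)|%:R :> R.
  rewrite -natr_prod -hB //; congr (_%:R).
  have i : zisog (prodl Bp l) B.
    by rewrite /zisog hB //; apply: prodn_gt0 => p; apply: zisog_refl.
  by have [_ _ ->] := eq_card_isogl B i.
rewrite iB cB natr_prod -prodrXl big_split /= prodfV -mulrA; congr (_ * _).
by rewrite big_split /= invfM.
Qed.

End LawOfProducts.

Lemma sum_if_lt (R : nmodType) (K x : nat) (y : R) :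
  \sum_(k < K) (if x == k then y else 0) = if (x < K)%N then y else 0.
Proof.
rewrite -big_mkcond /=; case: ltnP => xK.
  by rewrite (big_pred1 (Ordinal xK)) // => k; rewrite -val_eqE eq_sym.
by rewrite big_pred0 // => k; apply: contraTF xK => /eqP->; rewrite -ltnNge.
Qed.

Lemma mul_swap_div (R : fieldType) (x f i s : R) : i != 0 ->
  x * (f / s) = f * i / s * (x / i).
Proof.
by move=> i0; rewrite [f * i / s]mulrAC -[RHS]mulrA [i * _]mulrC divfK // mulrC.
Qed.

(** * Class functions as combinations of isomorphism indicators *)

Section ClassExpansion.
Variable R : realType.
Implicit Types F : finZmodType -> R.

Definition class_fun F := forall B C, zisog B C -> F B = F C.

Lemma indic_bool (S : Type) (p : pred S) s : \1_[set t | p t] s = (p s)%:R :> R.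
Proof. by rewrite indicE; congr ((nat_of_bool _)%:R); apply/idP/idP; rewrite inE. Qed.

(** A class [B] of order [k] occurs [#|sur (free_cover k) B| / #|iso B B|] times among the
    quotients; the coefficient compensates for this multiplicity. *)
Definition class_coeff F k (L : {group free_cover k}) : R :=
  F (quo L) * #|iso (quo L) (quo L)|%:R / #|sur (free_cover k) (quo L)|%:R.

Lemma class_expand F k (B : finZmodType) : class_fun F ->
  \sum_(L : {group free_cover k} | #|quo L| == k) class_coeff F L * (zisog B (quo L))%:R =
  if #|B| == k then F B else 0.
Proof.
move=> Fi; set X := free_cover k.
have e (L : {group X}) : class_coeff F L * (zisog B (quo L))%:R =
    F B / #|sur X B|%:R * #|iso (quo L) B|%:R.
  rewrite card_iso_sym; case: (boolP (zisog B (quo L))) => [i|]; last first.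
    by rewrite /zisog -leqNgt leqn0 => /eqP ->; rewrite !mulr0.
  rewrite mulr1 /class_coeff (Fi _ _ i); have [_ -> _] := eq_card_isogr X i.
  by have [_ _ <-] := eq_card_isogl (quo L) i; rewrite mulrAC.
rewrite (eq_bigr _ (fun L _ => e L)) -mulr_sumr.
have i0 (L : {group X}) : #|quo L| != #|B| -> #|iso (quo L) B| = 0%N.
  by move=> n; apply/eqP; rewrite -leqn0 leqNgt; apply: contra n => /zisog_card/eqP.
case: eqP => [Bk|nk]; last first.
  by rewrite big1 ?mulr0 // => L /eqP Lk; rewrite i0 // Lk eq_sym; apply/eqP.
have -> : \sum_(L : {group X} | #|quo L| == k) #|iso (quo L) B|%:R = #|sur X B|%:R :> R.
  rewrite card_sur_quo natr_sum big_mkcond; apply: eq_bigr => L _.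
  by case: ifP => // n; rewrite i0 // Bk n.
by rewrite mulfVK // pnatr_eq0 -lt0n; apply: sur_free_cover.
Qed.

Context d (T : measurableType d) (P : probability T R) (X : T -> finZmodType).
Hypothesis mX : forall B, measurable [set t | zisog (X t) B].

Lemma mean_order F k : class_fun F ->
  mean P (fun t => if #|X t| == k then F (X t) else 0)
    (\sum_(L : {group free_cover k} | #|quo L| == k)
       class_coeff F L * pr P [set t | zisog (X t) (quo L)]).
Proof.
move=> Fi; apply: mean_ext (mean_sum (F := fun (L : {group free_cover k}) t =>
  class_coeff F L * \1_[set t | zisog (X t) (quo L)] t) _ _) => [t|L _]; last first.
  by apply: meanZ; apply: mean_indic.
rewrite -(class_expand _ _ Fi); apply: eq_bigr => L _.
by rewrite (indic_bool (fun t => zisog (X t) (quo L))).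
Qed.

Lemma mean_bounded F K : class_fun F ->
  mean P (fun t => if (#|X t| < K)%N then F (X t) else 0)
    (\sum_(k < K) \sum_(L : {group free_cover k} | #|quo L| == k)
       class_coeff F L * pr P [set t | zisog (X t) (quo L)]).
Proof.
move=> Fi; apply: mean_ext (mean_sum (F := fun (k : 'I_K) t =>
  if #|X t| == k then F (X t) else 0) _ _) => [t|k _]; first by rewrite sum_if_lt.
exact: mean_order.
Qed.

Lemma class_measurable (C : finZmodType -> Prop) :
  (forall B B', zisog B B' -> C B -> C B') -> measurable [set t | C (X t)].
Proof.
move=> Ci; rewrite (_ : [set t | _] = \bigcup_k \bigcup_(L in
    [set L : {group free_cover k} | C (quo L)]) [set t | zisog (X t) (quo L)]).
  by apply: bigcupT_measurable => k; apply: fin_bigcup_measurable.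
apply/seteqP; split=> t /=; last by case=> k _ [L CL /= i]; apply: Ci CL; rewrite zisog_sym.
move=> Ct; have := sur_free_cover (erefl #|X t|); case/card_gt0P => f fs.
have i : zisog (quo (kerz f)) (X t).
  by apply: (zisog_sur_ker (piz_sur (kerz f)) fs); rewrite ker_piz.
exists #|X t| => //; exists (kerz f) => /=; last by rewrite zisog_sym.
by apply: Ci Ct; rewrite zisog_sym.
Qed.

End ClassExpansion.

Lemma pr_cvg d (T : measurableType d) (R : realType) (P : probability T R)
    (E : nat -> set T) (A : set T) :
  (forall N, measurable (E N)) -> measurable A -> \bigcup_N E N = A ->
  (forall i j, (i <= j)%N -> E i `<=` E j) ->
  pr P (E N) @[N --> \oo] --> pr P A.
Proof.
move=> mE mA EA nd; have := nondecreasing_cvg_mu (mu := P) mE; rewrite EA => /(_ mA) h.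
have /h {}h : nondecreasing_seq E by move=> i j ij; apply/subsetPset; apply: nd.
suff : (fun N => (pr P (E N))%:E) @ \oo --> (pr P A)%:E by move=> /fine_cvg.
rewrite -(prE P mA); apply: cvg_trans h; apply: near_eq_cvg.
by apply: nearW => N /=; rewrite -(prE P (mE N)).
Qed.

Section ClassFunctions.
Context d (S : measurableType d) (R : realType) (Q : probability S R) (u : nat).
Variable (Y : primes_type -> S -> finZmodType).
Hypothesis hY : lambda_family Q u Y.
Variable l : seq primes_type.
Hypothesis ul : uniq l.
Local Notation Z := (Yl Y l).
Local Notation wt := (weight R u l).
Implicit Types F : finZmodType -> R.

Lemma mean_part F k : class_fun F ->
  mean Q (fun s => if #|Z s| == k then F (Z s) else 0) (part_mean wt k F).
Proof.
move=> Fi; have -> : part_mean wt k F = \sum_(L : {group free_cover k} | #|quo L| == k)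
    class_coeff F L * pr Q [set s | zisog (Z s) (quo L)].
  rewrite /part_mean mulr_sumr; apply: eq_bigr => L /eqP Lk.
  have [_ ->] := Yl_event hY ul (quo L); rewrite Lk; apply: mul_swap_div.
  by rewrite pnatr_eq0 -lt0n; apply: zisog_refl.
by apply: mean_order => // B; have [] := Yl_event hY ul B.
Qed.

(** Truncation by order makes every expectation a finite sum, so surjection counts can be averaged
    before their moments are known to be finite. *)
Definition partial_mean F K : R := \sum_(k < K) part_mean wt k F.

Lemma mean_partial F K : class_fun F ->
  mean Q (fun s => if (#|Z s| < K)%N then F (Z s) else 0) (partial_mean F K).
Proof.
move=> Fi; apply: mean_ext (mean_sum (F := fun (k : 'I_K) s =>
  if #|Z s| == k then F (Z s) else 0) _ _) => [s|k _]; first by rewrite sum_if_lt.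
exact: mean_part.
Qed.

Lemma class_meas (C : finZmodType -> Prop) : (forall B B', zisog B B' -> C B -> C B') ->
  measurable [set s | C (Z s)].
Proof. by apply: class_measurable => B; have [] := Yl_event hY ul B. Qed.

Lemma class_cvg (C : finZmodType -> Prop) F : (forall B B', zisog B B' -> C B -> C B') ->
  (forall B, F B = (`[< C B >])%:R) ->
  partial_mean F K @[K --> \oo] --> pr Q [set s | C (Z s)].
Proof.
move=> Ci FC; have Fi : class_fun F.
  move=> B B' i; rewrite !FC; congr ((nat_of_bool _)%:R); apply: asbool_equiv_eq.
  by split; apply: Ci => //; rewrite zisog_sym.
pose E K := [set s | C (Z s) /\ (#|Z s| < K)%N].
have mE K : measurable (E K).
  apply: (class_meas (C := fun B => C B /\ (#|B| < K)%N)) => B B' i [CB].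
  by rewrite (zisog_card i); split=> //; apply: Ci CB.
have pE K : pr Q (E K) = partial_mean F K.
  apply: mean_uniq (mean_indic Q (mE K)) _; apply: mean_ext (mean_partial K Fi) => s.
  rewrite indicE FC; case: (ltnP #|Z s| K) => sK.
    congr ((nat_of_bool _)%:R); apply/asboolP/idP; rewrite inE /E /=; tauto.
  case: (boolP (s \in E K)) => //; rewrite inE => -[_]; by rewrite ltnNge sK.
rewrite -(eq_cvg _ _ pE); apply: pr_cvg => // [||i j ij s [Cs sj]].
- exact: class_meas.
- apply/seteqP; split=> s; first by case=> K _ [].
  by move=> Cs; exists #|Z s|.+1.
by split=> //; apply: leq_trans ij.
Qed.

End ClassFunctions.

(** * Reduction modulo [a] and the moments of [Y] *)

Section ModA.
Variable a : nat.
Hypothesis a_gt0 : (0 < a)%N.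

Definition modz (X : finZmodType) : finZmodType := quo (imz (mulz X a)).

Lemma modz_reduction (X : finZmodType) : reduction a (pi_quo (imz (mulz X a)) : X -> modz X).
Proof.
split; [exact: pi_quoB|exact: pi_quo_surj|move=> x].
split=> [/eqP|[y ->]].
  by rewrite pi_quo_eq0 => /mem_im_mulz[y <-]; exists y.
by apply/eqP; rewrite pi_quo_eq0; apply/mem_im_mulz; exists y.
Qed.

Lemma modz_exp (X : finZmodType) (x : modz X) : x *+ a = 0.
Proof.
have [qB qs qk] := modz_reduction X; have [y <-] := qs x.
by rewrite -(zmorphMn qB); apply/qk; exists y.
Qed.

Lemma tensor_modz (X : finZmodType) (H : zmodType) :
  tensor_Zmod X a H <-> zmod_isom (modz X) H.
Proof.
have [qB qs qk] := modz_reduction X.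
rewrite -(tensor_exp H a_gt0 (@modz_exp X)).
by apply: (tensor_transfer _ _ qB qs) => // x /qk.
Qed.

Lemma modz_zisog (X X' : finZmodType) : zisog X X' -> zisog (modz X) (modz X').
Proof.
move=> i; apply/zmod_isomP; apply/tensor_modz.
case/zisogP: (i) => f fB [g fK gK].
apply/(tensor_transfer (r := f) (X' := X')) => //.
- by move=> x'; exists (g x'); rewrite gK.
- by move=> x; rewrite -(zmorph0 fB) => /(can_inj fK)->; exists 0; rewrite mul0rn.
by apply/tensor_modz; apply: zmod_isom_refl.
Qed.

Lemma card_sur_modz (X V : finZmodType) : (forall x : V, x *+ a = 0) ->
  #|sur (modz X) V| = #|sur X V|.
Proof.
move=> Va; rewrite -sum1_card (big_sur_quo (piz_sur _)) sum1dep_card.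
apply: eq_card => f; rewrite inE andb_idr // => fs; rewrite ker_piz.
apply/fintype.subsetP => x /mem_im_mulz[y <-].
by rewrite mem_kerz ?(sur_hom fs) //; have /surP[fB _] := fs; rewrite (zmorphMn fB) Va.
Qed.

End ModA.

Lemma mean_comb_le d (T : measurableType d) (R : realType) (P : probability T R)
    (I J : finType) (f : T -> R) (g : I -> T -> R) (h : J -> T -> R)
    (c : I -> R) (e : J -> R) v (vg : I -> R) (vh : J -> R) :
  mean P f v -> (forall i, mean P (g i) (vg i)) -> (forall j, mean P (h j) (vh j)) ->
  (forall t, `|f t - \sum_i c i * g i t| <= \sum_j e j * h j t) ->
  `|v - \sum_i c i * vg i| <= \sum_j e j * vh j.
Proof.
move=> mf mg mh b.
have mG := mean_sum (index_enum I) (Q := predT) (fun i _ => meanZ (c i) (mg i)).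
have mH := mean_sum (index_enum J) (Q := predT) (fun j _ => meanZ (e j) (mh j)).
apply: (mean_norm_le _ mH b).
rewrite -mulN1r; apply: mean_ext (meanD mf (meanZ (-1) mG)) => t.
by rewrite mulN1r.
Qed.

Section SurjectionMoments.
Context d (S : measurableType d) (R : realType) (Q : probability S R) (u : nat).
Variable (Y : primes_type -> S -> finZmodType).
Hypothesis hY : lambda_family Q u Y.
Variable l : seq primes_type.
Hypothesis ul : uniq l.
Local Notation Z := (Yl Y l).
Local Notation wt := (weight R u l).
Local Notation part F k := (part_mean wt k F).

Lemma weight_mul g m : (0 < g)%N -> lnat l g -> wt (g * m)%N = g%:R ^- u * wt m.
Proof.
move=> g0 lg; rewrite /weight; have -> : lnat l (g * m)%N = lnat l m.
  by case: (posnP m) => [->|m0]; [rewrite muln0|rewrite lnatM // lg].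
by case: ifP => _; [rewrite natrM exprMn invfM mulrCA|rewrite mulr0].
Qed.

Lemma sur_class_fun (V : finZmodType) : class_fun (fun B => #|sur B V|%:R : R).
Proof. by move=> B C /eq_card_isogl e; have [_ -> _] := e V. Qed.

Lemma part_ge0 F k : class_fun F -> (forall B, 0 <= F B) -> 0 <= part F k.
Proof.
move=> Fi F0; apply: (mean_le (mean_cst Q 0) (mean_part hY ul k Fi)) => s.
by case: ifP.
Qed.

Lemma part_sur (V : finZmodType) k : lnat l #|V| ->
  part (fun B => #|sur B V|%:R) k =
  if (#|V| %| k)%N then #|V|%:R ^- u * part (fun=> 1) (k %/ #|V|)%N else 0.
Proof.
move=> lV; have v0 := card_finZmod_gt0 V; case: ifP => [/dvdnP[m ->]|nd].
  by rewrite mulnK // mulnC; apply: part_mean_sur; apply: weight_mul.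
rewrite /part_mean big1 ?mulr0 // => L /eqP Lk.
rewrite (_ : #|sur (quo L) V| = 0%N) ?mul0r //; apply/eqP; rewrite -leqn0 leqNgt.
apply/negP => /card_gt0P[f /card_ker_sur e].
by move: nd; rewrite -Lk -e dvdn_mulr.
Qed.

Lemma sum_multiples (v N : nat) (f : nat -> R) : (0 < v)%N ->
  \sum_(k < (v * N)%N) (if (v %| k)%N then f (k %/ v)%N else 0) = \sum_(m < N) f m.
Proof.
move=> v0; rewrite -(big_mkord xpredT (fun k => if (v %| k)%N then f (k %/ v)%N else 0)).
elim: N => [|N IH]; first by rewrite muln0 big_geq // big_ord0.
rewrite big_ord_recr /= -IH mulnS addnC (@big_cat_nat _ _ _ (v * N)) ?leq_addr //=.
congr (_ + _); rewrite big_ltn ?dvdn_mulr //; last by rewrite -[X in (X < _)%N]addn0 ltn_add2l.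
rewrite mulKn // big_nat_cond big1 ?addr0 // => k; rewrite andbT => /andP[k1 k2].
case: ifP => // /dvdnP[q qk]; move: k1 k2; rewrite qk [(q * v)%N]mulnC ltn_pmul2l // => h1.
by rewrite -mulnSr ltn_pmul2l // ltnS leqNgt h1.
Qed.

(** By [part_sur] the truncated moment at [v * N] is [v ^- u] times the truncated mass at [N], which
    tends to [1]. Monotonicity squeezes the other [K] between multiples of [v]. *)
Lemma partial_sur_cvg (V : finZmodType) : lnat l #|V| ->
  @partial_mean R u l (fun B => #|sur B V|%:R) K @[K --> \oo] --> (#|V|%:R ^- u : R).
Proof.
move=> lV; have v0 := card_finZmod_gt0 V; set v := #|V| in v0 *.
pose G K : R := @partial_mean R u l (fun B => #|sur B V|%:R) K.
pose tau K : R := @partial_mean R u l (fun=> 1) K.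
have tau1 : tau K @[K --> \oo] --> (1 : R).
  have := class_cvg hY ul (C := fun=> True) (F := fun=> 1) => h.
  rewrite -[X in _ --> X](pr_setT Q); apply: h => // B.
  by rewrite (_ : `[<True>] = true) //; apply/asboolP.
have Gv N : G (v * N)%N = v%:R ^- u * tau N.
  rewrite /G /partial_mean.
  rewrite (eq_bigr (fun k : 'I_(v * N) => if (v %| k)%N then
    v%:R ^- u * part (fun=> 1) (k %/ v)%N else 0)) => [|k _]; last exact: part_sur.
  rewrite (@sum_multiples v N (fun m => v%:R ^- u * part (fun=> 1) m)) //.
  by rewrite -mulr_sumr.
have Gnd i j : (i <= j)%N -> G i <= G j.
  move=> ij; rewrite /G /partial_mean -!(big_mkord xpredT (fun k => part (fun B => #|sur B V|%:R) k)).
  rewrite [leRHS](@big_cat_nat _ _ _ i) //= lerDl sumr_ge0 // => k _.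
  by apply: part_ge0 => //; apply: sur_class_fun.
have lim : v%:R ^- u * tau K @[K --> \oo] --> (v%:R ^- u : R).
  by rewrite -[X in _ --> X]mulr1; apply: cvgMr.
apply: (@squeeze_cvgr _ _ _ _ (fun K => v%:R ^- u * tau (K %/ v)%N) (fun K => v%:R ^- u * tau K)).
- apply: nearW => K; rewrite -!Gv; apply/andP; split; apply: Gnd.
    by rewrite mulnC leq_trunc_div.
  by rewrite leq_pmull.
- apply: (@cvg_comp _ _ _ (divn^~ v) (fun K => v%:R ^- u * tau K) _ _ _ _ lim).
  exact: cvg_divnr.
- exact: lim.
Qed.

(** The certificate is averaged over the groups of order less than [K], and then [K] tends to
    infinity. *)
Lemma partial_bound (a : nat) (H : finZmodType) (I J : finType)
    (V : I -> finZmodType) (W : J -> finZmodType) (c : I -> R) (e : J -> R) :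
  (0 < a)%N ->
  (forall i (x : V i), x *+ a = 0) -> (forall j (x : W j), x *+ a = 0) ->
  (forall i, lnat l #|V i|) -> (forall j, lnat l #|W j|) ->
  (forall X : finZmodType, (forall x : X, x *+ a = 0) ->
     `|(zisog X H)%:R - \sum_i c i * #|sur X (V i)|%:R| <= \sum_j e j * #|sur X (W j)|%:R) ->
  `|pr Q [set s | zisog (modz a (Z s)) H] - \sum_i c i * #|V i|%:R ^- u|
    <= \sum_j e j * #|W j|%:R ^- u.
Proof.
move=> a0 Va Wa lV lW cert.
pose C B := zisog (modz a B) H; pose F B : R := (C B)%:R.
have Ci B B' : zisog B B' -> C B -> C B'.
  by move=> /(modz_zisog a0); rewrite zisog_sym; apply: zisog_trans.
have Fi : class_fun F.
  move=> B B' i; congr ((nat_of_bool _)%:R); apply/idP/idP; apply: Ci => //.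
  by rewrite zisog_sym.
have cF : @partial_mean R u l F K @[K --> \oo] --> pr Q [set s | C (Z s)].
  apply: (class_cvg hY ul (C := fun B => C B)) => // B; congr ((nat_of_bool _)%:R).
  by apply/idP/asboolP.
have b K : `|@partial_mean R u l F K -
      \sum_i c i * @partial_mean R u l (fun B => #|sur B (V i)|%:R) K| <=
    \sum_j e j * @partial_mean R u l (fun B => #|sur B (W j)|%:R) K.
  apply: mean_comb_le (mean_partial hY ul K Fi)
    (fun i => mean_partial hY ul K (sur_class_fun (V i)))
    (fun j => mean_partial hY ul K (sur_class_fun (W j))) _ => s /=.
  case: ifP => _; last by rewrite !big1 ?subr0 ?normr0 // => i _; rewrite mulr0.
  have := cert _ (@modz_exp a (Z s)).
  rewrite (eq_bigr (fun i => c i * #|sur (Z s) (V i)|%:R)) => [|i _]; last first.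
    by rewrite card_sur_modz.
  rewrite [leRHS](eq_bigr (fun j => e j * #|sur (Z s) (W j)|%:R)) // => j _.
  by rewrite card_sur_modz.
have cs (K : finType) (U : K -> finZmodType) (a' : K -> R) : (forall k, lnat l #|U k|) ->
    \sum_k a' k * @partial_mean R u l (fun B => #|sur B (U k)|%:R) N @[N --> \oo] -->
    \sum_k a' k * #|U k|%:R ^- u.
  move=> lU; apply: cvg_big => [|k _]; first exact: add_continuous.
  by apply: cvgMr; apply: partial_sur_cvg.
exact: (ler_cvg_to (cvg_norm (cvgB cF (cs _ _ c lV))) (cs _ _ e lW) (nearW _ b)).
Qed.

End SurjectionMoments.

Lemma product_mulrn (I : Type) (V : I -> zmodType) (y : product_group V) n i :
  (y *+ n) i = y i *+ n.
Proof. by elim: n => // n IH; rewrite mulrS [RHS]mulrS -IH. Qed.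

(** * The product over all primes modulo [a] *)

Section PrimeComponents.
Variable A : primes_type -> finZmodType.
Hypothesis pA : primary A.

Fixpoint proj_l l (x : product_group (fun p => A p : zmodType)) : prodl A l :=
  if l is p :: l' then (x p, proj_l l' x) else 0.

Lemma proj_lB l : zmod_morphism (proj_l l).
Proof.
elim: l => [|p l IH] x y /=; first by rewrite subr0.
by rewrite IH; congr (_, _).
Qed.

Lemma proj_l_ext l x y : (forall p, p \in l -> x p = y p) -> proj_l l x = proj_l l y.
Proof.
elim: l => //= p l IH e; rewrite e ?mem_head // IH // => q ql.
by apply: e; rewrite in_cons ql orbT.
Qed.

Lemma proj_l_surj l z : uniq l -> exists x, proj_l l x = z.
Proof.
elim: l z => [|p l IH] z /=.
  by move=> _; exists 0; apply/val_inj; case: z => -[].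
case: z => z1 z2 /andP[pl /(IH z2)[x ex]]; exists (@eqtype.dfwith primes_type (fun p => A p : Type) x p z1) => /=.
rewrite eqtype.dfwith_in -ex; congr (_, _); apply: proj_l_ext => q ql.
by rewrite eqtype.dfwith_out //; apply: contraNneq pl => ->.
Qed.

Lemma proj_l_eq0 l x p : proj_l l x = 0 -> p \in l -> x p = 0.
Proof.
elim: l => //= q l IH [e1 e2]; rewrite in_cons => /orP[/eqP->//|pl].
exact: IH.
Qed.

Lemma divisible_coprime (V : finZmodType) a (x : V) : coprime #|V| a -> exists y, x = y *+ a.
Proof.
move=> co; have [k _] := Bezoutl a (card_finZmod_gt0 V); rewrite (eqP co) => /dvdnP[j ej].
exists (- (x *+ k)); rewrite mulNrn -mulrnA; apply/eqP; rewrite -addr_eq0 -mulrS.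
by rewrite -add1n ej mulnC mulrnA mulrn_card mul0rn.
Qed.

Definition primes_seq (a : nat) : seq primes_type :=
  pmap (insub : nat -> option {p : nat | prime p}) (primes a).

Lemma primes_seq_uniq a : uniq (primes_seq a).
Proof. exact: (pmap_sub_uniq _ (primes_uniq a)). Qed.

Lemma mem_primes_seq a (p : primes_type) : (p \in primes_seq a) = (prime_of p \in primes a).
Proof. exact: mem_pmap_sub. Qed.

(** Components at primes dividing [a] vanish, and multiplication by [a] is onto on the components at
    the other primes. *)
Lemma proj_kernel a x : (0 < a)%N -> proj_l (primes_seq a) x = 0 -> exists y, x = y *+ a.
Proof.
move=> a0 x0; pose y p := xget 0 [set y : A p | x p = y *+ a].
have yP p : x p = y p *+ a.
  suff [z zP] : exists z, x p = z *+ a.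
    by rewrite /y; case: xgetP => [? _ //|/(_ z)].
  have [pl|pl] := boolP (p \in primes_seq a).
    by exists 0; rewrite mul0rn; apply: proj_l_eq0 x0 pl.
  apply: divisible_coprime; apply: (pnat_coprime (pA p)).
  rewrite /pnat a0; apply/allP => q qa; rewrite !inE.
  by apply: contra pl; rewrite mem_primes_seq => /eqP <-.
exists (y : product_group (fun p => A p : zmodType)).
apply: functional_extensionality_dep => p; rewrite yP.
by rewrite product_mulrn.
Qed.

Lemma tensor_product a (H : zmodType) : (0 < a)%N ->
  tensor_Zmod (product_group (fun p => A p : zmodType)) a H <->
  zmod_isom (modz a (prodl A (primes_seq a))) H.
Proof.
move=> a0; rewrite -tensor_modz //; apply: (tensor_transfer _ _ (@proj_lB _)) => //.
  by move=> z; apply: proj_l_surj; apply: primes_seq_uniq.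
by move=> x; apply: proj_kernel.
Qed.

End PrimeComponents.

(** * Convergence of the probabilities modulo [a] *)

Section Convergence.
Context (R : realType) (u : nat) (w h eps : nat -> R) (alpha1 alpha2 beta : R).
Hypothesis hw : bigO_pow w alpha1.
Hypothesis hh : bigO_pow h alpha2.
Hypothesis heps : bigOmega_pow eps (- beta).
Hypothesis halpha1 : 0 <= alpha1 < 1.
Hypothesis halpha2 : 0 <= alpha2 < 1.
Hypothesis hbeta : 0 <= beta < 1.
Hypothesis hab : 2 * alpha1 + alpha2 < 1 - 2 * beta.
Context (d : nat -> measure_display) (T : forall n, measurableType (d n)).
Variables (P : forall n, probability (T n) R) (M : forall n, T n -> 'M[int]_(n, n + u)).
Hypothesis hM : forall n, (0 < n)%N ->
  balanced_mx (P n) (w n) (h n) (eps n) (@M n).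
Context (d' : measure_display) (S : measurableType d') (Q : probability S R).
Variable (Y : primes_type -> S -> finZmodType).
Hypothesis hY : lambda_family Q u Y.

Lemma M_discrete n : discrete_rv (@M n).
Proof.
case: n => [|n]; last by have [] := hM (ltn0Sn n).
(* The hypothesis [hM] starts at [n = 1]; at [n = 0] there is only one matrix. *)
move=> E [X _ <-]; rewrite (_ : _ @^-1` _ = [set t | X 0]).
  by have [X0|nX0] := pselect (X 0); [rewrite (_ : [set _ | _] = setT)|rewrite (_ : [set _ | _] = set0)];
    rewrite ?measurableT //; apply/seteqP; split.
by apply/seteqP; split=> t /=; rewrite (_ : M t = 0) //; apply/matrixP => -[].
Qed.

Lemma mean_sur_cokmod a (V : finZmodType) n : (0 < a)%N -> (forall x : V, x *+ a = 0) ->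
  mean (P n) (fun t => #|sur (cokmod a (M t)) V|%:R) (moment (P n) (@M n) V).
Proof.
move=> a0 Va; apply: mean_ext (mean_sum (F := fun (F : {ffun 'I_n -> V}) t =>
  \1_[set t | colcomb F (M t) = 0] t) _ _) => [t|F gF]; last first.
  apply: mean_indic; apply: (discrete_rv_meas [set m | colcomb F m = 0]).
  exact: M_discrete.
rewrite card_sur_cokmod // -sum1_card natr_sum big_mkcond [RHS]big_mkcond.
apply: eq_bigr => F _; rewrite inE; case: (genvec F) => //=.
rewrite indicE; case: eqP => [e|ne]; first by rewrite mem_set.
by rewrite memNset.
Qed.

(** The certificate places both probabilities within its error of the same combination of moments.
    The moments of the cokernel tend to [#|V| ^- u], the values that [partial_bound] uses for
    [Y]. *)
Lemma cokmod_cvg a (H : finZmodType) : (0 < a)%N ->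
  pr (P n) [set t | zisog (cokmod a (M t)) H] @[n --> \oo] -->
  pr Q [set s | zisog (modz a (Yl Y (primes_seq a) s)) H].
Proof.
move=> a0; apply/cvgrPdist_lt => e e0.
(* One quarter bounds the error term for [Y], two bound the one for the cokernel, and one is for the
   difference of the main terms. *)
have e4 : 0 < e / 4 by rewrite divr_gt0.
have [L [E [[bt [I [V [c [Va LE _]]]]] [J [W [f [Wa EE fb]]]] cert]]] := certificate H a0 e4.
have lV (U : finZmodType) : (forall x : U, x *+ a = 0) -> lnat (primes_seq a) #|U|.
  move=> Ua; apply/(lnatP _ (card_finZmod_gt0 U)) => q qp qd.
  have qa : q \in primes a.
    rewrite mem_primes qp a0 /=; apply/negPn/negP => na.
    have := exp_coprime (prime_gt0 qp) Ua; rewrite coprime_sym prime_coprime // => /(_ na).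
    by rewrite coprime_sym prime_coprime // qd.
  by apply/mapP; exists (exist _ q qp : primes_type) => //; rewrite mem_primes_seq.
have cert' (X : finZmodType) : (forall x : X, x *+ a = 0) -> `|(zisog X H)%:R - \sum_i c i * #|sur X (V i)|%:R|
    <= \sum_j f j * #|sur X (W j)|%:R.
  by move=> Xa; rewrite -LE -EE; apply: cert.
have bQ := partial_bound hY (primes_seq_uniq a) a0 Va Wa (fun i => lV _ (Va i)) (fun j => lV _ (Wa j)) cert'.
have bP n : `|pr (P n) [set t | zisog (cokmod a (M t)) H] - \sum_i c i * moment (P n) (@M n) (V i)|
    <= \sum_j f j * moment (P n) (@M n) (W j).
  apply: (mean_comb_le (f := fun t => \1_[set t | zisog (cokmod a (M t)) H] t) _
    (fun i => mean_sur_cokmod n a0 (Va i)) (fun j => mean_sur_cokmod n a0 (Wa j))) => [|t].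
    apply: mean_indic; apply: (discrete_rv_meas [set m | zisog (cokmod a m) H]).
    exact: M_discrete.
  rewrite (indic_bool R (fun t => zisog (cokmod a (M t)) H)); apply: cert'.
  exact: cokmod_exp.
have cs (K : finType) (U : K -> finZmodType) (g : K -> R) :
    \sum_k g k * moment (P n) (@M n) (U k) @[n --> \oo] -->
    \sum_k g k * #|U k|%:R ^- u.
  apply: cvg_big => [|k _]; first exact: add_continuous.
  by apply: cvgMr; apply: (moment_cvg hw hh heps halpha1 halpha2 hbeta hab hM).
have fd : \sum_j f j * #|W j|%:R ^- u <= e / 4.
  apply: le_trans fb; apply: ler_sum => j _; apply: le_trans (ler_norm _) _.
  rewrite normrM ler_piMr // ger0_norm ?invr_ge0 ?exprn_ge0 //.
  by rewrite invf_le1 ?exprn_gt0 ?ltr0n ?card_finZmod_gt0 // exprn_ege1 // ler1n card_finZmod_gt0.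
have /cvgrPdist_lt/(_ _ e4) n1 := cs I V c.
have /cvgrPdist_lt/(_ _ e4) n2 := cs J W f.
near=> n.
have := bP n; have : `|\sum_i c i * #|V i|%:R ^- u - \sum_i c i * moment (P n) (@M n) (V i)| < e / 4.
  by near: n.
have : `|\sum_j f j * #|W j|%:R ^- u - \sum_j f j * moment (P n) (@M n) (W j)| < e / 4.
  by near: n.
move: bQ fd; clear.
set q := pr Q _; set p := pr (P n) _; set A := \sum_i _; set B := \sum_i _.
set C := \sum_j _; set D := \sum_j _.
rewrite !ltr_norml !ler_norml => /andP[? ?] ? /andP[? ?] /andP[? ?] /andP[? ?].
by apply/andP; split; lra.
Unshelve. all: by end_near.
Qed.

End Convergence.

(** * Well-behaved groups and continuous functions on them *)

Section WellBehaved.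

Lemma tensor_isom_target (X H H' : zmodType) a : (0 < a)%N -> zmod_isom H H' ->
  tensor_Zmod X a H -> tensor_Zmod X a H'.
Proof.
move=> a0 [f [g fK gK]]; rewrite !tensor_ZmodP // => -[q [qB qs qk]].
have fB : zmod_morphism f by move=> x y; rewrite raddfB.
exists (f \o q); split; first exact: zmorph_comp.
  by move=> h; have [x qx] := qs (g h); exists x; rewrite /= qx gK.
move=> x /=; rewrite -qk; split=> [e|->]; last exact: zmorph0 fB.
by rewrite -[q x]fK e -(zmorph0 fB) fK.
Qed.

(** When [a] divides [b], the group [X / aX] is determined by [X / bX]. *)
Lemma tensor_coarser (X X' K H : zmodType) a b : (0 < a)%N -> (0 < b)%N -> (a %| b)%N ->
  tensor_Zmod X b K -> tensor_Zmod X' b K -> tensor_Zmod X a H -> tensor_Zmod X' a H.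
Proof.
move=> a0 b0 /dvdnP[c bc]; rewrite !(tensor_ZmodP _ _ b0) => -[q rq] [q' rq'].
have h (Y : zmodType) (r : Y -> K) : reduction b r -> tensor_Zmod Y a H <-> tensor_Zmod K a H.
  move=> [rB rs rk]; apply: (tensor_transfer _ a0 rB rs) => x /rk[y ->].
  by exists (y *+ c); rewrite -mulrnA bc.
by move=> /(h _ q rq) t; apply/(h _ q' rq').
Qed.

Lemma finite_well_behaved (B : finZmodType) : well_behaved B.
Proof. by move=> a a0; exists (modz a B); apply/tensor_modz => //; apply: zmod_isom_refl. Qed.

Lemma coker_well_behaved n m (M : 'M[int]_(n, m)) : well_behaved (coker M).
Proof. by move=> a a0; exists (cokmod a M); apply/tensor_coker => //; apply: zmod_isom_refl. Qed.

Lemma product_well_behaved A : primary A -> well_behaved (product_group (fun p => A p : zmodType)).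
Proof.
move=> pA a a0; exists (modz a (prodl A (primes_seq a))).
by apply/tensor_product => //; apply: zmod_isom_refl.
Qed.

Context (R : realType) (f : zmodType -> R).
Hypothesis fc : wb_continuous f.

Lemma wb_continuous_near (X : zmodType) e : well_behaved X -> 0 < e ->
  exists (a : nat) (H : finZmodType), [/\ (0 < a)%N, tensor_Zmod X a H &
    forall X', well_behaved X' -> tensor_Zmod X' a H -> `|f X - f X'| < e].
Proof.
move=> wX e0; have /fc/(_ X wX) : open (ball (f X) e) by exact: ball_open.
move=> /(_ (ballxx _ e0))[a [H [a0 _ [_ XH] h]]].
by exists a, H; split=> // X' wX' X'H; have := h X' (conj wX' X'H); rewrite -ball_normE.
Qed.

Lemma wb_continuous_isom (B B' : finZmodType) : zisog B B' -> f B = f B'.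
Proof.
move=> i; apply/eqP; rewrite -subr_eq0 -normr_eq0; apply/eqP/le_anti; rewrite normr_ge0 andbT.
apply/ler_addgt0Pl => e e0; rewrite addr0.
have [a [H [a0 BH h]]] := wb_continuous_near (@finite_well_behaved B) e0.
apply/ltW/h; first exact: finite_well_behaved.
apply/tensor_modz => //; move/tensor_modz: BH => /(_ a0); apply: zmod_isom_trans.
by apply/zmod_isomP/modz_zisog => //; rewrite zisog_sym.
Qed.

(** The oscillation of [f] on the basic open set of level [b] at [B]. *)
Definition tame b e (B : finZmodType) : Prop := forall X X', well_behaved X -> well_behaved X' ->
  tensor_Zmod X b B -> tensor_Zmod X' b B -> `|f X - f X'| <= e.

Lemma tame_isom b e (B B' : finZmodType) : (0 < b)%N -> zisog B B' -> tame b e B -> tame b e B'.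
Proof.
move=> b0 i tB X X' wX wX' XB XB'; apply: tB => //.
  by apply: tensor_isom_target XB => //; apply/zmod_isomP; rewrite zisog_sym.
by apply: tensor_isom_target XB' => //; apply/zmod_isomP; rewrite zisog_sym.
Qed.

(** Some basic neighbourhood of [X], of level [a], keeps [f] within [e / 2] of [f X], and it
    contains the one of level [N!] once [a <= N]. Factorials thus serve as a cofinal chain of
    levels. *)
Lemma eventually_tame (X : zmodType) e : well_behaved X -> 0 < e ->
  exists N0, forall N, (N0 <= N)%N -> forall B : finZmodType,
    tensor_Zmod X N`! B -> tame N`! e B.
Proof.
move=> wX e0; have e2 : 0 < e / 2 by rewrite divr_gt0.
have [a [H [a0 XH h]]] := wb_continuous_near wX e2.
exists a => N aN B XB X1 X2 w1 w2 B1 B2.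
have aN' : (a %| N`!)%N by apply: dvdn_fact; rewrite a0.
have N0 := fact_gt0 N.
have h1 := h X1 w1 (tensor_coarser a0 N0 aN' XB B1 XH).
have h2 := h X2 w2 (tensor_coarser a0 N0 aN' XB B2 XH).
have -> : f X1 - f X2 = (f X - f X2) - (f X - f X1) by rewrite opprB [RHS]addrC addrA subrK.
apply: le_trans (ler_normB _ _) _; move: h1 h2; clear; set u := `|_|; set v := `|_|; lra.
Qed.

Lemma wb_measurable d (T : measurableType d) (X : T -> zmodType) :
  random_wb_group X -> measurable_fun setT (fun t => f (X t)).
Proof.
move=> [wX oX]; apply: (measurability _ (measurable_realfun.RGenOInfty.measurableE R)) => _ [_ [x ->] <-].
rewrite setTI; apply: (oX (fun A => `]x, +oo[%classic (f A))); apply: fc.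
exact: interval_open.
Qed.

Lemma wb_mean d (T : measurableType d) (P : probability T R) (X : T -> zmodType) C :
  random_wb_group X -> (forall t, `|f (X t)| <= C) ->
  exists v, mean P (fun t => f (X t)) v /\ ('E_P[fun t => f (X t)] = v%:E)%E.
Proof.
move=> rX fC; have i : P.-integrable setT (EFin \o (fun t => f (X t))).
  apply: measurable_bounded_integrable => //.
  - by apply: (le_lt_trans (@probability_le1 _ _ _ P setT measurableT)); apply: ltry.
  - exact: wb_measurable.
  by exists C; split; [rewrite num_real|move=> x Cx t _; apply: le_trans (ltW Cx)].
have fin := integrable_fin_num measurableT i.
exists (fine (\int[P]_t (f (X t))%:E)%E); rewrite /mean fineK //.
by split=> //; rewrite unlock.
Qed.

End WellBehaved.

(** * Approximation of continuous functions by class functions *)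

Section Truncation.
Variables (R : realType) (f : zmodType -> R).
Hypothesis fc : wb_continuous f.
Variables (b K : nat) (e C : R).
Hypothesis b_gt0 : (0 < b)%N.
Hypothesis e_ge0 : 0 <= e.

Definition tame_ind (B : finZmodType) : R := (`[< tame f b e B >])%:R.

Lemma tame_ind_class : class_fun tame_ind.
Proof.
move=> B B' i; congr ((nat_of_bool _)%:R); apply: asbool_equiv_eq.
by split; apply: tame_isom => //; rewrite zisog_sym.
Qed.

Lemma tame_val_class : class_fun (fun B => tame_ind B * f B).
Proof. by move=> B B' i; rewrite (tame_ind_class i) (wb_continuous_isom fc i). Qed.

(** The mean over the groups of order less than [K], when [p B] is the
    probability of the isomorphism class of [B]. *)
Definition bounded_mean (F p : finZmodType -> R) : R :=
  \sum_(k < K) \sum_(L : {group free_cover k} | #|quo L| == k)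
    class_coeff F L * p (quo L).

(** Where [B t] is tame and of order less than [K], [f (X t)] is within [e] of [f (B t)], because
    [B t] lies in its own basic open set of level [b]. Elsewhere the error is at most [C], on an
    event of probability [1 - bounded_mean tame_ind p]. *)
Lemma truncation_bound d (T : measurableType d) (P : probability T R)
    (X : T -> zmodType) (B : T -> finZmodType) v :
  (forall t, well_behaved (X t)) -> (forall t, `|f (X t)| <= C) ->
  (forall t, tensor_Zmod (X t) b (B t)) -> (forall t (x : B t), x *+ b = 0) ->
  (forall H, measurable [set t | zisog (B t) H]) -> mean P (fun t => f (X t)) v ->
  let p H := pr P [set t | zisog (B t) H] in
  is_true (`|v - bounded_mean (fun B => tame_ind B * f B) p| <=
    e + C * (1 - bounded_mean tame_ind p)).
Proof.
move=> wX fX XB Bb mB mf p.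
have m1 := mean_bounded P mB K tame_ind_class.
have m2 := mean_bounded P mB K tame_val_class.
have mr := meanD (mean_cst P e) (meanZ C (meanD (mean_cst P 1) (meanZ (-1) m1))).
have ml := meanD mf (meanZ (-1) m2).
rewrite mulN1r in mr; rewrite mulN1r in ml; apply: (mean_norm_le ml mr) => t.
rewrite !mulN1r; case: ifP => _; last by rewrite !subr0 mulr1 ler_wpDl.
rewrite /tame_ind; case: asboolP => [tB|_]; last first.
  by rewrite mul0r !subr0 mulr1 ler_wpDl.
rewrite mul1r subrr mulr0 addr0; apply: tB => //; first exact: finite_well_behaved.
exact/(tensor_exp _ b_gt0 (Bb t))/zmod_isom_refl.
Qed.

End Truncation.

Lemma triangle_bound (R : realFieldType) (e C eta x y m m' v v' : R) : 0 <= C -> 0 < e ->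
  e * (4 * (1 + C)) = eta -> `|x - v| <= e + C * (1 - m) -> `|y - v'| <= e + C * (1 - m') ->
  1 - e < m -> `|m - m'| < e -> `|v - v'| < e -> `|x - y| < eta.
Proof.
move=> C0 e0 eE bx by' hm hmm hv.
have -> : x - y = (x - v) - (y - v') + (v - v') by ring.
have m1 : C * (1 - m) <= C * e by apply: ler_wpM2l => //; lra.
have m2 : C * (1 - m') <= C * (2 * e).
  by apply: ler_wpM2l => //; move: hmm; rewrite ltr_norml => /andP[_ ?]; lra.
apply: le_lt_trans (ler_normD _ _) _; have n1 := ler_normB (x - v) (y - v').
have ce : 0 <= C * e by rewrite mulr_ge0 // ltW.
have -> : eta = 4 * e + 4 * (C * e) by rewrite -eE; ring.
have e2 : C * (2 * e) = 2 * (C * e) by ring.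
move: bx by' hv n1 m1 m2 ce e0; rewrite e2.
by move: `|x - v| `|y - v'| `|v - v'| `|_ - _ - _| (C * (1 - m)) (C * (1 - m')) (C * e) => *; lra.
Qed.

(** * Weak convergence of the cokernels *)

Section WeakLimit.
Context (R : realType) (u : nat) (w h eps : nat -> R) (alpha1 alpha2 beta : R).
Hypothesis hw : bigO_pow w alpha1.
Hypothesis hh : bigO_pow h alpha2.
Hypothesis heps : bigOmega_pow eps (- beta).
Hypothesis halpha1 : 0 <= alpha1 < 1.
Hypothesis halpha2 : 0 <= alpha2 < 1.
Hypothesis hbeta : 0 <= beta < 1.
Hypothesis hab : 2 * alpha1 + alpha2 < 1 - 2 * beta.
Context (d : nat -> measure_display) (T : forall n, measurableType (d n)).
Variables (P : forall n, probability (T n) R) (M : forall n, T n -> 'M[int]_(n, n + u)).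
Hypothesis hM : forall n, (0 < n)%N ->
  balanced_mx (P n) (w n) (h n) (eps n) (@M n).
Context (d' : measure_display) (S : measurableType d') (Q : probability S R).
Variable (Y : primes_type -> S -> finZmodType).
Hypothesis hY : lambda_family Q u Y.

Let Zm a s := modz a (Yl Y (primes_seq a) s).

Lemma coker_event_meas a n (H : finZmodType) :
  measurable [set t | zisog (cokmod a (@M n t)) H].
Proof.
apply: (discrete_rv_meas [set m | zisog (cokmod a m) H]).
exact: (M_discrete hM).
Qed.

Lemma product_event_meas a (H : finZmodType) : (0 < a)%N ->
  measurable [set s | zisog (Zm a s) H].
Proof.
move=> a0; apply: (class_meas hY (primes_seq_uniq a) (C := fun B => zisog (modz a B) H)).
by move=> B B' /(modz_zisog a0); rewrite zisog_sym; apply: zisog_trans.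
Qed.

Lemma tensor_coker_isog a n t (H H' : zmodType) : (0 < a)%N -> zmod_isom H' H ->
  tensor_Zmod (coker (@M n t)) a H <-> zmod_isom (cokmod a (M t)) H'.
Proof.
move=> a0 i; rewrite tensor_coker //; split=> j; apply: zmod_isom_trans j _ => //.
exact: zmod_isom_sym.
Qed.

Lemma tensor_product_isog a s (H H' : zmodType) : (0 < a)%N -> zmod_isom H' H ->
  tensor_Zmod (product_Y Y s) a H <-> zmod_isom (Zm a s) H'.
Proof.
move=> a0 i; rewrite (tensor_product (primaryY hY s)) //.
split=> j; apply: zmod_isom_trans j _ => //; exact: zmod_isom_sym.
Qed.

Lemma coker_random n : random_wb_group (fun t => coker (@M n t)).
Proof.
split=> [t|O _]; first exact: coker_well_behaved.
apply: (discrete_rv_meas [set m | O (coker m)]); exact: (M_discrete hM).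
Qed.

(** On well-behaved groups an open class is a union of basic ones, and up to isomorphism these are
    countably many: a level [a] and a quotient of some [free_cover k]. *)
Lemma product_random : random_wb_group (product_Y Y).
Proof.
have wY s : well_behaved (product_Y Y s) by apply/product_well_behaved/(primaryY hY).
split=> // O oO.
pose U a k (L : {group free_cover k}) :=
  (0 < a)%N /\ forall X, basic_open a (quo L) X -> O X.
rewrite (_ : [set t | _] = \bigcup_a \bigcup_k \bigcup_(L in
    [set L : {group free_cover k} | U a k L]) [set s | zisog (Zm a s) (quo L)]).
  apply: bigcupT_measurable => a; apply: bigcupT_measurable => k.
  by apply: fin_bigcup_measurable => // L [a0 _]; apply: product_event_meas.
apply/seteqP; split=> s /=; last first.
  case=> a _ [k _ [L [a0 UL] /= i]]; apply: UL; split=> //.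
  by apply/(tensor_product_isog s a0 (zmod_isom_refl _))/zmod_isomP.
move=> /(oO _ (wY s))[a [H [a0 Ha [_ sH] UH]]].
have := sur_free_cover (erefl #|H|); case/card_gt0P => g gs.
have i : zisog (quo (kerz g)) H.
  by apply: (zisog_sur_ker (piz_sur (kerz g)) gs); rewrite ker_piz.
exists a => //; exists #|H| => //; exists (kerz g).
  split=> // X [wX XL]; apply: UH; split=> //.
  by apply: tensor_isom_target XL => //; apply/zmod_isomP.
have /zmod_isomP j := i.
by have /zmod_isomP := (tensor_product_isog s a0 j).1 sH.
Qed.

Lemma prob_cvg a (H : zmodType) : (0 < a)%N -> exponent_dvd H a ->
  P n [set t | tensor_Zmod (coker (M t)) a H] @[n --> \oo]
    --> Q [set s | tensor_Zmod (product_Y Y s) a H].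
Proof.
(* An [H] isomorphic to no finite group has probability [0] on both sides. *)
move=> a0 _; have [[H' i]|nH] := pselect (exists H' : finZmodType, zmod_isom H' H); last first.
  have eP n : P n [set t | tensor_Zmod (coker (M t)) a H] = 0%E.
    rewrite (_ : [set t | _] = set0) ?measure0 //; apply/seteqP; split=> // t /=.
    by move/(tensor_coker _ a0) => j; apply: nH; exists (cokmod a (M t)).
  have eQ : Q [set s | tensor_Zmod (product_Y Y s) a H] = 0%E.
    rewrite (_ : [set t | _] = set0) ?measure0 //; apply/seteqP; split=> // s /=.
    by move/(tensor_product (primaryY hY s) _ a0) => j; apply: nH; exists (Zm a s).
  rewrite eQ (eq_cvg _ _ eP); exact: cvg_cst.
have eP n : P n [set t | tensor_Zmod (coker (M t)) a H] =
    (pr (P n) [set t | zisog (cokmod a (M t)) H'])%:E.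
  rewrite -(prE (P n) (coker_event_meas a n H')); congr (P n _).
  by apply/seteqP; split=> t /=; rewrite (tensor_coker_isog t a0 i) zmod_isomP.
have eQ : Q [set s | tensor_Zmod (product_Y Y s) a H] =
    (pr Q [set s | zisog (Zm a s) H'])%:E.
  rewrite -(prE Q (product_event_meas H' a0)); congr (Q _).
  by apply/seteqP; split=> s /=; rewrite (tensor_product_isog s a0 i) zmod_isomP.
rewrite eQ (eq_cvg _ _ eP); apply: cvg_EFin; first exact: nearW.
exact: (cokmod_cvg hw hh heps halpha1 halpha2 hbeta hab hM hY a0).
Qed.

(** Every value of [product_Y Y] is tame at all large factorial levels. Continuity from below
    therefore gives one level that works with probability above [1 - e], and, applied once more, one
    bound [K] on the orders. *)
Lemma exists_tame (f : zmodType -> R) e : wb_continuous f -> 0 < e ->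
  exists b K, [/\ (0 < b)%N & 1 - e <
    bounded_mean K (tame_ind f b e) (fun H => pr Q [set s | zisog (Zm b s) H])].
Proof.
move=> fc e0; pose G N := [set s | tame f N`! e (Zm N`! s)].
have mtame N : forall B B', zisog B B' -> tame f N`! e B -> tame f N`! e B'.
  by move=> B B'; apply: tame_isom; apply: fact_gt0.
have mG N : measurable (G N).
  apply: (@class_measurable _ _ (Zm N`!) _ (tame f N`! e)) (mtame N) => H.
  by apply: product_event_meas; apply: fact_gt0.
pose E N := \bigcap_(m in [set m | (N <= m)%N]) G m.
have mE N : measurable (E N) by apply: bigcap_measurable => //; exists N => /=.
have EE : \bigcup_N E N = setT.
  apply/seteqP; split=> // s _.
  have [|N0 hN] := eventually_tame fc (X := product_Y Y s) _ e0.
    by apply/product_well_behaved/(primaryY hY).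
  exists N0 => // N /= /hN; apply; apply/(tensor_product_isog s _ (zmod_isom_refl _)).
    exact: fact_gt0.
  exact: zmod_isom_refl.
have nd i j : (i <= j)%N -> E i `<=` E j.
  by move=> ij s Es m /= jm; apply: Es; apply: leq_trans jm.
have cE : pr Q (E N) @[N --> \oo] --> (1 : R).
  by rewrite -(pr_setT Q); apply: pr_cvg.
have [N hN] : exists N, 1 - e < pr Q (E N).
  have /cvgrPdist_lt/(_ _ e0)[N _ /(_ N (leqnn N)) /=] := cE.
  by rewrite ltr_norml => /andP[_]; rewrite ltrBlDr -ltrBlDl => hN; exists N.
have {}hN : 1 - e < pr Q (G N).
  by apply: lt_le_trans hN _; apply: pr_le => // s Es; apply: Es => /=.
pose F K := [set s | tame f N`! e (Zm N`! s) /\ (#|Zm N`! s| < K)%N].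
have mF K : measurable (F K).
  apply: (@class_measurable _ _ (Zm N`!) _
    (fun B => tame f N`! e B /\ (#|B| < K)%N)) => [H|B B' i [tB cB]].
    by apply: product_event_meas; apply: fact_gt0.
  by rewrite -(zisog_card i); split=> //; apply: mtame i tB.
have FE : \bigcup_K F K = G N.
  apply/seteqP; split=> s; first by case=> K _ [].
  by move=> Gs; exists #|Zm N`! s|.+1.
have cF : pr Q (F K) @[K --> \oo] --> pr Q (G N).
  by apply: pr_cvg => // i j ij s [ts sj]; split=> //; apply: leq_trans ij.
have [K hK] : exists K, 1 - e < pr Q (F K).
  have d0 : 0 < pr Q (G N) - (1 - e) by rewrite subr_gt0.
  have /cvgrPdist_lt/(_ _ d0)[K _ /(_ K (leqnn K)) /=] := cF.
  by rewrite ltr_norml => /andP[_]; rewrite ltrD2l ltrN2 => hK; exists K.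
exists N`!, K; split; first exact: fact_gt0.
suff -> : bounded_mean K (tame_ind f N`! e) (fun H => pr Q [set s | zisog (Zm N`! s) H]) = pr Q (F K) by [].
have mZ H : measurable [set s | zisog (Zm N`! s) H].
  by apply: product_event_meas; apply: fact_gt0.
have mb := mean_bounded Q mZ K (tame_ind_class f e (fact_gt0 N)).
apply: mean_uniq (mean_indic Q (mF K)); apply: mean_ext mb => s.
rewrite indicE /tame_ind; case: (ltnP #|Zm N`! s| K) => sK.
  congr ((nat_of_bool _)%:R); apply/asboolP/idP; rewrite inE /F /=; tauto.
by case: (boolP (s \in F K)) => //; rewrite inE => -[_]; rewrite ltnNge sK.
Qed.

(** Both expectations are truncated at the same [b] and [K]; the truncated means are finite
    combinations of probabilities that converge by [cokmod_cvg]. Tameness with high probability is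
    established for the limit and passes to the cokernels by this convergence. *)
Lemma expectation_cvg (f : zmodType -> R) : wb_bounded f -> wb_continuous f ->
  ('E_(P n)[fun t => f (coker (M t))] @[n --> \oo] --> 'E_Q[fun s => f (product_Y Y s)])%E.
Proof.
move=> [C fC] fc.
have C0 : 0 <= C by apply: le_trans (fC _ (@finite_well_behaved 'I_1)); apply: normr_ge0.
have fX n t : `|f (coker (@M n t))| <= C by apply/fC/coker_well_behaved.
have fY s : `|f (product_Y Y s)| <= C by apply/fC/product_well_behaved/(primaryY hY).
have /choice[v hv] : forall n, exists v, mean (P n) (fun t => f (coker (M t))) v /\
    ('E_(P n)[fun t => f (coker (M t))] = v%:E)%E.
  by move=> n; apply: (wb_mean fc (P n) (coker_random n) (C := C)).
have [vQ [mQ eQ]] := wb_mean fc Q product_random fY.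
rewrite eQ (eq_cvg _ _ (fun n => (hv n).2)); apply: cvg_EFin; first exact: nearW.
apply/cvgrPdist_lt => eta eta0; have C1 : 0 < 4 * (1 + C) by rewrite mulr_gt0 // ltr_wpDr.
(* The errors collected in [triangle_bound] stay below [4 e (1 + C)]. *)
pose e := eta / (4 * (1 + C)); have e0 : 0 < e by rewrite divr_gt0.
have [b [K [b0 hK]]] := exists_tame fc e0.
pose p n H := pr (P n) [set t | zisog (cokmod b (M t)) H].
pose q H := pr Q [set s | zisog (Zm b s) H].
have cp F : bounded_mean K F (p n) @[n --> \oo] --> bounded_mean K F q.
  apply: cvg_big => [|k _]; first exact: add_continuous.
  apply: cvg_big => [|L _]; first exact: add_continuous.
  by apply: cvgMr; exact: (cokmod_cvg hw hh heps halpha1 halpha2 hbeta hab hM hY b0).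
have bQ : `|vQ - bounded_mean K (fun B => tame_ind f b e B * f B) q| <=
    e + C * (1 - bounded_mean K (tame_ind f b e) q).
  apply: (@truncation_bound R f fc b K e C b0 (ltW e0) _ _ Q (product_Y Y) (Zm b)) => //.
  - by move=> s; apply/product_well_behaved/(primaryY hY).
  - by move=> s; apply/(tensor_product_isog s b0 (zmod_isom_refl _))/zmod_isom_refl.
  - by move=> s; apply: modz_exp.
  by move=> H; apply: product_event_meas.
have bP n : `|v n - bounded_mean K (fun B => tame_ind f b e B * f B) (p n)| <=
    e + C * (1 - bounded_mean K (tame_ind f b e) (p n)).
  apply: (@truncation_bound R f fc b K e C b0 (ltW e0) _ _ (P n) (fun t => coker (M t))
    (fun t => cokmod b (M t))) => //.
  - by move=> t; apply: coker_well_behaved.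
  - by move=> t; apply/tensor_coker => //; apply: zmod_isom_refl.
  - by move=> t; apply: cokmod_exp.
  - by move=> H; apply: coker_event_meas.
  exact: (hv n).1.
have /cvgrPdist_lt/(_ _ e0) n1 := cp (tame_ind f b e).
have /cvgrPdist_lt/(_ _ e0) n2 := cp (fun B => tame_ind f b e B * f B).
near=> n.
have h1 : `|bounded_mean K (tame_ind f b e) q - bounded_mean K (tame_ind f b e) (p n)| < e.
  by near: n.
have h2 : `|bounded_mean K (fun B => tame_ind f b e B * f B) q -
    bounded_mean K (fun B => tame_ind f b e B * f B) (p n)| < e by near: n.
have eE : e * (4 * (1 + C)) = eta by rewrite divfK // gt_eqF.
exact: (@triangle_bound R e C eta _ _ _ _ _ _ C0 e0 eE bQ (bP n) hK h1 h2).
Unshelve. all: by end_near.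
Qed.

End WeakLimit.

Theorem theorem1p2 (R : realType) (u : nat) (w h eps : nat -> R)
    (alpha1 alpha2 beta : R)
    (hw : bigO_pow w alpha1) (hh : bigO_pow h alpha2)
    (heps : bigOmega_pow eps (- beta))
    (halpha1 : 0 <= alpha1 < 1) (halpha2 : 0 <= alpha2 < 1)
    (hbeta : 0 <= beta < 1)
    (hab : 2 * alpha1 + alpha2 < 1 - 2 * beta)
    (d : nat -> measure_display) (T : forall n, measurableType (d n))
    (P : forall n, probability (T n) R)
    (M : forall n, T n -> 'M[int]_(n, n + u))
    (hM : forall n, (0 < n)%N ->
       balanced_mx (P n) (w n) (h n) (eps n) (M n))
    (d' : measure_display) (S : measurableType d') (Q : probability S R)
    (Y : primes_type -> S -> finZmodType) (hY : lambda_family Q u Y) :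
  weak_convergence P (fun n t => coker (M n t)) Q (product_Y Y) /\
  (forall (a : nat) (H : zmodType), (0 < a)%N -> exponent_dvd H a ->
     P n [set t | tensor_Zmod (coker (M n t)) a H] @[n --> \oo]
       --> Q [set s | tensor_Zmod (product_Y Y s) a H]).
Proof.
split; last by move=> a H a0 Ha; exact: (prob_cvg hw hh heps halpha1 halpha2 hbeta hab hM hY a0 Ha).
split; first exact: (coker_random hM).
- exact: (product_random hY).
- by move=> f fb fc; exact: (expectation_cvg hw hh heps halpha1 halpha2 hbeta hab hM hY fb fc).
Qed.
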